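(* Let $G$ be a finite group and let $(K,\Delta,\Sigma)$ be a $G$-differential field of characteristic zero such that $(K,\Sigma)$ is strict. Then the following are equivalent: (1) $(K,\Delta,\Sigma)\models G\text{-}\mathrm{DCF}_{0,m}$; (2) $(K^G,\Delta)$ is $K$-strongly PAC-differential; (3) $(K^G,\Delta)$ is PAC-differential and $(K,\Sigma)$ is algebraically $G$-closed.
   Context: A $G$-differential field is a field with $m$ commuting derivations $\Delta$ and a group homomorphism $g\mapsto\sigma_g$ from $G$ into the automorphisms commuting with $\Delta$; $\Sigma=\{\sigma_g\}$; $K^G$ is the subfield of invariants. $G\text{-}\mathrm{DCF}_{0,m}$ is the model companion (which exists) of the theory of $G$-differential fields of characteristic $0$; its models are the existentially closed ones. $(K,\Sigma)$ is strict if $[K:K^G]=|G|$ (equivalently the action is faithful), and algebraically $G$-closed if the $G$-action does not extend to any proper algebraic field extension of $K$. $(F,\Delta)$ is PAC-differential if every absolutely irreducible differential variety over $F$ has an $F$-rational point; for an extension $(K,\Delta)/(F,\Delta)$, $(F,\Delta)$ is $K$-strongly PAC-differential if every differential variety over $F$ that is $K$-irreducible has a differential $F$-rational point. *)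

(* Defs.v *)
From HB Require Import structures.
From mathcomp Require Import all_boot all_order all_algebra all_fingroup.
From Stdlib Require Import List.
Set Implicit Arguments. Unset Strict Implicit. Unset Printing Implicit Defensive.
Import GRing.Theory.
Local Open Scope ring_scope.

Definition is_derivation (L : fieldType) (d : L -> L) : Prop :=
  (forall x y, d (x + y) = d x + d y) /\ (forall x y, d (x * y) = d x * y + x * d y).

Definition is_diff_field (L : fieldType) (m : nat) (D : 'I_m -> L -> L) : Prop :=
  (forall j, is_derivation (D j)) /\ (forall j k x, D j (D k x) = D k (D j x)).

Definition is_G_action (G : finGroupType) (L : fieldType) (s : G -> {rmorphism L -> L}) : Prop :=
  (forall x, s 1%g x = x) /\ (forall g h x, s (g * h)%g x = s g (s h x)).

Definition G_diff_field (G : finGroupType) (L : fieldType) (m : nat)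
  (D : 'I_m -> L -> L) (s : G -> {rmorphism L -> L}) : Prop :=
  [pchar L] =i pred0 /\ is_diff_field D /\ is_G_action s /\
  (forall g j x, s g (D j x) = D j (s g x)).

Definition diff_emb (K L : fieldType) (m : nat) (D : 'I_m -> K -> K) (DL : 'I_m -> L -> L)
  (i : {rmorphism K -> L}) : Prop :=
  forall j x, i (D j x) = DL j (i x).

Definition G_diff_emb (G : finGroupType) (K L : fieldType) (m : nat)
  (D : 'I_m -> K -> K) (s : G -> {rmorphism K -> K})
  (DL : 'I_m -> L -> L) (t : G -> {rmorphism L -> L}) (i : {rmorphism K -> L}) : Prop :=
  diff_emb D DL i /\ (forall g x, i (s g x) = t g (i x)).

Definition fixed_field (G : finGroupType) (K : fieldType) (s : G -> {rmorphism K -> K})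
  (x : K) : Prop := forall g, s g x = x.

Inductive dterm (C : Type) (n m : nat) : Type :=
| DVar of 'I_n
| DCst of C
| DAdd of dterm C n m & dterm C n m
| DOpp of dterm C n m
| DMul of dterm C n m & dterm C n m
| DDer of 'I_m & dterm C n m.

Fixpoint deval (C : Type) (L : fieldType) (n m : nat) (f : C -> L)
  (D : 'I_m -> L -> L) (a : 'I_n -> L) (p : dterm C n m) : L :=
  match p with
  | DVar i => a i
  | DCst c => f c
  | DAdd p q => deval f D a p + deval f D a q
  | DOpp p => - deval f D a p
  | DMul p q => deval f D a p * deval f D a q
  | DDer j p => D j (deval f D a p)
  end.

Fixpoint dcoeffs_in (C : Type) (n m : nat) (P : C -> Prop) (p : dterm C n m) : Prop :=
  match p with
  | DVar _ => True
  | DCst c => P c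
  | DAdd p q => dcoeffs_in P p /\ dcoeffs_in P q
  | DOpp p => dcoeffs_in P p
  | DMul p q => dcoeffs_in P p /\ dcoeffs_in P q
  | DDer _ p => dcoeffs_in P p
  end.

Inductive gdterm (C : Type) (G : Type) (n m : nat) : Type :=
| GVar of 'I_n
| GCst of C
| GAdd of gdterm C G n m & gdterm C G n m
| GOpp of gdterm C G n m
| GMul of gdterm C G n m & gdterm C G n m
| GDer of 'I_m & gdterm C G n m
| GSig of G & gdterm C G n m.

Fixpoint gdeval (C : Type) (G : finGroupType) (L : fieldType) (n m : nat) (f : C -> L)
  (D : 'I_m -> L -> L) (s : G -> {rmorphism L -> L}) (a : 'I_n -> L)
  (p : gdterm C G n m) : L :=
  match p with
  | GVar i => a i
  | GCst c => f c
  | GAdd p q => gdeval f D s a p + gdeval f D s a q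
  | GOpp p => - gdeval f D s a p
  | GMul p q => gdeval f D s a p * gdeval f D s a q
  | GDer j p => D j (gdeval f D s a p)
  | GSig g p => s g (gdeval f D s a p)
  end.

(* (K, D, s) is an existentially closed G-differential field of char. 0,
   i.e. a model of G-DCF_{0,m}: every finite system of G-differential
   equations and inequations over K solvable in a G-differential field
   extension is solvable in K. *)
Definition ec_G_diff_field (G : finGroupType) (K : fieldType) (m : nat)
  (D : 'I_m -> K -> K) (s : G -> {rmorphism K -> K}) : Prop :=
  G_diff_field D s /\
  forall (L : fieldType) (DL : 'I_m -> L -> L) (t : G -> {rmorphism L -> L})
         (i : {rmorphism K -> L}),
    G_diff_field DL t -> G_diff_emb D s DL t i ->
    forall (n : nat) (eqs neqs : list (gdterm K G n m)),
      (exists b : 'I_n -> L,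
          (forall p, In p eqs -> gdeval i DL t b p = 0) /\
          (forall p, In p neqs -> gdeval i DL t b p != 0)) ->
      exists a : 'I_n -> K,
          (forall p, In p eqs -> gdeval id D s a p = 0) /\
          (forall p, In p neqs -> gdeval id D s a p != 0).

Definition diff_closed (U : fieldType) (m : nat) (DU : 'I_m -> U -> U) : Prop :=
  [pchar U] =i pred0 /\ is_diff_field DU /\
  forall (L : fieldType) (DL : 'I_m -> L -> L) (i : {rmorphism U -> L}),
    is_diff_field DL -> diff_emb DU DL i ->
    forall (n : nat) (eqs neqs : list (dterm U n m)),
      (exists b : 'I_n -> L,
          (forall p, In p eqs -> deval i DL b p = 0) /\
          (forall p, In p neqs -> deval i DL b p != 0)) ->
      exists a : 'I_n -> U,
          (forall p, In p eqs -> deval id DU a p = 0) /\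
          (forall p, In p neqs -> deval id DU a p != 0).

Definition dzero (C : Type) (U : fieldType) (n m : nat) (f : C -> U)
  (DU : 'I_m -> U -> U) (S : dterm C n m -> Prop) (a : 'I_n -> U) : Prop :=
  forall p, S p -> deval f DU a p = 0.

Definition kclosed (C : Type) (U : fieldType) (n m : nat) (f : C -> U)
  (DU : 'I_m -> U -> U) (A : ('I_n -> U) -> Prop) : Prop :=
  exists S : dterm C n m -> Prop, forall a, A a <-> dzero f DU S a.

Definition irreducible_wrt (U : fieldType) (n : nat)
  (closed : (('I_n -> U) -> Prop) -> Prop) (V : ('I_n -> U) -> Prop) : Prop :=
  (exists a, V a) /\
  forall A B, closed A -> closed B -> (forall a, V a <-> (A a \/ B a)) ->
    (forall a, V a <-> A a) \/ (forall a, V a <-> B a).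

(* (F, D) with F a differential subfield of (K, D) (given as a predicate) is
   PAC-differential: every absolutely irreducible differential variety over F
   (i.e. irreducible in the Kolchin topology of a universal differentially
   closed field U extending K) has an F-rational point. *)
Definition PAC_diff (K : fieldType) (m : nat) (D : 'I_m -> K -> K) (F : K -> Prop) : Prop :=
  forall (U : fieldType) (DU : 'I_m -> U -> U) (i : {rmorphism K -> U}),
    diff_closed DU -> diff_emb D DU i ->
    forall (n : nat) (S : dterm K n m -> Prop),
      (forall p, S p -> dcoeffs_in F p) ->
      irreducible_wrt (kclosed (@id U) DU) (dzero i DU S) ->
      exists a : 'I_n -> K, (forall k, F (a k)) /\ dzero i DU S (fun k => i (a k)).

(* (F, D) is K-strongly PAC-differential: every differential variety over F
   which is K-irreducible (irreducible in the Kolchin topology with parameters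
   from K) has an F-rational point. *)
Definition K_strongly_PAC_diff (K : fieldType) (m : nat) (D : 'I_m -> K -> K)
  (F : K -> Prop) : Prop :=
  forall (U : fieldType) (DU : 'I_m -> U -> U) (i : {rmorphism K -> U}),
    diff_closed DU -> diff_emb D DU i ->
    forall (n : nat) (S : dterm K n m -> Prop),
      (forall p, S p -> dcoeffs_in F p) ->
      irreducible_wrt (kclosed i DU) (dzero i DU S) ->
      exists a : 'I_n -> K, (forall k, F (a k)) /\ dzero i DU S (fun k => i (a k)).

Definition lin_indep_over (K : fieldType) (F : K -> Prop) (k : nat) (e : 'I_k -> K) : Prop :=
  forall c : 'I_k -> K, (forall j, F (c j)) -> \sum_(j < k) c j * e j = 0 ->
    forall j, c j = 0.

(* [K : K^G] = |G| *)
Definition strict_action (G : finGroupType) (K : fieldType) (s : G -> {rmorphism K -> K}) : Prop :=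
  (exists e : 'I_#|G| -> K, lin_indep_over (fixed_field s) e) /\
  (forall e : 'I_#|G|.+1 -> K, ~ lin_indep_over (fixed_field s) e).

Definition alg_G_closed (G : finGroupType) (K : fieldType) (s : G -> {rmorphism K -> K}) : Prop :=
  forall (L : fieldType) (i : {rmorphism K -> L}) (t : G -> {rmorphism L -> L}),
    (forall y : L, exists p : {poly K}, p != 0 /\ root (map_poly i p) y) ->
    is_G_action t -> (forall g x, t g (i x) = i (s g x)) ->
    forall y : L, exists x : K, i x = y.

(* Main.v *)
(* Differential polynomials are used through their values at points of differential
   extensions. Two facts about a point b over a differential field K carry the proof:
   b satisfies a finite system of equations and inequations over K which implies all
   the differential polynomial equations of b (a form of Ritt-Raudenbush), and two
   differential extensions of K amalgamate (a tensor product modulo a prime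
   differential ideal). Hence b specializes into any differentially closed extension.

   Let F = K^G and let e be a basis of K over F, indexed by |G|. It is also a basis of
   L over L^G for every extension L of K with G-action (Artin), so a G-differential
   system over K is a differential system over F in the coordinates. If F is
   K-strongly PAC, the F-locus of an invariant point c is K-irreducible, because the
   ideal of c over K is generated by its ideal over F; an F-point of the locus solves
   the system, so K is existentially closed.
   Conversely a K-irreducible V over F has a generic point b over K whose field K<b>
   carries a G-action fixing b; if K is existentially closed, the finite system
   isolating b is solvable in F.

   An algebraic G-extension of K inherits unique derivations, so existentially closed
   K are algebraically G-closed. If K is algebraically G-closed then, for b as above,
   K is algebraically closed in K<b>, hence K<b> tensored over K with any field U is a
   domain (specialize U to elements algebraic over K by Zariski's lemma); so b stays
   generic over U and V is absolutely irreducible. *)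

From HB Require Import structures.
From mathcomp Require Import all_boot all_order all_algebra all_fingroup all_field.
From mathcomp Require Import boolp classical_sets.
From mathcomp Require Import ring zify.
Require Import Defs.
Set Implicit Arguments. Unset Strict Implicit. Unset Printing Implicit Defensive.
Import GRing.Theory.
Local Open Scope ring_scope.

(** * Quotient rings and fields of fractions *)

(** Neither differential polynomial rings nor universal domains are given, and the cardinality of
    [K] is arbitrary; this shapes the constructions. Rings are made of syntactic data (terms, formal
    sums, coherent sequences) modulo equality of values, so that the ring axioms and the Leibniz
    rule are inherited from the fields in which the data are evaluated. A prime differential ideal,
    found by Zorn's lemma or already at hand, then yields a differential field of fractions.
    Amalgams, differential closures, unions of chains and the field of a generic point all arise in
    this way. Linear algebra over [K] inside an extension of unknown dimension uses linear
    functionals instead of bases. A differential closure really has to be built, because condition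
    (2) yields points only once a differentially closed [U] is supplied. On the other hand [G] need
    not act on [U]; where conjugation of points of [U] would be natural, the embedding of [K] is
    twisted by an automorphism instead. *)

Record setoid_ring (T : Type) (E : T -> T -> Prop) (z o : T) (a : T -> T -> T)
  (n : T -> T) (u : T -> T -> T) : Prop := SetoidRing {
  sr_refl : forall x, E x x;
  sr_sym : forall x y, E x y -> E y x;
  sr_trans : forall y x w, E x y -> E y w -> E x w;
  sr_add : forall x x' y y', E x x' -> E y y' -> E (a x y) (a x' y');
  sr_opp : forall x x', E x x' -> E (n x) (n x');
  sr_mul : forall x x' y y', E x x' -> E y y' -> E (u x y) (u x' y');
  sr_addA : forall x y w, E (a x (a y w)) (a (a x y) w);
  sr_addC : forall x y, E (a x y) (a y x);
  sr_add0 : forall x, E (a z x) x;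
  sr_addN : forall x, E (a (n x) x) z;
  sr_mulA : forall x y w, E (u x (u y w)) (u (u x y) w);
  sr_mulC : forall x y, E (u x y) (u y x);
  sr_mul1 : forall x, E (u o x) x;
  sr_mulD : forall x y w, E (u (a x y) w) (a (u x w) (u y w)) }.

Section QuotientRing.
Variables (T : Type) (E : T -> T -> Prop) (z o : T) (a : T -> T -> T).
Variables (n : T -> T) (u : T -> T -> T).
Hypothesis srE : setoid_ring E z o a n u.

(** A class is the predicate [E x] itself: by extensionality two classes are equal exactly when
    their representatives are [E]-related, and choice supplies representatives. *)
Definition setoid_quot := {A : T -> Prop | exists x, A = E x}.
Definition setoid_pi (x : T) : setoid_quot := exist _ (E x) (ex_intro _ x erefl).
Definition setoid_repr (A : setoid_quot) : T := projT1 (cid (svalP A)).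

Lemma setoid_reprK A : setoid_pi (setoid_repr A) = A.
Proof.
rewrite /setoid_repr; case: cid => x /= Ax; case: A Ax => A HA /= Ax.
by apply: eq_exist; rewrite Ax.
Qed.

Lemma setoid_piP x y : setoid_pi x = setoid_pi y <-> E x y.
Proof.
split=> [/(congr1 sval) /= e|Exy]; first by rewrite e; apply: (sr_refl srE).
apply: eq_exist; apply/funext => w; apply/propext; split.
  exact/(sr_trans srE)/(sr_sym srE).
exact/(sr_trans srE).
Qed.

Let pi_repr x : E (setoid_repr (setoid_pi x)) x.
Proof. by apply/setoid_piP; rewrite setoid_reprK. Qed.

HB.instance Definition _ := gen_eqMixin setoid_quot.
HB.instance Definition _ := gen_choiceMixin setoid_quot.

Definition setoid_addq A B := setoid_pi (a (setoid_repr A) (setoid_repr B)).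
Definition setoid_mulq A B := setoid_pi (u (setoid_repr A) (setoid_repr B)).
Definition setoid_oppq A := setoid_pi (n (setoid_repr A)).

Let addE x y : setoid_addq (setoid_pi x) (setoid_pi y) = setoid_pi (a x y).
Proof. by apply/setoid_piP/(sr_add srE); apply: pi_repr. Qed.
Let mulE x y : setoid_mulq (setoid_pi x) (setoid_pi y) = setoid_pi (u x y).
Proof. by apply/setoid_piP/(sr_mul srE); apply: pi_repr. Qed.
Let oppE x : setoid_oppq (setoid_pi x) = setoid_pi (n x).
Proof. by apply/setoid_piP/(sr_opp srE); apply: pi_repr. Qed.

Fact setoid_addqA : associative setoid_addq.
Proof.
move=> A B C; rewrite -[A]setoid_reprK -[B]setoid_reprK -[C]setoid_reprK !addE.
exact/setoid_piP/(sr_addA srE).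
Qed.
Fact setoid_addqC : commutative setoid_addq.
Proof.
move=> A B; rewrite -[A]setoid_reprK -[B]setoid_reprK !addE.
exact/setoid_piP/(sr_addC srE).
Qed.
Fact setoid_add0q : left_id (setoid_pi z) setoid_addq.
Proof. by move=> A; rewrite -[A]setoid_reprK addE; exact/setoid_piP/(sr_add0 srE). Qed.
Fact setoid_addNq : left_inverse (setoid_pi z) setoid_oppq setoid_addq.
Proof.
by move=> A; rewrite -[A]setoid_reprK oppE addE; exact/setoid_piP/(sr_addN srE).
Qed.
HB.instance Definition _ := GRing.isZmodule.Build setoid_quot
  setoid_addqA setoid_addqC setoid_add0q setoid_addNq.

Fact setoid_mulqA : associative setoid_mulq.
Proof.
move=> A B C; rewrite -[A]setoid_reprK -[B]setoid_reprK -[C]setoid_reprK !mulE.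
exact/setoid_piP/(sr_mulA srE).
Qed.
Fact setoid_mulqC : commutative setoid_mulq.
Proof.
move=> A B; rewrite -[A]setoid_reprK -[B]setoid_reprK !mulE.
exact/setoid_piP/(sr_mulC srE).
Qed.
Fact setoid_mul1q : left_id (setoid_pi o) setoid_mulq.
Proof. by move=> A; rewrite -[A]setoid_reprK mulE; exact/setoid_piP/(sr_mul1 srE). Qed.
Fact setoid_mulqD : left_distributive setoid_mulq setoid_addq.
Proof.
move=> A B C; rewrite -[A]setoid_reprK -[B]setoid_reprK -[C]setoid_reprK.
by rewrite addE !mulE addE; exact/setoid_piP/(sr_mulD srE).
Qed.
HB.instance Definition _ := GRing.Zmodule_isComPzRing.Build setoid_quot
  setoid_mulqA setoid_mulqC setoid_mul1q setoid_mulqD.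

(** The quotient is used only through the surjection [p]: identities in [R] are moved to
    representatives and checked there up to [E]. *)
Lemma setoid_ring_quot : exists (R : comPzRingType) (p : T -> R),
  (forall r, exists x, r = p x) /\ (forall x y, p x = p y <-> E x y) /\
  p z = 0 /\ p o = 1 /\ (forall x y, p (a x y) = p x + p y) /\
  (forall x, p (n x) = - p x) /\ (forall x y, p (u x y) = p x * p y).
Proof.
exists setoid_quot, setoid_pi; split.
  by move=> r; exists (setoid_repr r); rewrite setoid_reprK.
split; first exact: setoid_piP.
split=> //; split=> //; split; first by move=> x y; rewrite -addE.
by split=> [x|x y]; rewrite -?oppE -?mulE.
Qed.
End QuotientRing.

Section FieldOfRing.
Variables (R : comPzRingType).
Hypothesis neq01 : (1 : R) <> 0.
Hypothesis invR : forall x : R, x <> 0 -> exists y, y * x = 1.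

Definition field_of : Type := R.
HB.instance Definition _ := GRing.ComPzRing.on field_of.
Fact field_of_neq01 : (1 : field_of) != 0.
Proof. exact/eqP. Qed.
HB.instance Definition _ := GRing.PzSemiRing_isNonZero.Build field_of field_of_neq01.

Definition field_of_inv (x : field_of) : field_of :=
  if pselect (x <> 0) is left h then projT1 (cid (invR h)) else 0.
Fact field_of_mulV (x : field_of) : x != 0 -> field_of_inv x * x = 1.
Proof.
move=> /eqP nx; rewrite /field_of_inv; case: pselect => // h.
by case: cid.
Qed.
Fact field_of_inv0 : field_of_inv 0 = 0.
Proof. by rewrite /field_of_inv; case: pselect. Qed.
HB.instance Definition _ := GRing.ComNzRing_isField.Build field_of
  field_of_mulV field_of_inv0.

Lemma ring_is_field : exists (L : fieldType) (f : {rmorphism R -> L}),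
  injective f /\ (forall y, exists x, y = f x).
Proof.
exists (field_of : fieldType).
have fa : zmod_morphism (id : R -> field_of) by [].
have fm : monoid_morphism (id : R -> field_of) by [].
pose f : {rmorphism R -> field_of} :=
  HB.pack (id : R -> field_of) (GRing.isZmodMorphism.Build _ _ _ fa)
    (GRing.isMonoidMorphism.Build _ _ _ fm).
by exists f; split=> [//|y]; exists y.
Qed.
End FieldOfRing.

Lemma rmorph_of (R S : pzRingType) (f : R -> S) :
  (forall x y, f (x + y) = f x + f y) -> (forall x y, f (x * y) = f x * f y) ->
  f 1 = 1 -> exists g : {rmorphism R -> S}, forall x, g x = f x.
Proof.
move=> fD fM f1.
have f0 : f 0 = 0 by apply: (@addrI _ (f 0)); rewrite -fD !addr0.
have fB : zmod_morphism f.
  move=> x y; rewrite fD; congr (_ + _).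
  by apply: (@addrI _ (f y)); rewrite -fD !subrr f0.
have fm : monoid_morphism f by [].
by exists (HB.pack f (GRing.isZmodMorphism.Build _ _ _ fB)
    (GRing.isMonoidMorphism.Build _ _ _ fm) : {rmorphism R -> S}).
Qed.

Record prime_ideal (R : comPzRingType) (P : R -> Prop) : Prop := PrimeIdeal {
  pi0 : P 0;
  piD : forall x y, P x -> P y -> P (x + y);
  piM : forall r x, P x -> P (r * x);
  pi1 : ~ P 1;
  pi_prime : forall x y, P (x * y) -> P x \/ P y }.

Lemma piN (R : comPzRingType) (P : R -> Prop) x : prime_ideal P -> P x -> P (- x).
Proof. by move=> hP Px; rewrite -mulN1r; apply: (piM hP). Qed.

(** Fractions with denominators outside [P], identified when the cross difference lies in [P], give
    the fraction field of [R/P] by a single quotient, without forming [R/P]. *)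
Lemma prime_fraction_field (R : comPzRingType) (P : R -> Prop) :
  prime_ideal P -> exists (L : fieldType) (f : {rmorphism R -> L}),
  (forall x, f x = 0 <-> P x) /\
  (forall l, exists x y, ~ P y /\ l = f x / f y).
Proof.
move=> hP.
have Pe x y : P x -> x = y -> P y by move=> Px <-.
have nPM x y : ~ P x -> ~ P y -> ~ P (x * y).
  by move=> nx ny /(pi_prime hP)[].
pose T := (R * {y : R | ~ P y})%type.
pose E (s t : T) := P (s.1 * sval t.2 - t.1 * sval s.2).
pose mk x y (h : ~ P y) : T := (x, exist _ y h).
pose z := @mk 0 1 (pi1 hP); pose o := @mk 1 1 (pi1 hP).
pose a (s t : T) := @mk (s.1 * sval t.2 + t.1 * sval s.2) _ (nPM _ _ (svalP s.2) (svalP t.2)).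
pose n (s : T) := @mk (- s.1) _ (svalP s.2).
pose u (s t : T) := @mk (s.1 * t.1) _ (nPM _ _ (svalP s.2) (svalP t.2)).
have P0 x : x = 0 -> P x by move->; apply: pi0.
have sE : setoid_ring E z o a n u.
  split.
  - by move=> [x [y hy]]; apply: P0 => /=; ring.
  - move=> [x [y hy]] [x' [y' hy']]; rewrite /E /= => h.
    by apply: (Pe _ _ (piN hP h)); ring.
  - move=> [x' [y' hy']] [x [y hy]] [x'' [y'' hy'']]; rewrite /E /= => h1 h2.
    (* Primality cancels the middle denominator [y'], which lies outside [P]. *)
    suff: P (y' * (x * y'' - x'' * y)) by move/(pi_prime hP)=> [].
    by apply: (Pe _ _ (piD hP (piM hP y'' h1) (piM hP y h2))); ring.
  - move=> [x1 [y1 ?]] [x2 [y2 ?]] [x3 [y3 ?]] [x4 [y4 ?]]; rewrite /E /= => h1 h2.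
    by apply: (Pe _ _ (piD hP (piM hP (y3 * y4) h1) (piM hP (y1 * y2) h2))); ring.
  - move=> [x1 [y1 ?]] [x2 [y2 ?]]; rewrite /E /= => h.
    by apply: (Pe _ _ (piN hP h)); ring.
  - move=> [x1 [y1 ?]] [x2 [y2 ?]] [x3 [y3 ?]] [x4 [y4 ?]]; rewrite /E /= => h1 h2.
    by apply: (Pe _ _ (piD hP (piM hP (x3 * y4) h1) (piM hP (x2 * y1) h2))); ring.
  - by move=> [x1 [y1 ?]] [x2 [y2 ?]] [x3 [y3 ?]]; apply: P0 => /=; ring.
  - by move=> [x1 [y1 ?]] [x2 [y2 ?]]; apply: P0 => /=; ring.
  - by move=> [x1 [y1 ?]]; apply: P0 => /=; ring.
  - by move=> [x1 [y1 ?]]; apply: P0 => /=; ring.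
  - by move=> [x1 [y1 ?]] [x2 [y2 ?]] [x3 [y3 ?]]; apply: P0 => /=; ring.
  - by move=> [x1 [y1 ?]] [x2 [y2 ?]]; apply: P0 => /=; ring.
  - by move=> [x1 [y1 ?]]; apply: P0 => /=; ring.
  - by move=> [x1 [y1 ?]] [x2 [y2 ?]] [x3 [y3 ?]]; apply: P0 => /=; ring.
have [Q [p [ps [pE [pz [po [pa [pn pu]]]]]]]] := setoid_ring_quot sE.
have Q01 : (1 : Q) <> 0.
  rewrite -po -pz => /pE; rewrite /E /= => h.
  by apply: (pi1 hP); apply: (Pe _ _ h); ring.
have Qinv (q : Q) : q <> 0 -> exists y, y * q = 1.
  have [[x [y hy]] ->] := ps q => nq.
  have hx : ~ P x by move=> hx; apply: nq; rewrite -pz; apply/pE; rewrite /E /=;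
    apply: (Pe _ _ hx); ring.
  exists (p (@mk y x hx)); rewrite -pu -po; apply/pE; rewrite /E /=; apply: P0; ring.
have [L [f [finj fsurj]]] := ring_is_field Q01 Qinv.
have [g hg] : exists g : {rmorphism R -> L}, forall x, g x = f (p (@mk x 1 (pi1 hP))).
  apply: rmorph_of => [x y|x y|]; last by rewrite -[in RHS](rmorph1 f) -po.
    by rewrite -rmorphD -pa; congr (f _); apply/pE; rewrite /E /=; apply: P0; ring.
  by rewrite -rmorphM -pu; congr (f _); apply/pE; rewrite /E /=; apply: P0; ring.
have g0 x : g x = 0 <-> P x.
  rewrite hg; split=> [h|h].
    have /pE : p (@mk x 1 (pi1 hP)) = p z by apply: finj; rewrite h pz rmorph0.
    by rewrite /E /= => h'; apply: (Pe _ _ h'); ring.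
  rewrite -(rmorph0 f) -pz; congr (f _); apply/pE; rewrite /E /=; apply: (Pe _ _ h); ring.
exists L, g; split=> // l.
have [q ->] := fsurj l; have [[x [y hy]] ->] := ps q.
exists x, y; split=> //.
have gy : g y != 0 by apply/eqP => /g0.
apply: (mulIf gy); rewrite divfK // !hg -rmorphM; congr (f _); rewrite -pu; apply/pE.
by rewrite /E /=; apply: P0; ring.
Qed.

(** The quotient rule, in the form [D l * f y = f (d x) - l * f (d y)] whenever [l * f y = f x]. It
    does not depend on the fraction: the cross difference of two fractions is in the kernel of [f],
    hence so is its derivative. *)
Lemma fraction_derivation (R : comPzRingType) (L : fieldType) (f : {rmorphism R -> L})
  (d : R -> R) :
  (forall l, exists x y, f y != 0 /\ l = f x / f y) ->
  (forall x y, d (x + y) = d x + d y) ->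
  (forall x y, d (x * y) = d x * y + x * d y) ->
  (forall x, f x = 0 -> f (d x) = 0) ->
  exists D : L -> L, is_derivation D /\ forall x, D (f x) = f (d x).
Proof.
move=> hf dD dM d0.
have [n /choice[c hc]] := choice hf.
have cn l : f (c l) != 0 by have [] := hc l.
have lE l : l = f (n l) / f (c l) by have [] := hc l.
pose D l := (f (d (n l)) - l * f (d (c l))) / f (c l).
have d00 : d 0 = 0 by apply: (@addrI _ (d 0)); rewrite -dD !addr0.
have dN x : d (- x) = - d x.
  by apply: (@addrI _ (d x)); rewrite -dD !subrr.
have DE x y l : f y != 0 -> l * f y = f x -> D l * f y = f (d x) - l * f (d y).
  move=> ny e; have := lE l; set n0 := n l; set c0 := c l => el.
  have c00 : f c0 != 0 by apply: cn.
  have h : l * f c0 = f n0 by rewrite el divfK.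
  have : f (x * c0 + - (n0 * y)) = 0.
    by rewrite rmorphD rmorphN !rmorphM -e -h; ring.
  move/d0; rewrite dD dN !dM rmorphD rmorphN !rmorphD !rmorphM -e -h => k.
  rewrite /D -/n0 -/c0; apply: (mulIf c00).
  have -> : (f (d n0) - l * f (d c0)) / f c0 * f y * f c0 =
            (f (d n0) - l * f (d c0)) * f y by field.
  apply/eqP; rewrite -subr_eq0; apply/eqP; rewrite -[RHS]oppr0 -[in RHS]k; ring.
have DM' l y x : f y != 0 -> l * f y = f x -> forall w, w * f y = f (d x) - l * f (d y) -> D l = w.
  by move=> ny e w hw; apply: (mulIf ny); rewrite hw (DE x).
exists D; split; last first.
  move=> x; apply: (DM' _ 1 x); rewrite ?rmorph1 ?oner_neq0 ?mulr1 //.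
  have -> : d 1 = 0.
    by apply: (@addrI _ (d 1)); rewrite addr0 -{3}[1]mulr1 dM mulr1 mul1r.
  by rewrite rmorph0 mulr0 subr0.
split=> l l'.
  have h := lE l; have h' := lE l'.
  have e : l * f (c l) = f (n l) by rewrite {1}h divfK.
  have e' : l' * f (c l') = f (n l') by rewrite {1}h' divfK.
  apply: (DM' _ (c l * c l') (n l * c l' + n l' * c l)).
  - by rewrite rmorphM mulf_neq0.
  - by rewrite rmorphD !rmorphM -e -e'; ring.
  have k := DE _ _ _ (cn l) e; have k' := DE _ _ _ (cn l') e'.
  rewrite dD !dM !rmorphD !rmorphM -e -e' !mulrDl.
  have -> : D l * (f (c l) * f (c l')) = D l * f (c l) * f (c l') by ring.
  have -> : D l' * (f (c l) * f (c l')) = D l' * f (c l') * f (c l) by ring.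
  rewrite k k'; ring.
have h := lE l; have h' := lE l'.
have e : l * f (c l) = f (n l) by rewrite {1}h divfK.
have e' : l' * f (c l') = f (n l') by rewrite {1}h' divfK.
apply: (DM' _ (c l * c l') (n l * n l')).
- by rewrite rmorphM mulf_neq0.
- by rewrite !rmorphM -e -e'; ring.
have k := DE _ _ _ (cn l) e; have k' := DE _ _ _ (cn l') e'.
rewrite !dM !rmorphD !rmorphM -e -e' !mulrDl.
have -> : D l * l' * (f (c l) * f (c l')) = D l * f (c l) * (l' * f (c l')) by ring.
have -> : l * D l' * (f (c l) * f (c l')) = D l' * f (c l') * (l * f (c l)) by ring.
rewrite k k'; ring.
Qed.

Lemma fraction_rmorphism (R : comPzRingType) (L M : fieldType) (f : {rmorphism R -> L})
  (g : {rmorphism R -> M}) :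
  (forall l, exists x y, f y != 0 /\ l = f x / f y) ->
  (forall x, f x = 0 <-> g x = 0) ->
  exists h : {rmorphism L -> M}, forall x, h (f x) = g x.
Proof.
move=> hf fg.
have [n /choice[c hc]] := choice hf.
have cn l : f (c l) != 0 by have [] := hc l.
have lE l : l = f (n l) / f (c l) by have [] := hc l.
have gn x : f x != 0 -> g x != 0 by move=> /eqP nx; apply/eqP => /fg.
pose h l := g (n l) / g (c l).
have hE x y l : f y != 0 -> l * f y = f x -> h l = g x / g y.
  move=> ny e; have := lE l; rewrite /h; set n0 := n l; set c0 := c l => el.
  have c00 : f c0 != 0 by apply: cn.
  have h0 : l * f c0 = f n0 by rewrite el divfK.
  have /fg : f (n0 * y - x * c0) = 0 by rewrite rmorphB !rmorphM -e -h0; ring.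
  rewrite rmorphB !rmorphM => /eqP; rewrite subr_eq0 => /eqP k.
  by apply/eqP; rewrite eqr_div ?gn // k.
have [k hk] : exists k : {rmorphism L -> M}, forall x, k x = h x.
  apply: rmorph_of => [l l'|l l'|].
  - have h0 := lE l; have h1 := lE l'.
    have e : l * f (c l) = f (n l) by rewrite {1}h0 divfK.
    have e' : l' * f (c l') = f (n l') by rewrite {1}h1 divfK.
    rewrite (hE (n l * c l' + n l' * c l) (c l * c l')).
    + by rewrite rmorphD !rmorphM -addf_div ?gn.
    + by rewrite rmorphM mulf_neq0.
    + by rewrite rmorphD !rmorphM -e -e'; ring.
  - have h0 := lE l; have h1 := lE l'.
    have e : l * f (c l) = f (n l) by rewrite {1}h0 divfK.
    have e' : l' * f (c l') = f (n l') by rewrite {1}h1 divfK.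
    rewrite (hE (n l * n l') (c l * c l')).
    + by rewrite !rmorphM -mulf_div.
    + by rewrite rmorphM mulf_neq0.
    + by rewrite !rmorphM -e -e'; ring.
  - by rewrite (hE 1 1) ?rmorph1 ?oner_neq0 ?mulr1 ?divr1.
exists k => x; rewrite hk (hE x 1) ?rmorph1 ?oner_neq0 ?mulr1 ?divr1 //.
Qed.

(** * Prime differential ideals *)

Section PrimeDifferentialIdeal.
Local Open Scope classical_set_scope.
Variables (R : comPzRingType) (m : nat) (d : 'I_m -> R -> R).
Hypothesis dD : forall j x y, d j (x + y) = d j x + d j y.
Hypothesis dM : forall j x y, d j (x * y) = d j x * y + x * d j y.
Hypothesis invN : forall n, exists y : R, n.+1%:R * y = 1.

Record diff_ideal (I : R -> Prop) : Prop := DiffIdeal {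
  di0 : I 0;
  diD : forall x y, I x -> I y -> I (x + y);
  diM : forall r x, I x -> I (r * x);
  di1 : ~ I 1;
  did : forall j x, I x -> I (d j x) }.

Lemma der_expS j x n : d j (x ^+ n.+1) = n.+1%:R * x ^+ n * d j x.
Proof.
elim: n => [|n IH]; first by rewrite expr1 expr0; ring.
by rewrite exprS dM IH -[n.+2]addn1 natrD [x ^+ n.+1]exprS; ring.
Qed.

(** Differentiating [x ^+ k.+1 * d j x ^+ (2 * l)] and multiplying by [d j x] trades one factor [x]
    for two factors [d j x], up to the invertible [k.+1]; the remaining term is a multiple of the
    element differentiated. After [n] trades no [x] is left. *)
Lemma diff_ideal_deriv_expr I j x n : diff_ideal I -> I (x ^+ n) ->
  I (d j x ^+ (2 * n)).
Proof.
move=> hI Ixn.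
suff h l k : (k + l)%N = n -> I (x ^+ k * d j x ^+ (2 * l)).
  by rewrite -[d j x ^+ _]mul1r -[1]/(x ^+ 0); apply: h.
elim: l k => [|l IH] k kl; first by rewrite addn0 in kl; rewrite kl mulr1.
have [y hy] := invN k.
have := IH k.+1; rewrite addSnnS => /(_ kl) h.
have {}h := diM hI (y * d j x) (did hI j h).
rewrite dM der_expS in h.
case: l h IH kl => [|l] h IH kl.
  rewrite muln0 muln1 in h *.
  have d1 : d j 1 = 0.
    by apply: (@addrI _ (d j 1)); rewrite addr0 -{3}[1]mulr1 dM mulr1 mul1r.
  move: h; rewrite expr0 d1 mulr1 mulr0 addr0.
  congr (I _); rewrite [RHS](_ : _ = (k.+1%:R * y) * (x ^+ k * d j x ^+ 2)); first by ring.
  by rewrite hy mul1r.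
have h2 := IH k.+1; rewrite addSnnS in h2; have {}h2 := h2 kl.
have h3 := diM hI (- (y * (2 * l).+2%:R * d j (d j x))) h2.
have := diD hI h h3; congr (I _).
rewrite [in d j (d j x ^+ _)](_ : 2 * l.+1 = (2 * l).+2)%N ?mulnS // der_expS.
rewrite [RHS](_ : _ = (k.+1%:R * y) * (x ^+ k * d j x ^+ (2 * l).+4)); last first.
  by rewrite hy mul1r; congr (_ * d j x ^+ _); lia.
by rewrite exprD !exprS; ring.
Qed.

Lemma ideal_sum I (F : nat -> R) (s : seq nat) : diff_ideal I ->
  (forall i, I (F i)) -> I (\sum_(i <- s) F i).
Proof.
move=> hI hF; elim: s => [|i s IH]; rewrite ?big_nil ?big_cons; first exact: di0 hI.
exact: diD.
Qed.

Lemma ideal_expr I x k l : diff_ideal I -> (k <= l)%N -> I (x ^+ k) -> I (x ^+ l).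
Proof. by move=> hI kl; rewrite -(subnK kl) exprD; apply: (diM hI). Qed.

Lemma radical_diff_ideal I : diff_ideal I -> diff_ideal (fun x => exists n, I (x ^+ n)).
Proof.
move=> hI; split.
- by exists 1; rewrite expr1; apply: di0.
- move=> x y [a Ha] [b Hb]; exists (a + b)%N; rewrite exprDn.
  rewrite -(big_mkord xpredT (fun i => (x ^+ (a + b - i) * y ^+ i) *+ 'C(a + b, i))).
  apply: ideal_sum => // i; rewrite -mulr_natl; apply: (diM hI).
  have [ib|bi] := leqP i b.
    by rewrite mulrC; apply/(diM hI)/(ideal_expr hI _ Ha); lia.
  by apply/(diM hI)/(ideal_expr hI _ Hb); lia.
- by move=> r x [a Ha]; exists a; rewrite exprMn; apply: (diM hI).
- by case=> a; rewrite expr1n; apply: (di1 hI).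
- by move=> j x [a Ha]; exists (2 * a)%N; apply: diff_ideal_deriv_expr.
Qed.

(* For a radical differential ideal [I] and [x] not in [I], the ideal [I : x] is again
   a proper differential ideal. *)
Lemma max_diff_ideal_prime I : diff_ideal I ->
  (forall J, diff_ideal J -> (forall x, I x -> J x) -> forall x, J x -> I x) ->
  prime_ideal I.
Proof.
move=> hI hmax.
have hrad x n : I (x ^+ n) -> I x.
  move=> h; apply: (hmax _ (radical_diff_ideal hI)); last by exists n.
  by move=> {h}x h; exists 1%N; rewrite expr1.
split; [exact: di0|exact: diD|exact: diM|exact: di1|move=> x y hxy].
have [Ix|nIx] := pselect (I x); [by left|right].
apply: (hmax (fun w => I (x * w))) => //; last by move=> w; apply: (diM hI).
split.
- by rewrite mulr0; apply: di0.
- by move=> a b ha hb; rewrite mulrDr; apply: diD.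
- by move=> r a ha; rewrite mulrCA; apply: diM.
- by rewrite mulr1.
(* The square of [x * d j w] equals [x * d j w * d j (x * w) - d j x * d j w * (x * w)], and both
   terms lie in [I]. *)
- move=> j w h; apply: (hrad _ 2%N).
  have h1 := diM hI (x * d j w) (did hI j h).
  have h2 := diM hI (- (d j x * d j w)) h.
  have := diD hI h1 h2; congr (I _); rewrite dM; ring.
Qed.

Lemma exists_prime_diff_ideal : (1 : R) <> 0 ->
  exists P, prime_ideal P /\ forall j x, P x -> P (d j x).
Proof.
move=> n10.
have d0 j : d j 0 = 0 by apply: (@addrI _ (d j 0)); rewrite -dD !addr0.
pose T (A : set R) := A = set0 \/ diff_ideal A.
have [|A [TA maxA]] := @Zorn_bigcup R T.
  move=> F FT tot; have [[B0 FB0 hB0]|nB] := pselect (exists2 B, F B & diff_ideal B); last first.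
    left; apply/seteqP; split=> // x [B FB Bx]; case: (FT _ FB) => [e|hB].
      by rewrite e in Bx.
    by case: nB; exists B.
  right; split.
  - by exists B0 => //; apply: di0.
  - move=> x y [B1 F1 h1] [B2 F2 h2].
    have id1 : diff_ideal B1 by case: (FT _ F1) h1 => // ->.
    have id2 : diff_ideal B2 by case: (FT _ F2) h2 => // ->.
    case: (tot _ _ F1 F2) => h12; [exists B2|exists B1] => //; apply: diD => //; exact: h12.
  - move=> r x [B1 F1 h1]; exists B1 => //.
    by case: (FT _ F1) h1 => [->//|id1]; apply: diM.
  - by case=> B1 F1 h1; case: (FT _ F1) h1 => [->//|id1]; apply: di1.
  - move=> j x [B1 F1 h1]; exists B1 => //.
    by case: (FT _ F1) h1 => [->//|id1]; apply: did.
have idA : diff_ideal A.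
  case: TA => // A0; exfalso; apply: (maxA (fun x => x = 0)); last first.
    right; split=> //= [x y -> ->|r x ->|j x ->]; rewrite ?addr0 ?mulr0 //.
  by rewrite A0; split=> // /(_ 0); apply.
exists A; split; last exact: did.
apply: max_diff_ideal_prime => // J hJ AJ x Jx.
have [//|nAx] := pselect (A x); exfalso.
by apply: (maxA J); [split=> // /(_ _ Jx)|right].
Qed.
End PrimeDifferentialIdeal.

(** * Linear functionals over a subfield *)

Section Functionals.
Local Open Scope classical_set_scope.
Variables (K U : fieldType) (j : {rmorphism K -> U}).

Definition klinear (l : U -> K) : Prop :=
  (forall x y, l (x + y) = l x + l y) /\ (forall k x, l (j k * x) = k * l x).

Lemma klinear0 l : klinear l -> l 0 = 0.
Proof. by case=> lD _; apply: (@addrI _ (l 0)); rewrite -lD !addr0. Qed.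
Lemma klinearN l x : klinear l -> l (- x) = - l x.
Proof.
by move=> hl; apply: (@addrI _ (l x)); rewrite -(proj1 hl) !subrr klinear0.
Qed.
Lemma klinear_sum l (I : Type) (s : seq I) F : klinear l ->
  l (\sum_(i <- s) F i) = \sum_(i <- s) l (F i).
Proof.
by move=> hl; elim/big_rec2: _ => [|i x y _ <-]; [exact: klinear0|exact: (proj1 hl)].
Qed.
Lemma klinearMr l u : klinear l -> klinear (fun x => l (x * u)).
Proof.
by case=> lD lZ; split=> [x y|k x]; rewrite ?mulrDl ?lD // -mulrA lZ.
Qed.
Lemma klinearMl l u : klinear l -> klinear (fun x => l (u * x)).
Proof.
by case=> lD lZ; split=> [x y|k x]; rewrite ?mulrDr ?lD // mulrCA lZ.
Qed.

(** Zorn's lemma gives a [K]-subspace maximal among those that miss 1. By maximality it is a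
    complement of the line of scalars, and [l x] is the unique scalar congruent to [x] modulo it. *)
Lemma exists_functional1 : exists l, klinear l /\ l 1 = 1.
Proof.
pose sub (A : set U) := [/\ A 0, forall x y, A x -> A y -> A (x + y),
  forall k x, A x -> A (j k * x) & ~ A 1].
pose T (A : set U) := A = set0 \/ sub A.
have [|A [TA maxA]] := @Zorn_bigcup U T.
  move=> F FT tot; have [[B0 FB0 hB0]|nB] := pselect (exists2 B, F B & sub B); last first.
    left; apply/seteqP; split=> // x [B FB Bx]; case: (FT _ FB) => [e|hB].
      by rewrite e in Bx.
    by case: nB; exists B.
  right; split.
  - by exists B0 => //; case: hB0.
  - move=> x y [B1 F1 h1] [B2 F2 h2].
    have [_ D1 _ _] : sub B1 by case: (FT _ F1) h1 => // ->.
    have [_ D2 _ _] : sub B2 by case: (FT _ F2) h2 => // ->.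
    case: (tot _ _ F1 F2) => h12.
      by exists B2 => //; apply: D2 => //; exact: h12.
    by exists B1 => //; apply: D1 => //; exact: h12.
  - move=> r x [B1 F1 h1]; exists B1 => //.
    by case: (FT _ F1) h1 => [->//|[_ _ h _]]; apply: h.
  - by case=> B1 F1 h1; case: (FT _ F1) h1 => [->//|[]].
have [A0 AD AZ A1] : sub A.
  case: TA => // A0; exfalso; apply: (maxA (fun x => x = 0)); last first.
    right; split=> [//|x y /= -> ->|k x /= ->|/= /eqP]; rewrite ?addr0 ?mulr0 //.
    by rewrite oner_eq0.
  by rewrite A0; split=> // /(_ 0); apply.
have AN x : A x -> A (- x) by move=> h; rewrite -mulN1r -(rmorph1 j) -rmorphN; apply: AZ.
have jA k : A (j k) -> k = 0.
  move=> h; apply/eqP; apply: contra_notT A1 => nk.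
  by rewrite -(rmorph1 j) -(mulVf nk) rmorphM; apply: AZ.
have dec x : exists k, A (x - j k).
  have [Ax|nAx] := pselect (A x); first by exists 0; rewrite rmorph0 subr0.
  pose B : set U := fun y => exists k, A (y - j k * x).
  have AB : A `<=` B by move=> y Ay; exists 0; rewrite rmorph0 mul0r subr0.
  have Bx : B x by exists 1; rewrite rmorph1 mul1r subrr.
  have [B1|nB1] := pselect (B 1).
    case: B1 => k; have [->|nk] := eqVneq k 0; first by rewrite rmorph0 mul0r subr0.
    move=> h; exists k^-1; have := AZ (- k^-1) _ h; congr A.
    by rewrite rmorphN fmorphV; field; rewrite fmorph_eq0.
  exfalso; apply: (maxA B); first by split=> // /(_ _ Bx).
  right; split=> //; first exact: AB.
    move=> a b [k hk] [l hl]; exists (k + l); have := AD _ _ hk hl; congr A.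
    by rewrite rmorphD; ring.
  move=> r a [k hk]; exists (r * k); have := AZ r _ hk; congr A.
  by rewrite rmorphM; ring.
have [l hl] := choice dec.
have lu x k : A (x - j k) -> l x = k.
  move=> h; apply/eqP; rewrite -subr_eq0; apply/eqP/jA.
  have := AD _ _ h (AN _ (hl x)); congr A; rewrite rmorphB; ring.
exists l; split; first split.
- move=> x y; apply: lu; have := AD _ _ (hl x) (hl y); congr A.
  by rewrite rmorphD; ring.
- move=> k x; apply: lu; have := AZ k _ (hl x); congr A.
  by rewrite rmorphM; ring.
- by apply: lu; rewrite rmorph1 subrr.
Qed.

Lemma exists_functional u : u != 0 -> exists l, klinear l /\ l u = 1.
Proof.
move=> nu; have [l [hl l1]] := exists_functional1.
exists (fun x => l (x * u^-1)); split; first exact: klinearMr.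
by rewrite mulfV.
Qed.

Lemma functional_eq0 u : (forall l, klinear l -> l u = 0) -> u = 0.
Proof.
move=> h; apply/eqP/contraT => /exists_functional[l [hl l1]].
by have := h _ hl; rewrite l1 => /eqP; rewrite oner_eq0.
Qed.

(* The pairs [(e, l)] behave like a basis of a finite dimensional subspace
   containing [us] together with its coordinate functions. *)
Lemma dual_basis (us : seq U) : exists B : seq (U * (U -> K)),
  (forall p, List.In p B -> klinear p.2) /\
  (forall u, u \in us -> u = \sum_(p <- B) j (p.2 u) * p.1).
Proof.
elim: us => [|u us [B [Bl BE]]]; first by exists [::].
pose q x := x - \sum_(p <- B) j (p.2 x) * p.1.
have qlin l : klinear l -> klinear (l \o q).
  move=> hl; have [lD lZ] := hl.
  have aux : forall p, List.In p B -> klinear p.2 by [].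
  suff hs : (forall x y, \sum_(p <- B) j (p.2 (x + y)) * p.1 =
        \sum_(p <- B) j (p.2 x) * p.1 + \sum_(p <- B) j (p.2 y) * p.1)
     /\ (forall k x, \sum_(p <- B) j (p.2 (j k * x)) * p.1 =
        j k * \sum_(p <- B) j (p.2 x) * p.1).
    have [hD hZ] := hs; split=> [x y|k x] /=; rewrite /q.
      by rewrite hD -lD; congr l; ring.
    by rewrite hZ -lZ; congr l; ring.
  clear BE q; elim: B Bl aux => [|p B IH] Bl _.
    by split=> *; rewrite !big_nil ?addr0 ?mulr0.
  have [hD hZ] := IH (fun p h => Bl p (or_intror h)) (fun p h => Bl p (or_intror h)).
  have [pD pZ] := Bl p (or_introl erefl).
  split=> [x y|k x]; rewrite !big_cons.
    by rewrite hD pD rmorphD; ring.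
  by rewrite hZ pZ rmorphM; ring.
have [qu|qu] := eqVneq (q u) 0.
  exists B; split=> // w; rewrite inE => /orP[/eqP->|]; last exact: BE.
  by apply/eqP; rewrite -subr_eq0 -/(q u) qu.
have [l [hl l1]] := exists_functional qu.
(* The new functional factors through the remainder [q], so it vanishes on the elements already
   expanded and takes the value 1 at [u]. *)
exists ((q u, l \o q) :: B); split=> [p [<-|]|w]; [exact: qlin|exact: Bl|].
rewrite big_cons /= inE => /orP[/eqP->|wus].
  by rewrite l1 rmorph1 mul1r /q subrK.
have -> : q w = 0 by rewrite /q -BE ?subrr.
by rewrite klinear0 // rmorph0 mul0r add0r -BE.
Qed.
End Functionals.

(** * Tensor products and amalgamation *)

Section Derivations.
Variables (L : fieldType) (d : L -> L).
Hypothesis hd : is_derivation d.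
Lemma der0 : d 0 = 0.
Proof. by apply: (@addrI _ (d 0)); rewrite -(proj1 hd) !addr0. Qed.
Lemma derN x : d (- x) = - d x.
Proof. by apply: (@addrI _ (d x)); rewrite -(proj1 hd) !subrr der0. Qed.
Lemma der1 : d 1 = 0.
Proof.
apply: (@addrI _ (d 1)).
by rewrite addr0 -{3}[1]mulr1 (proj2 hd) mulr1 mul1r.
Qed.
Lemma der_sum (I : Type) (s : seq I) F : d (\sum_(i <- s) F i) = \sum_(i <- s) d (F i).
Proof. by elim/big_rec2: _ => [|i x y _ <-]; [exact: der0|exact: (proj1 hd)]. Qed.
End Derivations.

(** Commutation of the derivations passes from [R] to fractions by differentiating [l * f y = f x]
    in both orders and cancelling [f y]. *)
Lemma prime_diff_field (R : comPzRingType) (m : nat) (d : 'I_m -> R -> R) (P : R -> Prop) :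
  (forall j x y, d j (x + y) = d j x + d j y) ->
  (forall j x y, d j (x * y) = d j x * y + x * d j y) ->
  (forall j k x, d j (d k x) = d k (d j x)) ->
  prime_ideal P -> (forall j x, P x -> P (d j x)) ->
  exists (L : fieldType) (DL : 'I_m -> L -> L) (f : {rmorphism R -> L}),
  is_diff_field DL /\ (forall x, f x = 0 <-> P x) /\
  (forall j x, f (d j x) = DL j (f x)) /\
  (forall l, exists x y, f y != 0 /\ l = f x / f y).
Proof.
move=> dD dM dC hP dP.
have [L [f [f0 fs]]] := prime_fraction_field hP.
have fs' l : exists x y, f y != 0 /\ l = f x / f y.
  have [x [y [ny ->]]] := fs l; exists x, y; split=> //.
  by apply/eqP => /f0.
have fd j : exists D : L -> L, is_derivation D /\ forall x, D (f x) = f (d j x).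
  by apply: fraction_derivation => // x /f0 h; apply/f0/dP.
have [DL hDL] := choice fd.
exists L, DL, f; split; last by split=> //; split=> // j x; rewrite (proj2 (hDL j)).
split=> [j|j k l]; first exact: (proj1 (hDL j)).
have [x [y [ny e]]] := fs' l.
have {}e : l * f y = f x by rewrite e divfK.
have c z : DL j (DL k (f z)) = DL k (DL j (f z)).
  have [[_ h1] [_ h2]] := (hDL j, hDL k).
  by rewrite h1 !h2 h1 dC.
have := c x; rewrite -e.
have [[[Dj Mj] _] [[Dk Mk] _]] := (hDL j, hDL k).
rewrite Mk Mj !Dk !Dj !Mk !Mj c => h.
apply: (mulIf ny); apply: (@addIr _ (l * DL k (DL j (f y)))).
apply: (@addIr _ (DL k l * DL j (f y) + DL j l * DL k (f y))).
transitivity (DL j (DL k l) * f y + DL k l * DL j (f y) +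
    (DL j l * DL k (f y) + l * DL k (DL j (f y)))); first by ring.
by rewrite h; ring.
Qed.

Section Tensor.
Variables (K U M : fieldType) (j : {rmorphism K -> U}) (i : {rmorphism K -> M}).

(* The tensor product of [U] and [M] over [K]: formal sums of pairs [u, m], identified
   when [\sum l(u) m] agree for every [K]-linear functional [l] on [U]. *)
Definition tensor_ev (l : U -> K) (s : seq (U * M)) : M :=
  \sum_(p <- s) i (l p.1) * p.2.
Definition tensor_eq (s t : seq (U * M)) : Prop :=
  forall l, klinear j l -> tensor_ev l s = tensor_ev l t.
Definition tensor_mul (s t : seq (U * M)) : seq (U * M) :=
  [seq (p.1 * q.1, p.2 * q.2) | p <- s, q <- t].
Definition tensor_opp (s : seq (U * M)) := [seq (- p.1, p.2) | p <- s].

Lemma tensor_evD l s t : tensor_ev l (s ++ t) = tensor_ev l s + tensor_ev l t.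
Proof. exact: big_cat. Qed.
Lemma tensor_evN l s : klinear j l -> tensor_ev l (tensor_opp s) = - tensor_ev l s.
Proof.
move=> hl; rewrite /tensor_ev big_map /= -sumrN; apply: eq_bigr => p _.
by rewrite (klinearN _ hl) rmorphN mulNr.
Qed.
(** For a functional [l], the maps [l (p.1 * _)] are again functionals, so the value of a product
    depends only on the class of its second factor. Commutativity then settles the first factor. *)
Lemma tensor_evM l s t : tensor_ev l (tensor_mul s t) =
  \sum_(p <- s) p.2 * tensor_ev (fun x => l (p.1 * x)) t.
Proof.
rewrite /tensor_ev /tensor_mul big_allpairs_dep; apply: eq_bigr => p _ /=.
by rewrite mulr_sumr; apply: eq_bigr => q _; rewrite mulrCA.
Qed.
Lemma tensor_mulC s t : tensor_eq (tensor_mul s t) (tensor_mul t s).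
Proof.
move=> l _; rewrite /tensor_ev /tensor_mul !big_allpairs_dep exchange_big /=.
by apply: eq_bigr => p _; apply: eq_bigr => q _; rewrite [p.1 * _]mulrC [p.2 * _]mulrC.
Qed.

Lemma tensor_setoid : setoid_ring tensor_eq [::] [:: (1, 1)] cat tensor_opp tensor_mul.
Proof.
have mr s t t' : tensor_eq t t' -> tensor_eq (tensor_mul s t) (tensor_mul s t').
  move=> h l hl; rewrite !tensor_evM; apply: eq_bigr => p _.
  by rewrite h //; apply: klinearMl.
have tr t s u : tensor_eq s t -> tensor_eq t u -> tensor_eq s u.
  by move=> h1 h2 l hl; rewrite h1 // h2.
split=> //.
- by move=> x y h l hl; rewrite h.
- by move=> s s' t t' h h' l hl; rewrite !tensor_evD h ?h'.
- by move=> s s' h l hl; rewrite !tensor_evN ?h.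
- move=> s s' t t' h h'; apply: (tr (tensor_mul s t')); first exact: mr.
  apply: (tr _ _ _ (tensor_mulC _ _)); apply: (tr _ _ _ _ (tensor_mulC _ _)).
  exact: mr.
- by move=> s t w l hl; rewrite catA.
- by move=> s t l hl; rewrite !tensor_evD addrC.
- by move=> s l hl; rewrite tensor_evD tensor_evN // addNr /tensor_ev big_nil.
- move=> s t w l hl; rewrite !tensor_evM /tensor_mul big_allpairs_dep.
  apply: eq_bigr => p _; rewrite -/(tensor_mul t w) tensor_evM mulr_sumr.
  apply: eq_bigr => q _ /=; rewrite mulrA; congr (_ * _).
  by apply: eq_bigr => r _; rewrite mulrA.
- exact: tensor_mulC.
- move=> s l hl; rewrite tensor_evM big_seq1 mul1r.
  by apply: eq_bigr => p _; rewrite mul1r.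
- move=> s t w l hl; rewrite tensor_evD !tensor_evM.
  by rewrite big_cat.
Qed.

Lemma tensor_ring : exists (R : comPzRingType) (pU : {rmorphism U -> R})
    (pM : {rmorphism M -> R}),
  (forall k, pU (j k) = pM (i k)) /\
  (forall r, exists s, r = \sum_(p <- s) pU p.1 * pM p.2) /\
  (forall s, \sum_(p <- s) pU p.1 * pM p.2 = 0 <-> tensor_eq s [::]) /\
  (1 : R) <> 0.
Proof.
have [R [p [ps [pE [pz [po [pa [pn pm]]]]]]]] := setoid_ring_quot tensor_setoid.
have [pU hU] : exists pU : {rmorphism U -> R}, forall u, pU u = p [:: (u, 1)].
  apply: rmorph_of => [x y|x y|//].
    rewrite -pa; apply/pE => l hl; rewrite /tensor_ev !big_cons !big_nil /=.
    by rewrite (proj1 hl) rmorphD; ring.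
  rewrite -pm; apply/pE => l hl; rewrite /tensor_ev !big_cons !big_nil /=.
  by ring.
have [pM hM] : exists pM : {rmorphism M -> R}, forall u, pM u = p [:: (1, u)].
  apply: rmorph_of => [x y|x y|//].
    rewrite -pa; apply/pE => l hl; rewrite /tensor_ev !big_cons !big_nil /=.
    by ring.
  rewrite -pm; apply/pE => l hl; rewrite /tensor_ev !big_cons !big_nil /=.
  by rewrite mulr1.
have pS s : \sum_(q <- s) pU q.1 * pM q.2 = p s.
  elim: s => [|q s IH]; first by rewrite big_nil pz.
  rewrite big_cons IH hU hM -pm -pa /=; apply/pE => l hl.
  by rewrite /tensor_ev !big_cons /= mulr1 mul1r.
exists R, pU, pM; split.
  move=> k; rewrite hU hM; apply/pE => l [_ lZ]; rewrite /tensor_ev !big_seq1 /=.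
  by rewrite -[j k]mulr1 lZ rmorphM; ring.
split; first by move=> r; have [s ->] := ps r; exists s; rewrite pS.
split; first by move=> s; rewrite pS -pz; apply: pE.
rewrite -po -pz => /pE h; have [l [hl l1]] := exists_functional1 j.
have := h l hl; rewrite /tensor_ev big_seq1 big_nil /= l1 rmorph1 mulr1 => /eqP.
by rewrite oner_eq0.
Qed.
End Tensor.

Section TensorDerivation.
Variables (K U M : fieldType) (j : {rmorphism K -> U}) (i : {rmorphism K -> M}).
Variables (R : comPzRingType) (pU : {rmorphism U -> R}) (pM : {rmorphism M -> R}).
Let S s := \sum_(p <- s) pU p.1 * pM p.2.
Hypothesis pS : forall r, exists s, r = S s.
Hypothesis p0 : forall s, S s = 0 <-> tensor_eq j i s [::].

(* Well defined because [d \o l - l \o dU] is [K]-linear for every [K]-linear [l]. *)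
Lemma tensor_derivation (d : K -> K) (dU : U -> U) (dM : M -> M) :
  is_derivation d -> is_derivation dU -> is_derivation dM ->
  (forall k, j (d k) = dU (j k)) -> (forall k, i (d k) = dM (i k)) ->
  exists D : R -> R, (forall x y, D (x + y) = D x + D y) /\
    (forall x y, D (x * y) = D x * y + x * D y) /\
    (forall u, D (pU u) = pU (dU u)) /\ (forall u, D (pM u) = pM (dM u)).
Proof.
move=> hd hdU hdM jd id.
have [dUD dUM] := hdU; have [dMD dMM] := hdM; have [dD dMul] := hd.
pose D0 s := \sum_(p <- s) (pU (dU p.1) * pM p.2 + pU p.1 * pM (dM p.2)).
have ev0 (l : U -> K) : tensor_ev i l [::] = 0 by rewrite /tensor_ev big_nil.
have D00 s : S s = 0 -> D0 s = 0.
  move=> /p0 h.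
  pose t := [seq (dU p.1, p.2) | p <- s] ++ [seq (p.1, dM p.2) | p <- s].
  have -> : D0 s = S t by rewrite /S /t big_cat !big_map /= -big_split.
  apply/p0 => l hl; rewrite ev0.
  pose mu x := d (l x) - l (dU x).
  have [lD lZ] := hl.
  have hmu : klinear j mu.
    split=> [x y|k x]; rewrite /mu.
      by rewrite lD dD dUD lD; ring.
    by rewrite lZ dMul dUM lD -jd !lZ; ring.
  have : tensor_ev i l t + tensor_ev i mu s = dM (tensor_ev i l s); last first.
    by rewrite (h _ hmu) (h _ hl) !ev0 addr0 (der0 hdM).
  rewrite /tensor_ev (der_sum hdM) /t big_cat !big_map /= -!big_split /=; apply: eq_bigr => p _.
  by rewrite /mu rmorphB dMM id; ring.
have SD s t : S (s ++ t) = S s + S t by rewrite /S big_cat.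
have D0D s t : D0 (s ++ t) = D0 s + D0 t by rewrite /D0 big_cat.
pose n (s : seq (U * M)) := [seq (- p.1, p.2) | p <- s].
have SN s : S (n s) = - S s.
  rewrite /S big_map -sumrN; apply: eq_bigr => p _.
  by rewrite rmorphN mulNr.
have D0N s : D0 (n s) = - D0 s.
  rewrite /D0 big_map -sumrN; apply: eq_bigr => p _ /=.
  by rewrite (derN hdU) !rmorphN; ring.
have Dw s t : S s = S t -> D0 s = D0 t.
  move=> h; have : D0 (s ++ n t) = 0 by apply: D00; rewrite SD SN h subrr.
  by rewrite D0D D0N => /eqP; rewrite subr_eq0 => /eqP.
have [r hr] := choice pS.
have DE s : D0 (r (S s)) = D0 s by apply: Dw; rewrite -hr.
exists (fun x => D0 (r x)).
have DD x y : D0 (r (x + y)) = D0 (r x) + D0 (r y).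
  by rewrite -D0D; apply: Dw; rewrite SD -!hr.
split=> //; split.
  move=> x y; rewrite {3}(hr x) {2}(hr y).
  pose t := [seq (p.1 * q.1, p.2 * q.2) | p <- r x, q <- r y].
  have -> : D0 (r (x * y)) = D0 t.
    apply: Dw; rewrite -hr {1}(hr x) {1}(hr y) /S /t big_allpairs_dep /=.
    rewrite mulr_suml; apply: eq_bigr => p _; rewrite mulr_sumr.
    by apply: eq_bigr => q _; rewrite !rmorphM; ring.
  rewrite /D0 /S /t big_allpairs_dep /= !mulr_suml -big_split /=.
  apply: eq_bigr => p _; rewrite !mulr_sumr -big_split /=; apply: eq_bigr => q _ /=.
  by rewrite dUM dMM !rmorphD !rmorphM; ring.
split=> u.
  have -> : pU u = S [:: (u, 1)] by rewrite /S big_seq1 /= rmorph1 mulr1.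
  by rewrite DE /D0 big_seq1 /= (der1 hdM) !rmorph1 rmorph0; ring.
have -> : pM u = S [:: (1, u)] by rewrite /S big_seq1 /= rmorph1 mul1r.
by rewrite DE /D0 big_seq1 /= (der1 hdU) !rmorph1 rmorph0; ring.
Qed.
End TensorDerivation.

Lemma natr_invertible (K : fieldType) (R : pzRingType) (f : {rmorphism K -> R}) :
  [pchar K] =i pred0 -> forall n, exists y : R, n.+1%:R * y = 1.
Proof.
move=> K0 n; exists (f (n.+1%:R^-1)).
rewrite -(rmorph_nat f) -rmorphM mulfV ?rmorph1 //.
by move/pcharf0P: K0 => ->.
Qed.

Section Amalgam.
Variables (K U M : fieldType) (m : nat) (D : 'I_m -> K -> K).
Variables (DU : 'I_m -> U -> U) (DM : 'I_m -> M -> M).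
Variables (j : {rmorphism K -> U}) (i : {rmorphism K -> M}).
Hypotheses (K0 : [pchar K] =i pred0) (hD : is_diff_field D).
Hypotheses (hU : is_diff_field DU) (hM : is_diff_field DM).
Hypotheses (jD : diff_emb D DU j) (iD : diff_emb D DM i).

Lemma tensor_diff_ring : exists (R : comPzRingType) (d : 'I_m -> R -> R)
    (pU : {rmorphism U -> R}) (pM : {rmorphism M -> R}),
  [/\ forall l x y, d l (x + y) = d l x + d l y,
      forall l x y, d l (x * y) = d l x * y + x * d l y,
      forall l k x, d l (d k x) = d k (d l x),
      (forall l u, d l (pU u) = pU (DU l u)) /\ (forall l u, d l (pM u) = pM (DM l u)) &
      [/\ forall k, pU (j k) = pM (i k),
       forall r, exists s, r = \sum_(p <- s) pU p.1 * pM p.2,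
       forall s, \sum_(p <- s) pU p.1 * pM p.2 = 0 <-> tensor_eq j i s [::] &
       (1 : R) <> 0]].
Proof.
have [R [pU [pM [pj [ps [p0 R1]]]]]] := tensor_ring j i.
have [d hd] := choice (fun l => tensor_derivation ps p0 (proj1 hD l) (proj1 hU l)
  (proj1 hM l) (jD l) (iD l)).
have dD l x y : d l (x + y) = d l x + d l y by apply: (proj1 (hd l)).
have dM l x y : d l (x * y) = d l x * y + x * d l y by apply: (proj1 (proj2 (hd l))).
have dU l u : d l (pU u) = pU (DU l u) by apply: (proj1 (proj2 (proj2 (hd l)))).
have dMM l u : d l (pM u) = pM (DM l u) by apply: (proj2 (proj2 (proj2 (hd l)))).
have d0 l : d l 0 = 0 by apply: (@addrI _ (d l 0)); rewrite -dD !addr0.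
exists R, d, pU, pM; split=> //.
move=> l k x; have [s ->] := ps x; elim: s => [|p s IH]; first by rewrite !big_nil !d0.
rewrite big_cons !dD IH; congr (_ + _).
by rewrite !(dM, dD, dU, dMM) (proj2 hU) (proj2 hM); ring.
Qed.

Lemma diff_amalgam : exists (F : fieldType) (DF : 'I_m -> F -> F)
    (a : {rmorphism U -> F}) (b : {rmorphism M -> F}),
  [/\ is_diff_field DF, diff_emb DU DF a, diff_emb DM DF b & forall k, a (j k) = b (i k)].
Proof.
have [R [d [pU [pM [dD dM dC [dU dMM] [pj _ _ R1]]]]]] := tensor_diff_ring.
have [P [hP dP]] := exists_prime_diff_ideal dD dM
  (natr_invertible (GRing.RMorphism.clone _ _ (pU \o j) _) K0) R1.
have [F [DF [f [hF [f0 [fd _]]]]]] := prime_diff_field dD dM dC hP dP.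
exists F, DF, (GRing.RMorphism.clone _ _ (f \o pU) _), (GRing.RMorphism.clone _ _ (f \o pM) _).
split=> // [l x|l x|k] /=; first by rewrite -fd dU.
  by rewrite -fd dMM.
by rewrite pj.
Qed.
End Amalgam.

(** * Differential closures *)

Lemma deval_comp (C : Type) (L F : fieldType) (n m : nat) (i : C -> L)
  (DL : 'I_m -> L -> L) (DF : 'I_m -> F -> F) (f : {rmorphism L -> F})
  (b : 'I_n -> L) (p : dterm C n m) : diff_emb DL DF f ->
  f (deval i DL b p) = deval (f \o i) DF (f \o b) p.
Proof.
by move=> fD; elim: p => //= [p Hp q Hq|p Hp|p Hp q Hq|l p Hp];
  rewrite ?(rmorphD, rmorphN, rmorphM, fD) ?Hp ?Hq.
Qed.

Lemma eq_deval (C : Type) (L : fieldType) (n m : nat) (i i' : C -> L)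
  (D : 'I_m -> L -> L) (b b' : 'I_n -> L) (p : dterm C n m) :
  i =1 i' -> b =1 b' -> deval i D b p = deval i' D b' p.
Proof.
by move=> ei eb; elim: p => //= [p Hp q Hq|p Hp|p Hp q Hq|l p Hp]; rewrite ?Hp ?Hq.
Qed.

Fixpoint dmap (C C' : Type) (n m : nat) (f : C -> C') (p : dterm C n m) : dterm C' n m :=
  match p with
  | DVar i => DVar _ _ i
  | DCst c => DCst _ _ (f c)
  | DAdd p q => DAdd (dmap f p) (dmap f q)
  | DOpp p => DOpp (dmap f p)
  | DMul p q => DMul (dmap f p) (dmap f q)
  | DDer j p => DDer j (dmap f p)
  end.

Lemma deval_dmap (C C' : Type) (L : fieldType) (n m : nat) (g : C -> C') (i : C' -> L)
  (D : 'I_m -> L -> L) (b : 'I_n -> L) (p : dterm C n m) :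
  deval i D b (dmap g p) = deval (i \o g) D b p.
Proof. by elim: p => //= [p -> q ->|p ->|p -> q ->|l p ->]. Qed.

Lemma pchar_rmorphism (K L : fieldType) (i : {rmorphism K -> L}) :
  [pchar K] =i pred0 -> [pchar L] =i pred0.
Proof. by move=> K0; apply: ftrans (fmorph_pchar i) K0. Qed.

(* [TInv] turns an inequation solved by all interpretations into a unit of the
   quotient ring, so that it survives the passage to a prime quotient. *)
Inductive tm (C X : Type) (m : nat) : Type :=
| TVar of X
| TCst of C
| TAdd of tm C X m & tm C X m
| TOpp of tm C X m
| TMul of tm C X m & tm C X m
| TInv of tm C X m
| TDer of 'I_m & tm C X m.

Fixpoint tev (C X : Type) (L : fieldType) (m : nat) (f : C -> L)
  (D : 'I_m -> L -> L) (a : X -> L) (p : tm C X m) : L :=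
  match p with
  | TVar i => a i
  | TCst c => f c
  | TAdd p q => tev f D a p + tev f D a q
  | TOpp p => - tev f D a p
  | TMul p q => tev f D a p * tev f D a q
  | TInv p => (tev f D a p)^-1
  | TDer j p => D j (tev f D a p)
  end.

(** * A differential extension that solves all solvable finite systems at once *)

Section SolveAllSystems.
Variables (K : fieldType) (m : nat) (D : 'I_m -> K -> K).
Hypotheses (K0 : [pchar K] =i pred0) (hD : is_diff_field D).

Definition dsystem := {n : nat & (list (dterm K n m) * list (dterm K n m))%type}.
Definition dsolution (L : fieldType) (DL : 'I_m -> L -> L) (i : K -> L) (p : dsystem)
  (b : 'I_(tag p) -> L) : Prop :=
  (forall q, List.In q (tagged p).1 -> deval i DL b q = 0) /\
  (forall q, List.In q (tagged p).2 -> deval i DL b q != 0).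
Definition dsolvable (p : dsystem) : Prop :=
  exists (L : fieldType) (DL : 'I_m -> L -> L) (i : {rmorphism K -> L}),
  [/\ is_diff_field DL, diff_emb D DL i & exists b, @dsolution L DL i p b].

Lemma dsolution_comp (L F : fieldType) (DL : 'I_m -> L -> L) (DF : 'I_m -> F -> F)
  (i : K -> L) (f : {rmorphism L -> F}) p (b : 'I_(tag p) -> L) :
  diff_emb DL DF f -> dsolution DL i b -> @dsolution F DF (f \o i) p (f \o b).
Proof.
move=> fD [b0 bn]; split=> q hq; rewrite -(deval_comp _ _ _ fD).
  by rewrite b0 ?rmorph0.
by rewrite fmorph_eq0 bn.
Qed.

(** Each new solving extension is amalgamated over [K] with the one already built. This is the
    finite satisfiability that the compactness argument below relies on. *)
Lemma dsolvable_all (J : seq dsystem) : (forall p, List.In p J -> dsolvable p) ->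
  exists (L : fieldType) (DL : 'I_m -> L -> L) (i : {rmorphism K -> L}),
  [/\ is_diff_field DL, diff_emb D DL i &
   forall p, List.In p J -> exists b, @dsolution L DL i p b].
Proof.
elim: J => [|p J IH] hJ.
  exists K, D, (GRing.RMorphism.clone _ _ idfun _); split=> // p [].
have [L [DL [i [hL iD iJ]]]] := IH (fun q h => hJ q (or_intror h)).
have [M [DM [i' [hM i'D [b hb]]]]] := hJ p (or_introl erefl).
have [F [DF [f [g [hF fD gD e]]]]] := diff_amalgam K0 hD hL hM iD i'D.
exists F, DF, (GRing.RMorphism.clone _ _ (f \o i) _); split=> //.
  by move=> l x /=; rewrite iD fD.
move=> q [<-|/iJ[b' hb']]; last by exists (f \o b'); apply: dsolution_comp.
exists (g \o b).
have -> : (GRing.RMorphism.clone _ _ (f \o i) _ : K -> F) = g \o i'.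
  by apply/funext => k /=; rewrite e.
exact: dsolution_comp.
Qed.

Let X := {p : dsystem & 'I_(tag p)}.
Let T := tm K X m.
Let mev (L : fieldType) (DL : 'I_m -> L -> L) (i : K -> L)
  (a : forall p : dsystem, 'I_(tag p) -> L) : T -> L :=
  tev i DL (fun x : X => a (tag x) (tagged x)).
(** A compactness argument: terms in the unknowns of all systems are identified when finitely many
    solvable systems force their equality. The quotient could be trivial only if finitely many
    solvable systems were jointly unsolvable. *)
Let E (s t : T) : Prop := exists J : seq dsystem,
  (forall p, List.In p J -> dsolvable p) /\
  forall (L : fieldType) (DL : 'I_m -> L -> L) (i : {rmorphism K -> L})
    (a : forall p : dsystem, 'I_(tag p) -> L),
  is_diff_field DL -> diff_emb D DL i ->
  (forall p, List.In p J -> dsolution DL i (a p)) -> mev DL i a s = mev DL i a t.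

Let E_of s t : (forall (L : fieldType) (DL : 'I_m -> L -> L) (i : {rmorphism K -> L}) a,
  is_diff_field DL -> diff_emb D DL i -> mev DL i a s = mev DL i a t) -> E s t.
Proof. by move=> h; exists [::]; split=> // L DL i a hL iD _; apply: h. Qed.

Let E_congr s1 t1 s2 t2 s t : E s1 t1 -> E s2 t2 ->
  (forall (L : fieldType) (DL : 'I_m -> L -> L) (i : {rmorphism K -> L}) a,
  is_diff_field DL -> diff_emb D DL i -> mev DL i a s1 = mev DL i a t1 ->
  mev DL i a s2 = mev DL i a t2 -> mev DL i a s = mev DL i a t) -> E s t.
Proof.
move=> [J1 [s1J h1]] [J2 [s2J h2]] h; exists (J1 ++ J2)%list; split.
  by move=> p hp; case: (List.in_app_or _ _ _ hp); auto.
move=> L DL i a hL iD ha; apply: h => //.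
  by apply: h1 => // p pJ; apply/ha/List.in_or_app; left.
by apply: h2 => // p pJ; apply/ha/List.in_or_app; right.
Qed.

Let t0 : T := TCst _ _ 0.
Let t1 : T := TCst _ _ 1.

Let setoidE : setoid_ring E t0 t1 (@TAdd _ _ _) (@TOpp _ _ _) (@TMul _ _ _).
Proof.
split.
- by move=> x; apply: E_of.
- by move=> x y h; apply: (E_congr h h) => *; symmetry.
- by move=> y x w h1 h2; apply: (E_congr h1 h2) => L DL i a _ _ e1 e2; rewrite e1.
- by move=> x x' y y' h h'; apply: (E_congr h h') => L DL i a _ _; rewrite /mev /= => -> ->.
- by move=> x x' h; apply: (E_congr h h) => L DL i a _ _; rewrite /mev /= => ->.
- by move=> x x' y y' h h'; apply: (E_congr h h') => L DL i a _ _; rewrite /mev /= => -> ->.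
- by move=> *; apply: E_of => *; rewrite /mev /= addrA.
- by move=> *; apply: E_of => *; rewrite /mev /= addrC.
- by move=> *; apply: E_of => *; rewrite /mev /= rmorph0 add0r.
- by move=> *; apply: E_of => *; rewrite /mev /= rmorph0 addNr.
- by move=> *; apply: E_of => *; rewrite /mev /= mulrA.
- by move=> *; apply: E_of => *; rewrite /mev /= mulrC.
- by move=> *; apply: E_of => *; rewrite /mev /= rmorph1 mul1r.
- by move=> *; apply: E_of => *; rewrite /mev /= mulrDl.
Qed.

Fixpoint tm_of_dterm (p : dsystem) (q : dterm K (tag p) m) : tm K X m :=
  match q with
  | DVar k => TVar _ _ (Tagged (fun p : dsystem => 'I_(tag p)) k)
  | DCst c => TCst _ _ c
  | DAdd q r => TAdd (tm_of_dterm q) (tm_of_dterm r)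
  | DOpp q => TOpp (tm_of_dterm q)
  | DMul q r => TMul (tm_of_dterm q) (tm_of_dterm r)
  | DDer j q => TDer j (tm_of_dterm q)
  end.

Let mev_dterm (L : fieldType) (DL : 'I_m -> L -> L) (i : K -> L) a p
  (q : dterm K (tag p) m) : mev DL i a (tm_of_dterm q) = deval i DL (a p) q.
Proof.
by elim: q => //= [q Hq r Hr|q Hq|q Hq r Hr|l q Hq]; rewrite /mev /= -?Hq -?Hr.
Qed.

Lemma solve_all_systems : exists (K1 : fieldType) (D1 : 'I_m -> K1 -> K1)
  (i : {rmorphism K -> K1}),
  [/\ is_diff_field D1, diff_emb D D1 i &
   forall p, dsolvable p -> exists b, @dsolution K1 D1 i p b].
Proof.
have [R [p [ps [pE [pz [po [pa [pn pm]]]]]]]] := setoid_ring_quot setoidE.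
have [r hr] := choice ps.
pose d l x := p (TDer l (r x)).
have dE l s : d l (p s) = p (TDer l s).
  apply/pE; have /pE h := hr (p s).
  by apply: (E_congr h h) => L DL i a _ _; rewrite /mev /= => ->.
have dD l x y : d l (x + y) = d l x + d l y.
  rewrite (hr x) (hr y) -pa !dE -pa; apply/pE/E_of => L DL i a hL iD.
  by rewrite /mev /= (proj1 (proj1 hL l)).
have dM l x y : d l (x * y) = d l x * y + x * d l y.
  rewrite (hr x) (hr y) -pm !dE -!pm -pa; apply/pE/E_of => L DL i a hL iD.
  by rewrite /mev /= (proj2 (proj1 hL l)).
have dC l k x : d l (d k x) = d k (d l x).
  rewrite (hr x) !dE; apply/pE/E_of => L DL i a hL iD.
  by rewrite /mev /= (proj2 hL).
have [c hc] : exists c : {rmorphism K -> R}, forall k, c k = p (TCst _ _ k).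
  apply: rmorph_of => [x y|x y|//].
    by rewrite -pa; apply/pE/E_of => *; rewrite /mev /= rmorphD.
  by rewrite -pm; apply/pE/E_of => *; rewrite /mev /= rmorphM.
have R1 : (1 : R) <> 0.
  rewrite -po -pz => /pE[J [hJ h]].
  have [L [DL [i [hL iD hb]]]] := dsolvable_all hJ.
  (* Only the systems in [J] need a solution; all other unknowns get the default value 0. *)
  have [a ha] : exists a : forall p : dsystem, 'I_(tag p) -> L,
      forall p, List.In p J -> dsolution DL i (a p).
    pose Q p (b : 'I_(tag p) -> L) := List.In p J -> dsolution DL i b.
    have hQ q : exists b, Q q b.
      have [/hb[b hqb]|nJ] := pselect (List.In q J); first by exists b.
      by exists (fun=> 0).
    exists (fun q => projT1 (cid (hQ q))) => q.
    by case: (cid (hQ q)).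
  have := h _ _ _ _ hL iD ha; rewrite /mev /= rmorph0 rmorph1 => /eqP.
  by rewrite oner_eq0.
have [P [hP dP]] := exists_prime_diff_ideal dD dM (natr_invertible c K0) R1.
have [F [DF [f [hF [f0 [fd _]]]]]] := prime_diff_field dD dM dC hP dP.
pose i := GRing.RMorphism.clone _ _ (f \o c) _ : {rmorphism K -> F}.
have iE k : i k = f (p (TCst _ _ k)) by rewrite /= hc.
exists F, DF, i; split=> // [l x|q hq].
  rewrite !iE -fd dE; congr (f _); apply/pE/E_of => L DL j a hL jD.
  by rewrite /mev /= jD.
pose b (k : 'I_(tag q)) : F :=
  f (p (TVar _ _ (Tagged (fun p : dsystem => 'I_(tag p)) k))).
have bE w : deval i DF b w = f (p (tm_of_dterm w)).
  elim: w => //= [w Hw v Hv|w Hw|w Hw v Hv|l w Hw]; rewrite ?Hw ?Hv.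
  - by rewrite -rmorphD -pa.
  - by rewrite -rmorphN -pn.
  - by rewrite -rmorphM -pm.
  - by rewrite -fd dE.
exists b; split=> w hw; rewrite bE.
  rewrite -(rmorph0 f) -pz; congr (f _); apply/pE; exists [:: q]; split.
    by move=> q' [<-|[]].
  move=> L DL j a hL jD h; rewrite mev_dterm /mev /= rmorph0.
  by apply: (proj1 (h _ (or_introl erefl))).
have e : p (TMul (tm_of_dterm w) (TInv (tm_of_dterm w))) = 1.
  rewrite -po; apply/pE; exists [:: q]; split; first by move=> q' [<-|[]].
  move=> L DL j a hL jD h; rewrite /mev /= -/(mev _ _ _ _) mev_dterm rmorph1 mulfV //.
  by apply: (proj2 (h _ (or_introl erefl))).
have : f 1 != 0 by rewrite rmorph1 oner_eq0.
by rewrite -e pm rmorphM mulf_eq0 negb_or => /andP[].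
Qed.
End SolveAllSystems.

(** * Unions of chains and the construction of a differential closure *)

Lemma coherent_sequence (K_ : nat -> fieldType)
  (f_ : forall n, {rmorphism K_ n -> K_ n.+1}) (N : nat) (x : K_ N) :
  exists s : forall n, K_ n, s N = x /\
    forall n, (N <= n)%N -> s n.+1 = f_ n (s n).
Proof.
elim: N K_ f_ x => [|N IH] K_ f_ x.
  by exists (nat_rect K_ x (fun n y => f_ n y)).
have [s [sN hs]] := IH (fun n => K_ n.+1) (fun n => f_ n.+1) x.
exists (fun n => if n is n'.+1 then s n' else 0); split=> //.
by case=> // n; rewrite ltnS => /hs.
Qed.

(* The union of a chain is realized by eventually coherent sequences, modulo
   eventual equality, which avoids transporting elements along equalities of indices. *)
Lemma diff_chain_union (m : nat) (K_ : nat -> fieldType)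
  (D_ : forall n, 'I_m -> K_ n -> K_ n) (f_ : forall n, {rmorphism K_ n -> K_ n.+1}) :
  (forall n, is_diff_field (D_ n)) -> (forall n, diff_emb (D_ n) (D_ n.+1) (f_ n)) ->
  exists (U : fieldType) (DU : 'I_m -> U -> U) (i_ : forall n, {rmorphism K_ n -> U}),
  [/\ is_diff_field DU, forall n, diff_emb (D_ n) DU (i_ n),
    forall n x, i_ n.+1 (f_ n x) = i_ n x & forall u, exists n x, u = i_ n x].
Proof.
move=> hD fD.
pose coh (x : forall n, K_ n) :=
  exists N, forall n, (N <= n)%N -> x n.+1 = f_ n (x n).
pose T := {x : forall n, K_ n | coh x}.
pose E (x y : T) := exists N, forall n, (N <= n)%N -> sval x n = sval y n.
have coh1 (g : forall n, K_ n -> K_ n) (x : T) :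
    (forall n y, f_ n (g n y) = g n.+1 (f_ n y)) -> coh (fun n => g n (sval x n)).
  by case: x => x [N hN] /= hg; exists N => n /hN ->; rewrite hg.
have coh2 (g : forall n, K_ n -> K_ n -> K_ n) (x y : T) :
    (forall n u v, f_ n (g n u v) = g n.+1 (f_ n u) (f_ n v)) ->
    coh (fun n => g n (sval x n) (sval y n)).
  case: x y => [x [N hN]] [y [M hM]] /= hg; exists (maxn N M) => n.
  by rewrite geq_max => /andP[/hN -> /hM ->]; rewrite hg.
have coh0 : coh (fun n => 0) by exists 0%N => n _; rewrite rmorph0.
have coho : coh (fun n => 1) by exists 0%N => n _; rewrite rmorph1.
pose z : T := exist _ _ coh0; pose o : T := exist _ _ coho.
pose a (x y : T) : T := exist _ _ (coh2 (fun n u v => u + v) x y (fun n => rmorphD (f_ n))).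
pose u (x y : T) : T := exist _ _ (coh2 (fun n u v => u * v) x y (fun n => rmorphM (f_ n))).
pose n (x : T) : T := exist _ _ (coh1 (fun n u => - u) x (fun n => rmorphN (f_ n))).
pose v (x : T) : T := exist _ _ (coh1 (fun n u => u^-1) x (fun n => fmorphV (f_ n))).
pose e j (x : T) : T := exist _ _ (coh1 (fun n u => D_ n j u) x (fun n => fD n j)).
have E_of x y : (forall k, sval x k = sval y k) -> E x y by move=> h; exists 0%N.
have E_congr x y x' y' x'' y'' : E x y -> E x' y' ->
    (forall k, sval x k = sval y k -> sval x' k = sval y' k -> sval x'' k = sval y'' k) ->
    E x'' y''.
  move=> [N hN] [M hM] h; exists (maxn N M) => k.
  by rewrite geq_max => /andP[/hN h1 /hM h2]; apply: h.
have sE : setoid_ring E z o a n u.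
  split.
  - by move=> x; apply: E_of.
  - by move=> x y h; apply: (E_congr _ _ _ _ _ _ h h) => k ->.
  - by move=> y x w h1 h2; apply: (E_congr _ _ _ _ _ _ h1 h2) => k -> ->.
  - by move=> x x' y y' h1 h2; apply: (E_congr _ _ _ _ _ _ h1 h2) => k /= -> ->.
  - by move=> x x' h1; apply: (E_congr _ _ _ _ _ _ h1 h1) => k /= ->.
  - by move=> x x' y y' h1 h2; apply: (E_congr _ _ _ _ _ _ h1 h2) => k /= -> ->.
  - by move=> *; apply: E_of => k /=; rewrite addrA.
  - by move=> *; apply: E_of => k /=; rewrite addrC.
  - by move=> *; apply: E_of => k /=; rewrite add0r.
  - by move=> *; apply: E_of => k /=; rewrite addNr.
  - by move=> *; apply: E_of => k /=; rewrite mulrA.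
  - by move=> *; apply: E_of => k /=; rewrite mulrC.
  - by move=> *; apply: E_of => k /=; rewrite mul1r.
  - by move=> *; apply: E_of => k /=; rewrite mulrDl.
have [R [p [ps [pE [pz [po [pa [pn pm]]]]]]]] := setoid_ring_quot sE.
have [r hr] := choice ps.
pose d l x := p (e l (r x)).
have dE l s : d l (p s) = p (e l s).
  apply/pE; have /pE h := hr (p s).
  by apply: (E_congr _ _ _ _ _ _ h h) => k /= ->.
have dD l x y : d l (x + y) = d l x + d l y.
  rewrite (hr x) (hr y) -pa !dE -pa; apply/pE/E_of => k /=.
  by rewrite (proj1 (proj1 (hD k) l)).
have dM l x y : d l (x * y) = d l x * y + x * d l y.
  rewrite (hr x) (hr y) -pm !dE -!pm -pa; apply/pE/E_of => k /=.
  by rewrite (proj2 (proj1 (hD k) l)).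
have dC l k x : d l (d k x) = d k (d l x).
  rewrite (hr x) !dE; apply/pE/E_of => q /=.
  by rewrite (proj2 (hD q)).
have R1 : (1 : R) <> 0.
  rewrite -po -pz => /pE[N /(_ N (leqnn N)) /= /eqP].
  by rewrite oner_eq0.
(* A sequence that vanishes at one stage of its coherent range vanishes from there on, so a nonzero
   class has only invertible entries in that range. *)
have pV x : p x <> 0 -> p (v x) * p x = 1.
  move=> nx; rewrite -pm -po; apply/pE; case: x nx => x [N hN] nx.
  exists N => k Nk /=; rewrite mulVf //; apply/eqP => xk; apply: nx.
  rewrite -pz; apply/pE; exists k => l /= /subnK <-.
  elim: (l - k)%N => [|l' IH]; first by rewrite add0n.
  by rewrite addSn hN ?IH ?rmorph0 // (leq_trans Nk) ?leq_addl.
(* The ring is already a field; taking fractions at the zero ideal only equips it with the structure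
   of a [fieldType] and its derivations. *)
have hP : prime_ideal (fun x : R => x = 0).
  split=> //; first by move=> x y -> ->; rewrite addr0.
    by move=> q x ->; rewrite mulr0.
  move=> x y xy; have [x0|nx] := pselect (x = 0); [by left|right].
  move: xy nx; rewrite (hr x) => xy /pV h.
  by rewrite -[y]mul1r -h -mulrA xy mulr0.
have [|U [DU [f [hU [f0 [fd fs]]]]]] := prime_diff_field dD dM dC hP.
  by move=> l x ->; apply: (@addrI _ (d l 0)); rewrite -dD !addr0.
pose sq N := projT1 (choice (coherent_sequence f_ (N := N))).
have hsq N x : sq N x N = x /\ forall n, (N <= n)%N -> sq N x n.+1 = f_ n (sq N x n).
  by rewrite /sq; case: choice => s hs /=.
have csq N x : coh (sq N x) by exists N; have [_] := hsq N x.
have hi N : exists i : {rmorphism K_ N -> U}, forall x, i x = f (p (exist _ _ (csq N x))).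
  have sqE (x : K_ N) (y : T) : sval y N = x ->
      (forall k, (N <= k)%N -> sval y k.+1 = f_ k (sval y k)) ->
      E (exist _ _ (csq N x)) y.
    move=> yN hy; exists N => k /subnK <- /=; have [sN hs] := hsq N x.
    elim: (k - N)%N => [|k' IH]; first by rewrite add0n sN.
    by rewrite addSn hs ?hy ?IH // leq_addl.
  apply: rmorph_of => [x y|x y|].
  - rewrite -rmorphD -pa; congr (f _); apply/pE/sqE => [|k Nk] /=.
      by rewrite !(proj1 (hsq N _)).
    by rewrite !(proj2 (hsq N _)) // rmorphD.
  - rewrite -rmorphM -pm; congr (f _); apply/pE/sqE => [|k Nk] /=.
      by rewrite !(proj1 (hsq N _)).
    by rewrite !(proj2 (hsq N _)) // rmorphM.
  - rewrite -(rmorph1 f) -po; congr (f _); apply/pE/sqE => // k _ /=.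
    by rewrite rmorph1.
have [i_ hi_] : exists i_ : forall N, {rmorphism K_ N -> U},
    forall N x, i_ N x = f (p (exist _ _ (csq N x))).
  by exists (fun N => projT1 (cid (hi N))) => N; case: (cid (hi N)).
have iE N (x : K_ N) (y : T) M : (forall k, (M <= k)%N -> sval y k.+1 = f_ k (sval y k)) ->
    forall k, (M <= k)%N -> (N <= k)%N -> sval y k = sq N x k -> f (p y) = i_ N x.
  move=> hy k Mk Nk h; rewrite hi_; congr (f _); apply/pE; exists k => l /subnK <- /=.
  elim: (l - k)%N => [|l' IH]; first by rewrite add0n.
  rewrite addSn hy ?(leq_trans Mk) ?leq_addl // IH (proj2 (hsq N _)) //.
  by rewrite (leq_trans Nk) ?leq_addl.
exists U, DU, i_; split=> //.
- move=> N l x; rewrite [in RHS]hi_ -fd dE; symmetry.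
  apply: (iE _ _ _ N _ N) => //=; last by rewrite !(proj1 (hsq N _)).
  by move=> k Nk; rewrite (proj2 (hsq N _)) // fD.
- move=> N x; rewrite [RHS]hi_; symmetry.
  have hN := proj2 (hsq N x).
  apply: (iE _ _ _ N.+1 _ N.+1) => //=.
    by move=> k /ltnW; apply: hN.
  by rewrite hN // (proj1 (hsq N x)) (proj1 (hsq _ _)).
- move=> w; have [x [y [ny ->]]] := fs w.
  have -> : f x / f y = f (x * p (v (r y))).
    rewrite rmorphM; congr (_ * _); apply: (mulIf ny); rewrite mulVf // -rmorphM.
    have hy : p (r y) <> 0 by rewrite -hr => y0; rewrite y0 rmorph0 eqxx in ny.
    by rewrite {2}(hr y) pV ?rmorph1.
  have [[s [N hN]] ->] := ps (x * p (v (r y))).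
  exists N, (s N); apply: (iE _ _ _ N _ N) => //=.
  by rewrite (proj1 (hsq N _)).
Qed.

Lemma dmap_lift (m n : nat) (K_ : nat -> fieldType) (f_ : forall k, {rmorphism K_ k -> K_ k.+1})
  (U : fieldType) (i_ : forall k, {rmorphism K_ k -> U}) :
  (forall k x, i_ k.+1 (f_ k x) = i_ k x) -> (forall u, exists k x, u = i_ k x) ->
  forall q : dterm U n m, exists N, forall k, (N <= k)%N ->
  exists q' : dterm (K_ k) n m, q = dmap (i_ k) q'.
Proof.
move=> fi si.
have up u : exists N, forall k, (N <= k)%N -> exists x : K_ k, u = i_ k x.
  have [N [x ->]] := si u; exists N => k /subnK <-.
  elim: (k - N)%N => [|l [y ->]]; first by exists x.
  by exists (f_ _ y); rewrite [in RHS]fi.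
elim=> [k|c|q [N hN] r [M hM]|q [N hN]|q [N hN] r [M hM]|l q [N hN]].
- by exists 0%N => N _; exists (DVar _ _ k).
- have [N hN] := up c; exists N => k /hN[x ->]; by exists (DCst _ _ x).
- exists (maxn N M) => k; rewrite geq_max => /andP[/hN[q' ->] /hM[r' ->]].
  by exists (DAdd q' r').
- by exists N => k /hN[q' ->]; exists (DOpp q').
- exists (maxn N M) => k; rewrite geq_max => /andP[/hN[q' ->] /hM[r' ->]].
  by exists (DMul q' r').
- by exists N => k /hN[q' ->]; exists (DDer l q').
Qed.

Lemma dmaps_lift (m n : nat) (K_ : nat -> fieldType) (f_ : forall k, {rmorphism K_ k -> K_ k.+1})
  (U : fieldType) (i_ : forall k, {rmorphism K_ k -> U}) :
  (forall k x, i_ k.+1 (f_ k x) = i_ k x) -> (forall u, exists k x, u = i_ k x) ->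
  forall s : seq (dterm U n m), exists N, forall k, (N <= k)%N ->
  exists s' : seq (dterm (K_ k) n m), s = map (dmap (i_ k)) s'.
Proof.
move=> fi si; elim=> [|q s [N hN]]; first by exists 0%N => k _; exists [::].
have [M hM] := dmap_lift fi si q.
exists (maxn N M) => k; rewrite geq_max => /andP[/hN[s' ->] /hM[q' ->]].
by exists (q' :: s').
Qed.

(** Bundled so that a chain of extensions can be defined by recursion on its length. *)
Record char0_diff_field (m : nat) := Char0DiffField {
  cdf_sort : fieldType;
  cdf_der : 'I_m -> cdf_sort -> cdf_sort;
  cdf_char : [pchar cdf_sort] =i pred0;
  cdf_diff : is_diff_field cdf_der }.

(** One step solves only the systems with coefficients in the previous field. After countably many
    steps a finite system over the union has its coefficients at some finite stage and is solved at
    the next one. *)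
Lemma exists_diff_closure (K : fieldType) (m : nat) (D : 'I_m -> K -> K) :
  [pchar K] =i pred0 -> is_diff_field D ->
  exists (U : fieldType) (DU : 'I_m -> U -> U) (i : {rmorphism K -> U}),
    diff_closed DU /\ diff_emb D DU i.
Proof.
move=> K0 hD.
pose X := char0_diff_field m.
have step (A : X) : exists B : {B : X & {rmorphism cdf_sort A -> cdf_sort B}},
    diff_emb (@cdf_der _ A) (@cdf_der _ (tag B)) (tagged B) /\
    forall p, dsolvable (@cdf_der _ A) p -> exists b,
      @dsolution _ m _ (@cdf_der _ (tag B)) (tagged B) p b.
  have [K1 [D1 [i [h1 iD hi]]]] := solve_all_systems (@cdf_char _ A) (@cdf_diff _ A).
  exists (Tagged (fun B : X => {rmorphism cdf_sort A -> cdf_sort B})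
     (i : {rmorphism _ -> cdf_sort (Char0DiffField (pchar_rmorphism i (@cdf_char _ A)) h1)})).
  by split.
pose nxt A := projT1 (cid (step A)).
pose fix ch (n : nat) : X :=
  if n is n'.+1 then tag (nxt (ch n')) else Char0DiffField K0 hD.
pose f_ n : {rmorphism cdf_sort (ch n) -> cdf_sort (ch n.+1)} := tagged (nxt (ch n)).
have hf n : diff_emb (@cdf_der _ (ch n)) (@cdf_der _ (ch n.+1)) (f_ n) /\
    forall p, dsolvable (@cdf_der _ (ch n)) p -> exists b,
      @dsolution _ m _ (@cdf_der _ (ch n.+1)) (f_ n) p b.
  by rewrite /f_ /= /nxt; case: cid => B hB /=.
have [U [DU [i_ [hU iD fi si]]]] := diff_chain_union
  (fun n => @cdf_diff _ (ch n)) (fun n => proj1 (hf n)).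
exists U, DU, (i_ 0%N : {rmorphism K -> U}); split; last exact: (iD 0%N).
split; first exact: (pchar_rmorphism (i_ 0%N)).
split=> // L DL i hL iL n eqs neqs [b [b0 bn]].
have [N hN] := dmaps_lift fi si eqs.
have [M hM] := dmaps_lift fi si neqs.
have [eqs' eqsE] := hN _ (leq_maxl N M); have [neqs' neqsE] := hM _ (leq_maxr N M).
set k := maxn N M in eqs' neqs' eqsE neqsE.
pose p : dsystem (cdf_sort (ch k)) m := existT (fun r : nat =>
  (list (dterm (cdf_sort (ch k)) r m) * list (dterm (cdf_sort (ch k)) r m))%type) n (eqs', neqs').
have sp : dsolvable (@cdf_der _ (ch k)) p.
  exists L, DL, (GRing.RMorphism.clone _ _ (i \o i_ k) _); split=> //.
    by move=> l x /=; rewrite iD iL.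
  exists b; split=> q hq /=; rewrite -(deval_dmap (i_ k) i).
    by apply: b0; rewrite eqsE; apply: List.in_map.
  by apply: bn; rewrite neqsE; apply: List.in_map.
have [c hc] := proj2 (hf k) p sp.
have {hc}[c0 cn] := dsolution_comp (iD k.+1) hc.
exists (i_ k.+1 \o c); split=> q.
  rewrite eqsE => /List.in_map_iff[q' [<- hq']]; rewrite deval_dmap.
  by rewrite -[RHS](c0 _ hq'); apply: eq_deval => // x /=; rewrite fi.
rewrite neqsE => /List.in_map_iff[q' [<- hq']]; rewrite deval_dmap.
by have := cn _ hq'; congr (_ != _); apply: eq_deval => // x /=; rewrite fi.
Qed.

(** * Orders on exponents and Dickson's lemma *)

(** On the codes of jets, whose head is the number of the variable, this is a ranking: it compares
    variables first and then exponents, and is compatible with derivation. *)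
Fixpoint ltlex (s t : seq nat) : bool :=
  match s, t with
  | x :: s', y :: t' => (x < y)%N || ((x == y) && ltlex s' t')
  | _, _ => false
  end.

Lemma ltlex_trans t s u : ltlex s t -> ltlex t u -> ltlex s u.
Proof.
elim: t s u => [|y t IH] [|x s] [|z u] //=.
move=> /orP[xy|/andP[/eqP-> st]] /orP[yz|/andP[/eqP<- tu]]; rewrite ?(ltn_trans xy yz) //.
- by rewrite xy.
- by rewrite yz.
- by rewrite (IH _ _ st tu) eqxx orbT.
Qed.

Lemma ltlex_total s t : size s = size t -> [\/ ltlex s t, s = t | ltlex t s].
Proof.
elim: s t => [|x s IH] [|y t] //= => [_|[/IH h]]; first by constructor 2.
case: (ltngtP x y) => /= [_|_|->]; [by constructor 1|by constructor 3|].
by case: h => [h|->|h]; [constructor 1|constructor 2|constructor 3].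
Qed.

Lemma ltlex_incr s t j : size s = size t -> ltlex s t ->
  ltlex (incr_nth s j) (incr_nth t j).
Proof.
elim: s t j => [|x s IH] [|y t] [|j] //= [st].
by case/orP=> [->//|/andP[-> h]]; rewrite IH ?orbT.
Qed.

Lemma ltlex_incr_self s j : (j < size s)%N -> ltlex s (incr_nth s j).
Proof.
by elim: s j => [|x s IH] [|j] //=; rewrite ?ltnS ?leqnn // ?eqxx => /IH ->; rewrite orbT.
Qed.

(** The length must be fixed: [[:: 1]], [[:: 0; 1]], [[:: 0; 0; 1]] and so on descend forever. *)
Lemma ltlex_wf (k : nat) (P : seq nat -> Prop) :
  (forall s, size s = k -> (forall t, size t = k -> ltlex t s -> P t) -> P s) ->
  forall s, size s = k -> P s.
Proof.
elim: k P => [|k IH] P hP s.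
  by move=> s0; apply: hP => // t; case: t; case: s s0.
case: s => // x s [sk]; elim/ltn_ind: x s sk => x IHx.
apply: (IH (fun s => P (x :: s))) => s sk IHs.
apply: hP => [|[|y t] //= [tk]]; first by rewrite /= sk.
by case/orP=> [/IHx|/andP[/eqP-> /IHs]]; apply.
Qed.

(** Take a basis [B] of the set of tails and a bound [N] for heads that lift it back to [P]. A point
    with head at least [N] dominates one of these lifts; the heads below [N] give finitely many
    slices, each treated by induction. *)
Lemma dickson (k : nat) (P : seq nat -> Prop) : exists B : seq (seq nat),
  (forall x, x \in B -> P x /\ size x = k) /\
  (forall x, P x -> size x = k -> exists2 y, y \in B & all2 leq y x).
Proof.
elim: k P => [|k IH] P.
  have [P0|nP0] := pselect (P [::]); last by exists [::]; split=> // -[].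
  exists [:: [::]]; split=> [x|[] // _ _]; first by rewrite inE => /eqP->.
  by exists [::].
have [B [BP hB]] := IH (fun s => exists c, P (c :: s)).
have [N hN] : exists N, forall s, s \in B -> exists2 c, (c <= N)%N & P (c :: s).
  have : forall s, s \in B -> exists c, P (c :: s) by move=> s /BP[].
  elim: B {BP hB} => [|s B IHB] h; first by exists 0%N.
  have [N hN] := IHB (fun t tB => h t (mem_behead (s := s :: B) tB)).
  have [c hc] := h s (mem_head _ _).
  exists (maxn c N) => t; rewrite inE => /orP[/eqP->|/hN[c' c'N hc']].
    by exists c; rewrite ?leq_maxl.
  by exists c' => //; rewrite (leq_trans c'N) ?leq_maxr.
have [B2 [B2P hB2]] : exists B2 : seq (seq nat),
    (forall x, x \in B2 -> P x /\ size x = k.+1) /\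
    (forall c s, (c < N)%N -> P (c :: s) -> size s = k ->
       exists2 y, y \in B2 & all2 leq y (c :: s)).
  elim: N {hN} => [|N [B2 [B2P hB2]]]; first by exists [::].
  have [B1 [B1P hB1]] := IH (fun s => P (N :: s)).
  exists (map (cons N) B1 ++ B2); split.
    move=> x; rewrite mem_cat => /orP[/mapP[y /B1P[h1 h2] ->]|/B2P] //.
    by rewrite /= h2.
  move=> c s; rewrite ltnS leq_eqVlt => /orP[/eqP->|cN] Pcs sk.
    have [y yB ys] := hB1 _ Pcs sk.
    by exists (N :: y); rewrite ?mem_cat ?map_f //= leqnn.
  by have [y yB ys] := hB2 _ _ cN Pcs sk; exists y; rewrite // mem_cat yB orbT.
have [B3 [B3P hB3]] : exists B3 : seq (seq nat),
    (forall x, x \in B3 -> P x /\ size x = k.+1) /\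
    (forall s, s \in B -> exists2 c, (c <= N)%N & c :: s \in B3).
  elim: B BP hN {hB} => [|s B IHB] BP hN; first by exists [::].
  have [|t tB|B3 [B3P hB3]] := IHB.
  - by move=> t tB; apply: BP; rewrite inE tB orbT.
  - by apply: hN; rewrite inE tB orbT.
  have [c cN hc] := hN s (mem_head _ _).
  have [_ sk] := BP s (mem_head _ _).
  exists ((c :: s) :: B3); split.
    by move=> x; rewrite inE => /orP[/eqP->|/B3P//]; rewrite /= sk.
  move=> t; rewrite inE => /orP[/eqP->|/hB3[c' c'N h]].
    by exists c; rewrite ?mem_head.
  by exists c' => //; rewrite inE h orbT.
exists (B2 ++ B3); split.
  by move=> x; rewrite mem_cat => /orP[/B2P|/B3P].
case=> // c s Pcs [sk]; have [cN|Nc] := ltnP c N.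
  by have [y yB ys] := hB2 _ _ cN Pcs sk; exists y; rewrite ?mem_cat ?yB.
have [y yB ys] := hB s (ex_intro _ c Pcs) sk.
have [c' c'N h] := hB3 _ yB.
by exists (c' :: y); rewrite ?mem_cat ?h ?orbT //= (leq_trans c'N).
Qed.

Lemma sumn_incr_nth s j : sumn (incr_nth s j) = (sumn s).+1.
Proof.
elim: s j => [|x s IH] [|j] //=; last by rewrite IH addnS.
by elim: j.
Qed.

(** [w] codes a derivative of the jet coded by [v]. The shift [j.+1] is due to position 0, which
    holds the number of the variable. *)
Inductive incr_reach (m : nat) (v : seq nat) : seq nat -> Prop :=
| incr_reach0 : incr_reach m v v
| incr_reachS w (j : 'I_m) : incr_reach m v w -> incr_reach m v (incr_nth w j.+1).

Lemma all2_leq_reach m k s t : size t = m -> all2 leq s t ->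
  incr_reach m (k :: s) (k :: t).
Proof.
move: {2}(sumn t) (erefl (sumn t)) => N; elim: N t => [|N IH] t st tm.
  move=> h; suff -> : s = t by constructor.
  elim: t s {tm} st h => [|x t IHt] [|y s] //= /eqP.
  rewrite addn_eq0 => /andP[/eqP-> /eqP /IHt h].
  by rewrite leqn0 => /andP[/eqP-> /h ->].
move=> h; have [->|nst] := eqVneq s t; first by constructor.
have sz : size s = size t by move: h; rewrite all2E => /andP[/eqP].
have le_i i : (nth 0%N s i <= nth 0%N t i)%N.
  have [it|it] := ltnP i (size t); last by rewrite nth_default ?sz.
  move: h; elim: t s i it {st tm nst sz IH} => [|x t IHt] [|y s] [|i] //= it /andP[//].
  by move=> _; apply: IHt.
have [i it lt_i] : exists2 i, (i < size t)%N & (nth 0%N s i < nth 0%N t i)%N.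
  apply: contrapT => hn; move/eqP: nst; apply.
  apply: (@eq_from_nth _ 0%N) => // i; rewrite sz => it.
  apply/eqP; rewrite eqn_leq le_i /= leqNgt; apply/negP => h'.
  by apply: hn; exists i.
pose t' := set_nth 0%N t i (nth 0%N t i).-1.
have st' : size t' = size t by rewrite size_set_nth; apply/maxn_idPr.
have t'E : incr_nth t' i = t.
  apply: (@eq_from_nth _ 0%N) => [|l _].
    by rewrite size_incr_nth st' it.
  rewrite nth_incr_nth nth_set_nth /=; case: eqVneq => [<-|nli].
    by rewrite ?eqxx; lia.
  by [].
rewrite -t'E; rewrite tm in it.
apply: (@incr_reachS _ _ (k :: t') (Ordinal it)).
apply: IH; rewrite ?st' //.
  by have := sumn_incr_nth t' i; rewrite t'E st => -[].
rewrite all2E st' sz eqxx /=; apply/(all_nthP (0%N, 0%N)) => l.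
rewrite size_zip st' sz minnn => lt; rewrite nth_zip ?st' //=.
rewrite nth_set_nth /=; case: eqVneq => [->|_]; last exact: le_i.
by move: lt_i; case: (nth 0%N t i).
Qed.

(** * Isolation of the type of a point *)

(** The extension field is part of the point, so that points living in different extensions can be
    compared through the terms over [K] that vanish at them. *)
Record dpoint (K : fieldType) (m : nat) (D : 'I_m -> K -> K) (n : nat) := DPoint {
  pt_field : fieldType;
  pt_der : 'I_m -> pt_field -> pt_field;
  pt_emb : {rmorphism K -> pt_field};
  pt_val : 'I_n -> pt_field;
  pt_diff : is_diff_field pt_der;
  pt_embD : diff_emb D pt_der pt_emb }.

Lemma In_rcons (A : Type) (s : seq A) x y :
  List.In y s \/ y = x -> List.In y (rcons s x).
Proof.
by rewrite -cats1 => -[h| ->]; apply: List.in_or_app; [left|right; left].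
Qed.

Section IsolatedTypes.
Variables (K : fieldType) (m n : nat) (D : 'I_m -> K -> K).
Hypothesis K0 : [pchar K] =i pred0.

Notation term := (dterm K n m).
Notation point := (dpoint D n).
Definition ev (P : point) (t : term) : pt_field P :=
  deval (@pt_emb _ _ _ _ P) (@pt_der _ _ _ _ P) (@pt_val _ _ _ _ P) t.
(** Stands for equality of differential polynomials, tested at all points instead of on normal
    forms. *)
Definition tequiv (s t : term) : Prop := forall P, ev P s = ev P t.
Local Notation der P := (@pt_der _ _ _ _ P).

Let derD (P : point) j x y : der P j (x + y) = der P j x + der P j y.
Proof. exact: (proj1 (proj1 (pt_diff P) j)). Qed.
Let derM (P : point) j x y : der P j (x * y) = der P j x * y + x * der P j y.
Proof. exact: (proj2 (proj1 (pt_diff P) j)). Qed.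
Let derC (P : point) j k x : der P j (der P k x) = der P k (der P j x).
Proof. exact: (proj2 (pt_diff P)). Qed.
Let d0 (P : point) j : der P j 0 = 0.
Proof. exact: (der0 (proj1 (pt_diff P) j)). Qed.
Let dN (P : point) j x : der P j (- x) = - der P j x.
Proof. exact: (derN (proj1 (pt_diff P) j)). Qed.

(* The derivative [d_1^(v_1) ... d_m^(v_m) x_k] is encoded by the list [k :: v]. *)
Definition jet_base (v : seq nat) : term :=
  if insub (head n v) is Some k then DVar _ _ k else DCst _ _ 0.
Definition jet (v : seq nat) : term :=
  foldr (fun (j : 'I_m) t => iter (nth 0%N v j.+1) (fun u => DDer j u) t) (jet_base v) (enum 'I_m).
Definition valid (v : seq nat) : bool := (size v == m.+1) && (head n v < n)%N.

Lemma valid_size v : valid v -> size v = m.+1.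
Proof. by case/andP=> /eqP. Qed.
Lemma valid_incr v (j : 'I_m) : valid v -> valid (incr_nth v j.+1).
Proof.
case/andP=> /eqP sv hv; rewrite /valid size_incr_nth sv ltnS ltn_ord eqxx /=.
by case: v sv hv.
Qed.

Lemma jet_incr v (j : 'I_m) : size v = m.+1 ->
  tequiv (jet (incr_nth v j.+1)) (DDer j (jet v)).
Proof.
move=> sv P; have hb : jet_base (incr_nth v j.+1) = jet_base v.
  by rewrite /jet_base; case: v sv.
rewrite /jet hb.
have evI w r (k : 'I_m) : ev P (iter r (fun u => DDer k u) w) = iter r (der P k) (ev P w).
  by elim: r => //= r <-.
have itC r (k : 'I_m) x : der P j (iter r (der P k) x) = iter r (der P k) (der P j x).
  by elim: r => //= r <-; rewrite derC.
have: j \in enum 'I_m by rewrite mem_enum.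
have: uniq (enum 'I_m) by apply: enum_uniq.
elim: (enum 'I_m) => //= k s IH /andP[ks us].
have e0 : j \notin s -> ev P (foldr (fun (j0 : 'I_m) t =>
    iter (nth 0%N (incr_nth v j.+1) j0.+1) (fun u => DDer j0 u) t) (jet_base v) s) =
  ev P (foldr (fun (j0 : 'I_m) t =>
    iter (nth 0%N v j0.+1) (fun u => DDer j0 u) t) (jet_base v) s).
  elim: s {IH ks us} => //= l s IH; rewrite inE negb_or => /andP[jl /IH h].
  rewrite !evI h nth_incr_nth eqSS; suff -> : (nat_of_ord j == l) = false by [].
  by apply/negbTE.
rewrite inE; have [jk|njk] := eqVneq j k.
  rewrite -jk in ks *; move=> _; rewrite evI (e0 ks) nth_incr_nth eqxx add1n /=.
  by rewrite -evI.
have evd (l : 'I_m) w : ev P (DDer l w) = der P l (ev P w) by [].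
move=> /= js; rewrite evI (IH us js) !evd evI itC.
by rewrite nth_incr_nth eqSS (_ : (nat_of_ord j == k) = false) //; apply/negbTE.
Qed.

(** Polynomials in the jets smaller than [v]. There is no case for [DDer]: derivations have been
    pushed into the jets. *)
Inductive below (v : seq nat) : term -> Prop :=
| below_cst c : below v (DCst _ _ c)
| below_jet u : valid u -> ltlex u v -> below v (jet u)
| below_add s t : below v s -> below v t -> below v (DAdd s t)
| below_opp s : below v s -> below v (DOpp s)
| below_mul s t : below v s -> below v t -> below v (DMul s t).

Lemma below_trans u v t : ltlex u v -> below u t -> below v t.
Proof.
move=> uv; elim=> [c|w hw wu|s s' _ h _ h'|s _ h|s s' _ h _ h'].
- exact: below_cst.
- by apply: below_jet => //; apply: ltlex_trans uv.
- exact: below_add.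
- exact: below_opp.
- exact: below_mul.
Qed.

Lemma below_der v (j : 'I_m) t : size v = m.+1 -> below v t ->
  exists t', below (incr_nth v j.+1) t' /\ tequiv (DDer j t) t'.
Proof.
move=> sv; have up : ltlex v (incr_nth v j.+1).
  by apply: ltlex_incr_self; rewrite sv ltnS.
elim=> {t} [c|u hu uv|s s' hs [t [tb te]] hs' [t' [tb' te']]|s hs [t [tb te]]|
        s s' hs [t [tb te]] hs' [t' [tb' te']]].
- exists (DCst _ _ (D j c)); split; first exact: below_cst.
  by move=> P; rewrite /ev /= pt_embD.
- exists (jet (incr_nth u j.+1)); split; last first.
    by move=> P; rewrite (jet_incr _ (valid_size hu)).
  apply: below_jet; first exact: valid_incr.
  by apply: ltlex_incr => //; rewrite sv valid_size.
- exists (DAdd t t'); split; first exact: below_add.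
  by move=> P; rewrite /ev /= derD; congr (_ + _); [apply: te|apply: te'].
- exists (DOpp t); split; first exact: below_opp.
  by move=> P; rewrite /ev /= dN; congr (- _); apply: te.
- exists (DAdd (DMul t s') (DMul s t')); split.
    by apply: below_add; apply: below_mul => //; apply: below_trans up _.
  move=> P; have := te P; have := te' P; rewrite /ev /= derM => -> ->.
  by [].
Qed.

Lemma below_top t : exists t', below (n :: nseq m 0%N) t' /\ tequiv t t'.
Proof.
(* The head [n] exceeds every variable number, so [v0] lies above all valid codes. *)
pose v0 := n :: nseq m 0%N.
have v0S : size v0 = m.+1 by rewrite /= size_nseq.
have top v t' : below v t' -> below v0 t'.
  elim=> [c|u hu uv|s s' _ h _ h'|s _ h|s s' _ h _ h'].
  - exact: below_cst.
  - by apply: below_jet => //; case: u hu {uv} => //= x u /andP[_ /= ->].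
  - exact: below_add.
  - exact: below_opp.
  - exact: below_mul.
elim: t => [k|c|s [s' [sb se]] t [t' [tb te]]|s [s' [sb se]]|s [s' [sb se]] t [t' [tb te]]|
    j s [s' [sb se]]].
- exists (jet ((k : nat) :: nseq m 0%N)); split.
    apply: below_jet; last by rewrite /= ltn_ord.
    by rewrite /valid /= size_nseq eqxx ltn_ord.
  move=> P; rewrite /jet.
  have -> : jet_base ((k : nat) :: nseq m 0%N) = DVar _ _ k.
    by rewrite /jet_base /= valK.
  elim: (enum 'I_m) => //= j s ->; rewrite nth_nseq.
  by case: ifP.
- by exists (DCst _ _ c); split=> //; apply: below_cst.
- exists (DAdd s' t'); split; first exact: below_add.
  by move=> P; rewrite /ev /=; congr (_ + _); [apply: se|apply: te].
- exists (DOpp s'); split; first exact: below_opp.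
  by move=> P; rewrite /ev /=; congr (- _); apply: se.
- exists (DMul s' t'); split; first exact: below_mul.
  by move=> P; rewrite /ev /=; congr (_ * _); [apply: se|apply: te].
- have [t [tb te]] := below_der j v0S sb.
  exists t; split; first exact: top tb.
  by move=> P; rewrite -te /ev /=; congr (der P j _); apply: se.
Qed.

Fixpoint pol (w : seq nat) (cs : seq term) : term :=
  if cs is c :: cs' then DAdd c (DMul (jet w) (pol w cs')) else DCst _ _ 0.

Definition pshift (k : nat) (cs : seq term) : seq term := nseq k (DCst _ _ 0) ++ cs.
Definition pscale (c : term) (cs : seq term) : seq term := [seq DMul c d | d <- cs].
Fixpoint padd (cs ds : seq term) : seq term :=
  match cs, ds with
  | [::], _ => ds
  | _, [::] => cs
  | c :: cs', d :: ds' => DAdd c d :: padd cs' ds'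
  end.
Fixpoint pmul (cs ds : seq term) : seq term :=
  if cs is c :: cs' then padd (pscale c ds) (pshift 1 (pmul cs' ds)) else [::].

Section PolEval.
Variables (P : point) (w : seq nat).
Local Notation x := (ev P (jet w)).
Lemma ev_add s t : ev P (DAdd s t) = ev P s + ev P t. Proof. by []. Qed.
Lemma ev_mul s t : ev P (DMul s t) = ev P s * ev P t. Proof. by []. Qed.
Lemma ev_opp s : ev P (DOpp s) = - ev P s. Proof. by []. Qed.
Lemma ev_nat k : ev P (DCst _ _ k%:R) = k%:R. Proof. by rewrite /ev /= rmorph_nat. Qed.
Lemma ev_der j s : ev P (DDer j s) = der P j (ev P s). Proof. by []. Qed.

Lemma ev_pol_nil : ev P (pol w [::]) = 0. Proof. by rewrite /= (ev_nat 0). Qed.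
Lemma ev_pol_cons c cs : ev P (pol w (c :: cs)) = ev P c + x * ev P (pol w cs).
Proof. by []. Qed.
Lemma ev_padd cs ds : ev P (pol w (padd cs ds)) = ev P (pol w cs) + ev P (pol w ds).
Proof.
elim: cs ds => [|c cs IH] [|d ds]; rewrite ?ev_pol_nil ?add0r ?addr0 //.
by rewrite !ev_pol_cons IH ev_add; ring.
Qed.
Lemma ev_pscale c cs : ev P (pol w (pscale c cs)) = ev P c * ev P (pol w cs).
Proof.
elim: cs => [|d cs IH]; first by rewrite ev_pol_nil mulr0.
by rewrite !ev_pol_cons IH ev_mul; ring.
Qed.
Lemma ev_pshift k cs : ev P (pol w (pshift k cs)) = x ^+ k * ev P (pol w cs).
Proof.
elim: k => [|k IH]; first by rewrite expr0 mul1r.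
rewrite -[pshift k.+1 cs]/(DCst _ _ 0 :: pshift k cs).
by rewrite ev_pol_cons IH exprS (ev_nat 0); ring.
Qed.
Lemma ev_pmul cs ds : ev P (pol w (pmul cs ds)) = ev P (pol w cs) * ev P (pol w ds).
Proof.
elim: cs => [|c cs IH]; first by rewrite ev_pol_nil mul0r.
by rewrite ev_padd ev_pscale ev_pshift IH ev_pol_cons; ring.
Qed.
Lemma ev_pol_rcons cs c : ev P (pol w (rcons cs c)) = ev P (pol w cs) + x ^+ size cs * ev P c.
Proof.
elim: cs => [|d cs IH]; first by rewrite [rcons _ _]/= ev_pol_cons ev_pol_nil; ring.
by rewrite rcons_cons !ev_pol_cons IH exprS; ring.
Qed.
End PolEval.

Definition allbelow (v : seq nat) (cs : seq term) : Prop := forall c, List.In c cs -> below v c.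

Lemma allbelow_padd v cs ds : allbelow v cs -> allbelow v ds -> allbelow v (padd cs ds).
Proof.
elim: cs ds => [|c cs IH] [|d ds] //= hc hd e [<-|he].
  by apply: below_add; [apply: hc|apply: hd]; left.
by apply: (IH ds) he => f hf; [apply: hc|apply: hd]; right.
Qed.
Lemma allbelow_pscale v c cs : below v c -> allbelow v cs -> allbelow v (pscale c cs).
Proof. by move=> hc h d /List.in_map_iff[e [<- he]]; apply: below_mul => //; apply: h. Qed.
Lemma allbelow_pshift v k cs : allbelow v cs -> allbelow v (pshift k cs).
Proof.
by move=> h; elim: k => [|k IH] //= d [<-|/IH//]; apply: below_cst.
Qed.
Lemma allbelow_pmul v cs ds : allbelow v cs -> allbelow v ds -> allbelow v (pmul cs ds).
Proof.
elim: cs => [|c cs IH] hc hd //=; apply: allbelow_padd.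
  by apply: allbelow_pscale => //; apply: hc; left.
by apply: (allbelow_pshift (k := 1)); apply: IH => // e he; apply: hc; right.
Qed.
Lemma below_pol u v cs : valid u -> ltlex u v -> allbelow u cs -> below v (pol u cs).
Proof.
move=> hu uv; elim: cs => [|c cs IH] h; first exact: below_cst.
apply: below_add; first by apply: below_trans uv _; apply: h; left.
apply: below_mul; first exact: below_jet.
by apply: IH => e he; apply: h; right.
Qed.

Lemma below_decompose v t : size v = m.+1 -> below v t ->
  (exists c, tequiv t (DCst _ _ c)) \/
  exists w cs, [/\ valid w, ltlex w v, allbelow w cs & tequiv t (pol w cs)].
Proof.
move=> sv.
pose R t := exists w cs, [/\ valid w, ltlex w v, allbelow w cs & tequiv t (pol w cs)].
(* Two polynomials are brought to the larger of their leaders; the one with the smaller leader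
   becomes a coefficient of degree 0. *)
have common s s' : R s -> R s' -> exists w cs ds, [/\ valid w, ltlex w v,
    allbelow w cs /\ allbelow w ds & tequiv s (pol w cs) /\ tequiv s' (pol w ds)].
  move=> [w [cs [hw wv hcs es]]] [u [ds [hu uv hds et]]].
  have one z y : tequiv z (pol y [:: z]).
    by move=> P; rewrite ev_pol_cons ev_pol_nil mulr0 addr0.
  have sing y z : below y z -> allbelow y [:: z] by move=> h c [<-|[]].
  case: (@ltlex_total w u) => [|wu|wu|wu]; first by rewrite !valid_size.
  - exists u, [:: pol w cs], ds; split=> //; split=> //.
      exact/sing/below_pol.
    by move=> P; rewrite es -one.
  - by exists w, cs, ds; split=> //; split=> //; rewrite wu.
  - exists w, cs, [:: pol u ds]; split=> //; split=> //.
      exact/sing/below_pol.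
    by move=> P; rewrite et -one.
elim=> {t} [c|u hu uv|s s' _ h _ h'|s _ h|s s' _ h _ h'].
- by left; exists c.
- right; exists u, [:: DCst _ _ 0; DCst _ _ 1]; split=> //.
    by move=> c [<-|[<-|[]]]; apply: below_cst.
  by move=> P; rewrite /ev /= rmorph0 rmorph1 mulr0 addr0 mulr1 add0r.
- case: h h' => [[c hc]|hs] [[c' hc']|hs'].
  + by left; exists (c + c') => P; rewrite ev_add hc hc' /ev /= rmorphD.
  + right; have [w [cs [hw wv hcs e]]] := hs'.
    exists w, (padd [:: DCst _ _ c] cs); split=> //.
      by apply: allbelow_padd => // d [<-|[]]; apply: below_cst.
    by move=> P; rewrite ev_padd ev_add hc e ev_pol_cons ev_pol_nil; ring.
  + right; have [w [cs [hw wv hcs e]]] := hs.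
    exists w, (padd [:: DCst _ _ c'] cs); split=> //.
      by apply: allbelow_padd => // d [<-|[]]; apply: below_cst.
    by move=> P; rewrite ev_padd ev_add hc' e ev_pol_cons ev_pol_nil; ring.
  + right; have [w [cs [ds [hw wv [h1 h2] [e1 e2]]]]] := common _ _ hs hs'.
    exists w, (padd cs ds); split=> //; first exact: allbelow_padd.
    by move=> P; rewrite ev_add e1 e2 ev_padd.
- case: h => [[c hc]|[w [cs [hw wv hcs e]]]].
    by left; exists (- c) => P; rewrite ev_opp hc /ev /= rmorphN.
  right; exists w, (pscale (DCst _ _ (- 1)) cs); split=> //.
    by apply: allbelow_pscale => //; apply: below_cst.
  by move=> P; rewrite ev_pscale ev_opp e /ev /= rmorphN rmorph1 mulN1r.
- case: h h' => [[c hc]|hs] [[c' hc']|hs'].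
  + by left; exists (c * c') => P; rewrite ev_mul hc hc' /ev /= rmorphM.
  + right; have [w [cs [hw wv hcs e]]] := hs'.
    exists w, (pscale (DCst _ _ c) cs); split=> //.
      by apply: allbelow_pscale => //; apply: below_cst.
    by move=> P; rewrite ev_pscale ev_mul hc e.
  + right; have [w [cs [hw wv hcs e]]] := hs.
    exists w, (pscale (DCst _ _ c') cs); split=> //.
      by apply: allbelow_pscale => //; apply: below_cst.
    by move=> P; rewrite ev_pscale ev_mul hc' e mulrC.
  + right; have [w [cs [ds [hw wv [h1 h2] [e1 e2]]]]] := common _ _ hs hs'.
    exists w, (pmul cs ds); split=> //; first exact: allbelow_pmul.
    by move=> P; rewrite ev_mul e1 e2 ev_pmul.
Qed.

(** The coefficients are multiplied by [k], [k.+1] and so on; started at 1 on the tail of the list,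
    this is the formal derivative with respect to the leader. *)
Fixpoint psep (k : nat) (cs : seq term) : seq term :=
  if cs is c :: cs' then DMul (DCst _ _ k%:R) c :: psep k.+1 cs' else [::].
Definition separant cs := psep 1 (behead cs).

Lemma size_psep k cs : size (psep k cs) = size cs.
Proof. by elim: cs k => //= c cs IH k; rewrite IH. Qed.
Lemma psep_rcons k cs c : psep k (rcons cs c) =
  rcons (psep k cs) (DMul (DCst _ _ (k + size cs)%:R) c).
Proof. by elim: cs k => [|d cs IH] k /=; rewrite ?addn0 // IH addSnnS. Qed.
Lemma allbelow_psep v k cs : allbelow v cs -> allbelow v (psep k cs).
Proof.
elim: cs k => [|c cs IH] k h //= d [<-|hd].
  by apply: below_mul; [apply: below_cst|apply: h; left].
by apply: (IH k.+1) hd => e he; apply: h; right.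
Qed.
Lemma ev_psepS P w k cs :
  ev P (pol w (psep k.+1 cs)) = ev P (pol w (psep k cs)) + ev P (pol w cs).
Proof.
elim: cs k => [|c cs IH] k; first by rewrite /= !(ev_nat P 0) addr0.
by rewrite /psep -/psep !ev_pol_cons IH !ev_mul !ev_nat -addn1 natrD; ring.
Qed.

(** The reason for separants: a derivative has degree 1 in the derived leader, and its initial is
    the separant. *)
Lemma ev_der_pol P w (j : 'I_m) cs : size w = m.+1 ->
  der P j (ev P (pol w cs)) = ev P (pol w (map (DDer j) cs)) +
    ev P (pol w (separant cs)) * ev P (jet (incr_nth w j.+1)).
Proof.
move=> sw; rewrite (jet_incr j sw) ev_der.
elim: cs => [|c cs IH]; first by rewrite /= !(ev_nat P 0) d0; ring.
rewrite map_cons !ev_pol_cons derD derM IH ev_der /separant /=.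
case: cs {IH} => [|c' cs]; first by rewrite /= !(ev_nat P 0); ring.
rewrite /psep -/psep !ev_pol_cons (ev_psepS _ _ 1) ev_mul ev_nat /separant /=.
by ring.
Qed.

Lemma allbelow_der v (j : 'I_m) cs : size v = m.+1 -> allbelow v cs ->
  exists cs', allbelow (incr_nth v j.+1) cs' /\
    forall w P, ev P (pol w (map (DDer j) cs)) = ev P (pol w cs').
Proof.
move=> sv; elim: cs => [|c cs IH] h; first by exists [::]; split.
have [cs' [hcs' e]] := IH (fun d hd => h d (or_intror hd)).
have [c' [hc' e']] := below_der j sv (h c (or_introl erefl)).
exists (c' :: cs'); split; first by move=> d [<-|/hcs'].
by move=> w P; rewrite map_cons !ev_pol_cons e e'.
Qed.

(** Every proper derivative has the shape [T + S * jet w] with the same separant [S]: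
    differentiating once more, all terms but [S] times the new leader are absorbed into [T]. *)
Lemma reach_derivative v cs w : valid v -> allbelow v cs -> incr_reach m v w ->
  w = v \/ exists T S, [/\ valid w, below w T, below w S, tequiv S (pol v (separant cs)) &
    forall P, ev P (pol v cs) = 0 -> ev P T + ev P S * ev P (jet w) = 0].
Proof.
move=> hv hcs; elim=> [|w' j _ IH]; first by left.
right; case: IH => [->|[T [S [hw hT hS eS h]]]].
  have sv := valid_size hv.
  have up : ltlex v (incr_nth v j.+1) by apply: ltlex_incr_self; rewrite sv ltnS.
  have [cs' [hcs' e]] := allbelow_der j sv hcs.
  have pb ds : allbelow v ds -> below (incr_nth v j.+1) (pol v ds) by exact: below_pol.
  have pb' ds : allbelow (incr_nth v j.+1) ds -> below (incr_nth v j.+1) (pol v ds).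
    elim: ds => [|d ds IHd] hds; first exact: below_cst.
    apply: below_add; first by apply: hds; left.
    by apply: below_mul; [apply: below_jet|apply: IHd => f hf; apply: hds; right].
  exists (pol v cs'), (pol v (separant cs)); split=> //.
  - exact: valid_incr.
  - exact: pb'.
  - by apply/pb/allbelow_psep => c hc; apply: hcs; case: (cs) hc => //; right.
  - by move=> P hP; rewrite -e -ev_der_pol // hP d0.
have sw := valid_size hw.
have up : ltlex w' (incr_nth w' j.+1) by apply: ltlex_incr_self; rewrite sw ltnS.
have [T' [hT' eT']] := below_der j sw hT; have [S' [hS' eS']] := below_der j sw hS.
exists (DAdd T' (DMul S' (jet w'))), S; split=> //.
- exact: valid_incr.
- by apply: below_add => //; apply: below_mul => //; apply: below_jet.
- exact: below_trans up _.
move=> P /h hP; have := congr1 (der P j) hP; rewrite derD derM d0 => e.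
by rewrite ev_add ev_mul -eT' -eS' (jet_incr j sw) !ev_der -[RHS]e; ring.
Qed.

Variable b : point.

(* [cs] lists the coefficients, in increasing degree, of a polynomial with leader [v]
   that vanishes at [b] while its initial does not. *)
Definition good v cs := [/\ (1 < size cs)%N, allbelow v cs, ev b (pol v cs) = 0 &
  ev b (last (DCst _ _ 0) cs) <> 0].
Definition good_min v cs := good v cs /\ forall ds, good v ds -> (size cs <= size ds)%N.

Lemma exists_good_min v cs : good v cs -> exists ds, good_min v ds.
Proof.
move: {2}(size cs) (leqnn (size cs)) => N; elim: N cs => [|N IH] cs.
  by rewrite leqn0 => /eqP s0 []; rewrite s0.
move=> hN g; have [[ds dsN hds]|h] := pselect (exists2 ds, (size ds < size cs)%N & good v ds).
  by apply: (IH ds) => //; rewrite -ltnS (leq_trans dsN).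
by exists cs; split=> // ds hds; rewrite leqNgt; apply/negP => lt; apply: h; exists ds.
Qed.

(** If the separant vanished at [b] it would be a shorter good polynomial, since its initial is that
    of [cs] times a positive integer. In degree 1 the separant is the initial itself. *)
Lemma good_min_separant v cs : good_min v cs -> ev b (pol v (separant cs)) <> 0.
Proof.
case=> -[s1 hcs z nz] hmin hS.
case/lastP: cs s1 hcs z nz hmin hS => // cs c; rewrite size_rcons ltnS => s1 hcs z.
rewrite last_rcons => nz hmin.
case: cs s1 hcs z hmin => // d cs _ hcs z hmin.
rewrite /separant /= psep_rcons => hS.
have nzc : ev b (DMul (DCst _ _ (1 + size cs)%:R) c) <> 0.
  rewrite ev_mul ev_nat add1n => /eqP; rewrite mulf_eq0.
  have /pcharf0P -> := pchar_rmorphism (@pt_emb _ _ _ _ b) K0.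
  by move=> /eqP.
have [s0|] := posnP (size cs).
  move: hS; rewrite (size0nil s0) [rcons _ _]/= ev_pol_cons (ev_nat b 0) mulr0 addr0.
  by move: nzc; rewrite s0.
move=> sp; have := hmin (rcons (psep 1 cs) (DMul (DCst _ _ (1 + size cs)%:R) c)).
rewrite /= !size_rcons size_psep ltnn => h; suff : false by []; apply: h; split=> //.
- by rewrite size_rcons size_psep ltnS.
- rewrite -psep_rcons; apply: allbelow_psep => e he; apply: hcs => /=; right.
  by [].
- by rewrite last_rcons.
Qed.

(** One step of pseudo-division. The two top coefficients cancel in the value, so they are left out
    of the lists, and this makes [ds] shorter. *)
Lemma reduce_step w cs rs : allbelow w cs -> allbelow w rs ->
  (1 < size rs)%N -> (size rs <= size cs)%N ->
  exists ds c e, [/\ allbelow w ds, (size ds < size cs)%N &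
    forall P, ev P (pol w ds) = ev P (last (DCst _ _ 0) rs) * ev P (pol w cs)
       - ev P c * ev P (jet w) ^+ e * ev P (pol w rs)].
Proof.
case/lastP: cs => [|cs c]; first by case: rs.
case/lastP: rs => // rs r hcs hrs; rewrite !size_rcons !ltnS last_rcons => s1 sr.
exists (padd (pscale r cs) (pshift (size cs - size rs) (pscale (DOpp c) rs))), c, (size cs - size rs)%N.
have hc : below w c by apply/hcs/In_rcons; right.
have hr : below w r by apply/hrs/In_rcons; right.
have hcs' : allbelow w cs by move=> d hd; apply/hcs/In_rcons; left.
have hrs' : allbelow w rs by move=> d hd; apply/hrs/In_rcons; left.
split.
- apply: allbelow_padd; first exact: allbelow_pscale.
  by apply/allbelow_pshift/allbelow_pscale => //; apply: below_opp.
- have szp (xs ys : seq term) : size (padd xs ys) = maxn (size xs) (size ys).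
    by elim: xs ys => [|x xs IHx] [|y ys] //=; rewrite IHx maxnSS.
  by rewrite szp size_cat size_nseq !size_map subnK // maxnn.
- move=> P; rewrite ev_padd ev_pshift !ev_pscale ev_opp !ev_pol_rcons.
  rewrite -{2}(subnK sr) exprD; ring.
Qed.

(* A pointwise form of the Ritt-Raudenbush theorem: by Dickson's lemma finitely many
   leaders [v] of polynomials vanishing at [b], with initial not vanishing at [b], are
   minimal; the corresponding polynomials of least degree, with their initials and
   separants, decide all differential polynomials over [K] by pseudo-division. *)
Lemma isolated_type : exists eqs neqs : seq term,
  [/\ forall q, List.In q eqs -> ev b q = 0, forall q, List.In q neqs -> ev b q <> 0 &
  forall P : point, (forall q, List.In q eqs -> ev P q = 0) ->
    (forall q, List.In q neqs -> ev P q <> 0) ->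
    forall t, ev b t = 0 -> ev P t = 0].
Proof.
have [M [hM hdiv]] : exists M : seq (seq nat * seq term),
    (forall p, List.In p M -> valid p.1 /\ good_min p.1 p.2) /\
    (forall w cs, valid w -> good w cs -> exists p, List.In p M /\ incr_reach m p.1 w).
  (* Derivation never changes the variable, so Dickson's lemma is applied to the exponents for one
     variable at a time. *)
  suff main N : (N <= n)%N -> exists M : seq (seq nat * seq term),
      (forall p, List.In p M -> valid p.1 /\ good_min p.1 p.2) /\
      (forall w cs, valid w -> (head n w < N)%N -> good w cs ->
         exists p, List.In p M /\ incr_reach m p.1 w).
    have [M [hM hdiv]] := main n (leqnn n).
    exists M; split=> // w cs hw; apply: hdiv => //.
    by case/andP: hw.
  elim: N => [|N IH] hN; first by exists [::]; split.
  have [M [hM hdiv]] := IH (ltnW hN).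
  pose PN s := exists cs, good (N :: s) cs.
  have [B [BP hB]] := dickson m PN.
  have [M' [hM' hM'B]] : exists M' : seq (seq nat * seq term),
      (forall p, List.In p M' -> valid p.1 /\ good_min p.1 p.2) /\
      (forall s, s \in B -> exists p, List.In p M' /\ p.1 = N :: s).
    elim: B {hB} BP => [|s B IHB] BP; first by exists [::].
    have [|M' [hM' hM'B]] := IHB; first by move=> x xB; apply: BP; rewrite inE xB orbT.
    have [[cs hcs] sm] := BP s (mem_head _ _).
    have [ds hds] := exists_good_min hcs.
    exists ((N :: s, ds) :: M'); split.
      move=> p [<-|/hM'//]; split=> //.
      by rewrite /valid /= sm eqxx.
    move=> t; rewrite inE => /orP[/eqP->|/hM'B[p [pM pe]]].
      by exists (N :: s, ds); split=> //; left.
    by exists p; split=> //; right.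
  exists (M' ++ M)%list; split.
    by move=> p pM; case: (List.in_app_or _ _ _ pM); [apply: hM'|apply: hM].
  move=> w cs hw hwN g; have [wN|wN] := eqVneq (head n w) N; last first.
    have [|p [pM pr]] := hdiv w cs hw _ g; first by rewrite ltn_neqAle wN -ltnS.
    by exists p; split=> //; apply: List.in_or_app; right.
  case: w wN hw g {hwN} => [|_ w /= ->] //.
  move=> hw g; have [y yB yw] := hB w (ex_intro _ cs g) (eq_add_S _ _ (valid_size hw)).
  have [p [pM pe]] := hM'B y yB.
  exists p; split; first by apply: List.in_or_app; left.
  by rewrite pe; apply: all2_leq_reach => //; apply/eq_add_S/(valid_size hw).
pose eqs := [seq pol p.1 p.2 | p <- M].
pose neqs := [seq last (DCst _ _ 0) p.2 | p <- M] ++ [seq pol p.1 (separant p.2) | p <- M].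
exists eqs, neqs; split.
- by move=> q /List.in_map_iff[p [<- /hM[_ [[]]]]].
- move=> q hq; case: (List.in_app_or _ _ _ hq) => /List.in_map_iff[p [<- /hM[_ g]]].
    by case: g => -[].
  exact: good_min_separant g.
move=> P Peqs Pneqs.
have PE p : List.In p M -> ev P (pol p.1 p.2) = 0.
  by move=> pM; apply: Peqs; apply/List.in_map_iff; exists p.
have PI p : List.In p M -> ev P (last (DCst _ _ 0) p.2) <> 0.
  move=> pM; apply: Pneqs; apply: List.in_or_app; left.
  by apply/List.in_map_iff; exists p.
have PS p : List.In p M -> ev P (pol p.1 (separant p.2)) <> 0.
  move=> pM; apply: Pneqs; apply: List.in_or_app; right.
  by apply/List.in_map_iff; exists p.
pose R w := valid w -> forall cs, allbelow w cs -> ev b (pol w cs) = 0 -> ev P (pol w cs) = 0.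
have belowR v : size v = m.+1 -> (forall w, size w = m.+1 -> ltlex w v -> R w) ->
    forall t, below v t -> ev b t = 0 -> ev P t = 0.
  move=> sv hR t ht; have [[c ec]|[w [cs [hw wv hcs e]]]] := below_decompose sv ht.
    rewrite !ec /ev /= => /eqP; rewrite fmorph_eq0 => /eqP ->.
    by rewrite rmorph0.
  by rewrite !e; apply: hR => //; apply: valid_size.
suff hR w : size w = m.+1 -> R w.
  move=> t zt; have [t' [ht e]] := below_top t.
  have zt' : ev b t' = 0 by rewrite -e.
  rewrite e; apply: (belowR (n :: nseq m 0%N)) zt' => //; first by rewrite /= size_nseq.
  by move=> w sw _; apply: hR.
move=> sw; apply: (ltlex_wf (k := m.+1)) sw => {}w sw IHw hw cs.
have lowR := belowR _ sw IHw.
move: {2}(size cs) (leqnn (size cs)) => N; elim: N cs => [|N IH] cs.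
  by rewrite leqn0 => /eqP/size0nil -> _ _; rewrite ev_pol_nil.
move=> sN hcs zcs.
case/lastP: cs sN hcs zcs => [|cs c] sN hcs zcs; first by rewrite ev_pol_nil.
have hc : below w c by apply/hcs/In_rcons; right.
have hcs' : allbelow w cs by move=> d hd; apply/hcs/In_rcons; left.
rewrite size_rcons ltnS in sN.
have [zc|nzc] := pselect (ev b c = 0).
  rewrite ev_pol_rcons (lowR c) // mulr0 addr0; apply: IH => //.
  by move: zcs; rewrite ev_pol_rcons zc mulr0 addr0.
have g : good w (rcons cs c).
  split=> //; last by rewrite last_rcons.
  rewrite size_rcons ltnS lt0n; apply/eqP => /size0nil c0; apply: nzc.
  by move: zcs; rewrite c0 [rcons _ _]/= ev_pol_cons (ev_nat b 0) mulr0 addr0.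
have [p [pM pr]] := hdiv w _ hw g; have [hp [gp gpmin]] := hM p pM.
(* The divisor is the polynomial of [p] itself if [w] is its leader, and otherwise the linear
   derivative [T + S * jet w]. Its initial does not vanish at [P], being an initial or a separant
   listed in [neqs]. *)
have [rs [rsb [rs1 rss] [rsB rsP] rsI]] : exists rs, [/\ allbelow w rs,
    (1 < size rs)%N /\ (size rs <= size (rcons cs c))%N,
    ev b (pol w rs) = 0 /\ ev P (pol w rs) = 0 & ev P (last (DCst _ _ 0) rs) <> 0].
  have [s1 pb pz _] := gp.
  case: (reach_derivative hp pb pr) => [e|[T [S [_ hT hS eS h]]]].
    exists p.2; rewrite e; split=> //; last exact: PI.
      by split=> //; apply: gpmin; rewrite -e.
    by split=> //; apply: PE.
  exists [:: T; S]; split.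
  - by move=> d [<-|[<-|[]]].
  - by split=> //; case: g.
  - split; rewrite !ev_pol_cons ev_pol_nil mulr0 addr0 mulrC; first exact: h.
    exact/h/PE.
  - by rewrite /= eS; apply: PS.
have [ds [e1 [e2 [hds sds e]]]] := reduce_step hcs rsb rs1 rss.
have zds : ev P (pol w ds) = 0.
  apply: IH => //; first by move: sds; rewrite size_rcons ltnS => /leq_trans; apply.
  by rewrite e rsB zcs !mulr0 subr0.
have := e P; rewrite zds rsP mulr0 subr0 => /esym/eqP.
by rewrite mulf_eq0 => /orP[/eqP|/eqP].
Qed.
End IsolatedTypes.

(** * Generic points *)

Lemma In_map (A B : Type) (f : A -> B) (s : seq A) y :
  List.In y (map f s) <-> exists x, f x = y /\ List.In x s.
Proof. exact: List.in_map_iff. Qed.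

(** In the amalgam of [U] with the field of [b], the point [b] solves its isolating system together
    with [f != 0]. Closedness of [U] brings a solution down to [U], and isolation transfers all
    remaining equations of [b]. *)
Lemma specialize_point (K U : fieldType) (m n : nat) (D : 'I_m -> K -> K)
  (DU : 'I_m -> U -> U) (j : {rmorphism K -> U}) (b : dpoint D n) (f : dterm K n m) :
  [pchar K] =i pred0 -> is_diff_field D -> diff_closed DU -> diff_emb D DU j ->
  ev b f <> 0 -> exists a : 'I_n -> U, deval j DU a f <> 0 /\
    forall g, ev b g = 0 -> deval j DU a g = 0.
Proof.
move=> K0 hD [U0 [hU cU]] jD nf.
have [eqs [neqs [be bn hP]]] := isolated_type K0 b.
have [F [DF [u [v [hF uD vD e]]]]] := diff_amalgam K0 hD hU (pt_diff b) jD (@pt_embD _ _ _ _ b).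
have evF q : deval u DF (v \o pt_val b) (dmap j q) = v (ev b q).
  by rewrite deval_dmap (deval_comp _ _ _ vD); apply: eq_deval.
have [|a [ae an]] := cU F DF u hF uD n (map (dmap j) eqs) (map (dmap j) (f :: neqs)).
  exists (v \o pt_val b); split=> q hq; have [q' [<- hq']] := proj1 (In_map _ _ _) hq; rewrite evF.
    by rewrite be ?rmorph0.
  rewrite fmorph_eq0; apply/eqP.
  by case: hq' => [<-//|]; apply: bn.
have aj q : deval id DU a (dmap j q) = deval j DU a q by rewrite deval_dmap.
exists a; split.
  by apply/eqP; rewrite -aj; apply: an; left.
move=> g; apply: (hP (DPoint a hU jD)) => q hq.
  by rewrite -(ae (dmap j q)) ?aj //; apply: List.in_map.
by apply/eqP; rewrite -[ev _ _]aj; apply: an; right; apply: List.in_map.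
Qed.

Lemma dmap_fixed (C : Type) (n m : nat) (g : C -> C) (P : C -> Prop) (p : dterm C n m) :
  (forall c, P c -> g c = c) -> dcoeffs_in P p -> dmap g p = p.
Proof.
move=> gP; elim: p => //= [c /gP->|p Hp q Hq [/Hp-> /Hq->]|p Hp /Hp->|p Hp q Hq [/Hp-> /Hq->]|l p Hp /Hp->] //.
Qed.

Section GenericPoint.
Variables (G : finGroupType) (K : fieldType) (m n : nat) (D : 'I_m -> K -> K).
Variables (s : G -> {rmorphism K -> K}) (U : fieldType) (DU : 'I_m -> U -> U).
Variables (i : {rmorphism K -> U}) (S : dterm K n m -> Prop).
Hypotheses (HK : G_diff_field D s) (cU : diff_closed DU) (iD : diff_emb D DU i).
Hypothesis SF : forall p, S p -> dcoeffs_in (fixed_field s) p.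
Hypothesis Sirr : irreducible_wrt (kclosed i DU) (dzero i DU S).

Let V := dzero i DU S.
Let vanish f := forall a, V a -> deval i DU a f = 0.
Let term := dterm K n m.

(** If the product vanishes on [V], then [V] is the union of its closed subsets where [f],
    respectively [g], vanishes. *)
Let vanish_prime f g : vanish (DMul f g) -> vanish f \/ vanish g.
Proof.
move=> h; have [_ irr] := Sirr.
have [|||e|e] := irr (dzero i DU (fun p => S p \/ p = f)) (dzero i DU (fun p => S p \/ p = g)).
- by exists (fun p => S p \/ p = f).
- by exists (fun p => S p \/ p = g).
- move=> a; split=> [Va|[h1|h1] p Sp]; try by apply: h1; left.
  have /eqP := h a Va; rewrite /= mulf_eq0 => /orP[/eqP z|/eqP z]; [left|right];
    by move=> p [/Va|->].
- by left=> a /e h1; apply: h1; right.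
- by right=> a /e h1; apply: h1; right.
Qed.

(** The field of [b] consists of fractions of terms modulo the ideal of [V]. The group acts through
    the coefficients of terms and leaves the variables alone, so the coordinates of [b] are
    invariant. *)
Lemma generic_point : exists (b : dpoint D n) (t : G -> {rmorphism pt_field b -> pt_field b}),
  [/\ G_diff_field (@pt_der _ _ _ _ b) t,
   forall g x, pt_emb b (s g x) = t g (pt_emb b x),
   forall g k, t g (pt_val b k) = pt_val b k &
   forall f : term, ev b f = 0 <-> vanish f].
Proof.
have [K0 [hD [[s1 sM] sD]]] := HK; have [U0 [hU _]] := cU.
pose E (f g : term) := forall a, V a -> deval i DU a f = deval i DU a g.
pose t0 : term := DCst _ _ 0; pose t1 : term := DCst _ _ 1.
have sE : setoid_ring E t0 t1 (@DAdd _ _ _) (@DOpp _ _ _) (@DMul _ _ _).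
  split.
  - by [].
  - by move=> x y h a Va; rewrite h.
  - by move=> y x w h1 h2 a Va; rewrite h1 ?h2.
  - by move=> x x' y y' h1 h2 a Va /=; rewrite h1 ?h2.
  - by move=> x x' h1 a Va /=; rewrite h1.
  - by move=> x x' y y' h1 h2 a Va /=; rewrite h1 ?h2.
  - by move=> *; move=> a Va /=; rewrite addrA.
  - by move=> *; move=> a Va /=; rewrite addrC.
  - by move=> *; move=> a Va /=; rewrite rmorph0 add0r.
  - by move=> *; move=> a Va /=; rewrite rmorph0 addNr.
  - by move=> *; move=> a Va /=; rewrite mulrA.
  - by move=> *; move=> a Va /=; rewrite mulrC.
  - by move=> *; move=> a Va /=; rewrite rmorph1 mul1r.
  - by move=> *; move=> a Va /=; rewrite mulrDl.
have [R [p [ps [pE [pz [po [pa [pn pm]]]]]]]] := setoid_ring_quot sE.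
have [r hr] := choice ps.
pose d l x := p (DDer l (r x)).
have dE l f : d l (p f) = p (DDer l f).
  apply/pE; have /pE h := hr (p f).
  by move=> a Va /=; rewrite (h a Va).
have dD l x y : d l (x + y) = d l x + d l y.
  rewrite (hr x) (hr y) -pa !dE -pa; apply/pE => a Va /=.
  by rewrite (proj1 (proj1 hU l)).
have dM l x y : d l (x * y) = d l x * y + x * d l y.
  rewrite (hr x) (hr y) -pm !dE -!pm -pa; apply/pE => a Va /=.
  by rewrite (proj2 (proj1 hU l)).
have dC l k x : d l (d k x) = d k (d l x).
  rewrite (hr x) !dE; apply/pE => a Va /=.
  by rewrite (proj2 hU).
have [c hc] : exists c : {rmorphism K -> R}, forall k, c k = p (DCst _ _ k).
  apply: rmorph_of => [x y|x y|//].
    by rewrite -pa; apply/pE => a Va /=; rewrite rmorphD.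
  by rewrite -pm; apply/pE => a Va /=; rewrite rmorphM.
have p0 f : p f = 0 <-> vanish f.
  rewrite -pz pE /E /=; split=> h a Va; first by rewrite h ?rmorph0.
  by rewrite rmorph0; apply: h.
have hP : prime_ideal (fun x : R => x = 0).
  split=> //; first by move=> x y -> ->; rewrite addr0.
  - by move=> q x ->; rewrite mulr0.
  - rewrite -po => /p0 h; have [[a Va] _] := Sirr.
    by have /eqP := h a Va; rewrite /= rmorph1 oner_eq0.
  move=> x y; rewrite (hr x) (hr y) -pm => /p0/vanish_prime[/p0|/p0]; by [left|right].
have [|L [DL [f [hL [f0 [fd fs]]]]]] := prime_diff_field dD dM dC hP.
  by move=> l x ->; apply: (@addrI _ (d l 0)); rewrite -dD !addr0.
pose e := GRing.RMorphism.clone _ _ (f \o c) _ : {rmorphism K -> L}.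
have eE k : e k = f (p (DCst _ _ k)) by rewrite /= hc.
have eD : diff_emb D DL e.
  by move=> l k; rewrite !eE -fd dE; congr (f _); apply/pE => a Va /=; rewrite iD.
pose b : dpoint D n := DPoint (fun k => f (p (DVar _ _ k))) hL eD.
have evb q : ev b q = f (p q).
  elim: q => [k|k|q Hq q' Hq'|q Hq|q Hq q' Hq'|l q Hq]; rewrite /ev /= ?hc //.
  - by rewrite pa rmorphD -Hq -Hq'.
  - by rewrite pn rmorphN -Hq.
  - by rewrite pm rmorphM -Hq -Hq'.
  - by rewrite -dE fd -Hq.
have ev0 q : ev b q = 0 <-> vanish q by rewrite evb -p0.
have Svan q : S q -> vanish q by move=> Sq a; apply.
(* Since [s g] need not extend to [U], the embedding of [K] is twisted instead: [bg] evaluates [q]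
   as [b] evaluates its conjugate. Its specializations to [U] lie on [V], because the terms of [S]
   are fixed by [s g]; one with nonzero [q] contradicts [vanish q]. *)
have stab g q : vanish q -> vanish (dmap (s g) q).
  move=> vq; apply/ev0; apply: contrapT => nq.
  pose eg := GRing.RMorphism.clone _ _ (e \o s g) _ : {rmorphism K -> L}.
  have egD : diff_emb D DL eg by move=> l k; rewrite [LHS]/= sD -eD.
  pose bg : dpoint D n := DPoint (fun k => f (p (DVar _ _ k))) hL egD.
  have evg w : ev bg w = ev b (dmap (s g) w) by rewrite /ev deval_dmap.
  have [|a [na ha]] := @specialize_point K U m n D DU i bg q K0 hD cU iD; first by rewrite evg.
  apply/na/vq => w Sw; apply: ha; rewrite evg.
  rewrite (@dmap_fixed _ _ _ _ (fixed_field s)) ?ev0; first exact: Svan.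
    by move=> k; apply.
  exact: SF.
have hsig g : exists h : {rmorphism R -> R}, forall q, h (p q) = p (dmap (s g) q).
  have stab' q q' : p q = p q' -> p (dmap (s g) q) = p (dmap (s g) q').
    move=> h; apply/eqP; rewrite -subr_eq0 -pn -pa; apply/eqP.
    have /p0/(stab g)/p0 : p (DAdd q (DOpp q')) = 0 by rewrite pa pn h subrr.
    by [].
  pose h x := p (dmap (s g) (r x)).
  have hE q : h (p q) = p (dmap (s g) q) by apply: stab'; rewrite -hr.
  have [k hk] : exists k : {rmorphism R -> R}, forall x, k x = h x.
    apply: rmorph_of => [x y|x y|].
    - by rewrite (hr x) (hr y) -pa !hE /= pa.
    - by rewrite (hr x) (hr y) -pm !hE /= pm.
    - by rewrite -po hE /= rmorph1.
  by exists k => q; rewrite hk hE.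
have [sg hsg] := choice hsig.
have dmapM g h q : dmap (s (g * h)%g) q = dmap (s g) (dmap (s h) q) :> term.
  by elim: q => //= [k|q -> q' ->|q ->|q -> q' ->|l q ->]; rewrite ?sM.
have dmap1 q : dmap (s 1%g) q = q :> term.
  by elim: q => //= [k|q -> q' ->|q ->|q -> q' ->|l q ->]; rewrite ?s1.
have ht g : exists h : {rmorphism L -> L}, forall x, h (f x) = f (sg g x).
  have [|h hh] := @fraction_rmorphism R L L f (GRing.RMorphism.clone _ _ (f \o sg g) _) fs.
    move=> x; rewrite /= (hr x) hsg !f0 !p0; split=> [|h]; first exact: stab.
    have := stab g^-1%g _ h; rewrite -dmapM mulVg dmap1; exact.
  by exists h => x; rewrite hh.
have [t htE] := choice ht.
have tE g q : t g (ev b q) = ev b (dmap (s g) q) by rewrite !evb htE hsg.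
have frac (x : L) : exists q q', ev b q' != 0 /\ x * ev b q' = ev b q.
  have [u [v [nv ->]]] := fs x; exists (r u), (r v).
  by rewrite !evb -!hr divfK.
exists b, t; split=> //.
- split; first exact: (pchar_rmorphism e).
  split=> //; split; first split.
  + move=> x; have [q [q' [nq eq]]] := frac x.
    apply: (mulIf nq); rewrite eq -[in LHS](dmap1 q') -tE -(rmorphM (t 1%g)).
    by rewrite eq tE dmap1.
  + move=> g h x; have [q [q' [nq eq]]] := frac x.
    have n2 : ev b (dmap (s (g * h)%g) q') != 0 by rewrite -tE fmorph_eq0.
    apply: (mulIf n2); rewrite -[in LHS]tE -(rmorphM (t (g * h)%g)) eq tE !dmapM.
    by rewrite -!tE -(rmorphM (t g)) -(rmorphM (t h)) eq.
  + move=> g l x; have [q [q' [nq eq]]] := frac x.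
    have n2 : t g (ev b q') != 0 by rewrite fmorph_eq0.
    have Dev w : DL l (ev b w) = ev b (DDer l w) by [].
    have tD w : t g (DL l (ev b w)) = DL l (t g (ev b w)).
      rewrite Dev !tE Dev /=; congr (ev b _).
    have [[_ hM] _] := (proj1 hL l, tt).
    have e1 := congr1 (fun y => t g (DL l y)) eq.
    rewrite /= tD -eq rmorphM !hM rmorphD !rmorphM tD in e1.
    by apply: (mulIf n2); apply: (addIr _ e1).
- by move=> g x; have := tE g (DCst _ _ x).
- by move=> g k; have := tE g (DVar _ _ k).
Qed.
End GenericPoint.

(** * Existentially closed fields have strongly PAC invariants *)

Fixpoint gdterm_of (C G : Type) (n m : nat) (p : dterm C n m) : gdterm C G n m :=
  match p with
  | DVar i => GVar _ _ _ i
  | DCst c => GCst _ _ _ c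
  | DAdd p q => GAdd (gdterm_of G p) (gdterm_of G q)
  | DOpp p => GOpp (gdterm_of G p)
  | DMul p q => GMul (gdterm_of G p) (gdterm_of G q)
  | DDer j p => GDer j (gdterm_of G p)
  end.

Arguments gdterm_of {C} G {n m} p.

Lemma gdeval_gdterm_of (C : Type) (G : finGroupType) (L : fieldType) (n m : nat)
  (f : C -> L) (D : 'I_m -> L -> L) (s : G -> {rmorphism L -> L}) (a : 'I_n -> L)
  (p : dterm C n m) : gdeval f D s a (gdterm_of G p) = deval f D a p.
Proof. by elim: p => //= [p -> q ->|p ->|p -> q ->|l p ->]. Qed.

Lemma In_enum (T : finType) (x : T) : List.In x (enum T).
Proof.
have : x \in enum T by rewrite mem_enum.
by elim: (enum T) => //= y s IH; rewrite inE => /orP[/eqP->|/IH]; [left|right].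
Qed.

Lemma ec_strongly_PAC (G : finGroupType) (K : fieldType) (m : nat)
  (D : 'I_m -> K -> K) (s : G -> {rmorphism K -> K}) :
  ec_G_diff_field D s -> K_strongly_PAC_diff D (fixed_field s).
Proof.
move=> [HK ec] U DU i cU iD n S SF Sirr.
have [K0 [hD _]] := HK.
have [b [t [hb bt tv b0]]] := generic_point HK cU iD SF Sirr.
have [eqs [neqs [be bn hP]]] := isolated_type K0 b.
(* These equations force the coordinates of a solution to be invariant under [G]. *)
pose fx : list (gdterm K G n m) :=
  [seq GAdd (GSig p.1 (GVar K G m p.2)) (GOpp (GVar K G m p.2)) | p <- enum {: G * 'I_n}].
have [||a [ae an]] := ec _ _ _ _ hb (_ : G_diff_emb D s _ t (pt_emb b)) n
  (map (gdterm_of G) eqs ++ fx)%list (map (gdterm_of G) neqs).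
- by split; first exact: pt_embD.
- exists (pt_val b); split=> q.
    move=> hq; case: (List.in_app_or _ _ _ hq) => /In_map[w [<- hw]].
      by rewrite gdeval_gdterm_of; apply: be.
    by rewrite /= tv subrr.
  move=> /In_map[w [<- hw]]; rewrite gdeval_gdterm_of.
  by apply/eqP; apply: bn.
have aF k : fixed_field s (a k).
  move=> g; apply/eqP; rewrite -subr_eq0; apply/eqP.
  apply: (ae (GAdd (GSig g (GVar K G m k)) (GOpp (GVar K G m k)))).
  apply: List.in_or_app; right; apply/In_map; exists (g, k); split=> //.
  exact: In_enum.
exists a; split=> // q Sq.
have idD : diff_emb D D (GRing.RMorphism.clone _ _ (@idfun K) _) by [].
pose P : dpoint D n := DPoint a hD idD.
have : ev P q = 0.
  apply: hP.
  - move=> w hw; rewrite -[RHS](ae (gdterm_of G w)) ?gdeval_gdterm_of //.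
    by apply: List.in_or_app; left; apply: List.in_map.
  - move=> w hw; apply/eqP; have := an (gdterm_of G w); rewrite gdeval_gdterm_of; apply.
    exact: List.in_map.
  - by apply/b0 => c Vc; apply: Vc.
move/(congr1 i); rewrite rmorph0 (deval_comp _ _ _ iD) => h.
by rewrite -[RHS]h; apply: eq_deval.
Qed.

(** * Descent to the field of invariants *)

Section GaloisBasis.
Variables (G : finGroupType) (K : fieldType) (s : G -> {rmorphism K -> K}).
Hypothesis sG : is_G_action s.
Local Notation N := #|G|.
Variable e : 'I_N -> K.
Hypothesis e_free : lin_indep_over (fixed_field s) e.

(* Artin's argument: a nonzero solution with as few nonzero entries as possible,
   normalized to have an entry equal to 1, is fixed by [G]. *)
Lemma artin_independence (x : 'I_N -> K) :
  (forall g, \sum_j s g (e j) * x j = 0) -> forall j, x j = 0.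
Proof.
have [s1 sM] := sG.
move: {2}(#|[pred j | x j != 0]|) (leqnn #|[pred j | x j != 0]|) => k.
elim: k x => [|k IH] x.
  rewrite leqn0 => /eqP/card0_eq h _ j; have := h j; rewrite !inE.
  by move/negbFE/eqP.
move=> xk hx j0; apply/eqP; apply: contraT => nj0.
pose y j := x j / x j0.
have hy g : \sum_j s g (e j) * y j = 0.
  by rewrite /y; under eq_bigr do rewrite mulrA; rewrite -mulr_suml hx mul0r.
have yF j : fixed_field s (y j).
  move=> h; apply/eqP; rewrite -subr_eq0; apply/eqP.
  apply: (IH (fun j => s h (y j) - y j)).
    rewrite -ltnS; apply: leq_trans xk; apply: proper_card; apply/properP; split.
      apply/fintype.subsetP => l; rewrite !inE; apply: contra => /eqP xl.
      by rewrite /y xl mul0r rmorph0 subr0.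
    exists j0; rewrite !inE //= /y divff // rmorph1 subrr eqxx //.
  move=> g; under eq_bigr do rewrite mulrBr.
  rewrite sumrB hy subr0.
  transitivity (s h (\sum_l s (h^-1 * g)%g (e l) * y l)); last by rewrite hy rmorph0.
  by rewrite rmorph_sum; apply: eq_bigr => l _; rewrite rmorphM -sM mulKVg.
have : y j0 = 0.
  apply: (e_free yF); have := hy 1%g; under eq_bigr do rewrite s1 mulrC.
  exact.
by rewrite /y divff // => /eqP; rewrite oner_eq0.
Qed.

(** The matrix of conjugates of the basis. Its invertibility over [K] persists over every extension,
    which is how the basis carries over to [L]. *)
Let A : 'M[K]_N := \matrix_(r, j) s (enum_val r) (e j).
Let A_unit : A \in unitmx.
Proof.
rewrite -unitmx_tr unitmxE unitfE; apply/negP => /det0P[v nv vA].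
move/eqP: nv; apply; apply/rowP => j; rewrite !mxE.
apply: (@artin_independence (fun j => v 0 j)) => g.
have /rowP/(_ (enum_rank g)) := vA; rewrite !mxE => h; rewrite -[RHS]h.
by apply: eq_bigr => l _; rewrite !mxE enum_rankK mulrC.
Qed.

Section Extension.
Variables (L : fieldType) (t : G -> {rmorphism L -> L}) (i : {rmorphism K -> L}).
Hypotheses (tG : is_G_action t) (it : forall g x, i (s g x) = t g (i x)).

Let AL_unit : map_mx i A \in unitmx. Proof. by rewrite map_unitmx. Qed.

Lemma conjugates_free (x : 'I_N -> L) :
  (forall g, \sum_j i (s g (e j)) * x j = 0) -> forall j, x j = 0.
Proof.
move=> h j; pose X : 'cV[L]_N := \col_l x l.
have AX : map_mx i A *m X = 0.
  apply/colP => r; rewrite !mxE -[RHS](h (enum_val r)).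
  by apply: eq_bigr => l _; rewrite !mxE.
have : X = 0 by rewrite -(mulKmx AL_unit X) AX mulmx0.
by move/colP/(_ j); rewrite !mxE.
Qed.

Lemma basis_free (c : 'I_N -> L) : (forall g j, t g (c j) = c j) ->
  \sum_j c j * i (e j) = 0 -> forall j, c j = 0.
Proof.
move=> cF h; apply: conjugates_free => g.
transitivity (t g (\sum_j c j * i (e j))); last by rewrite h rmorph0.
by rewrite rmorph_sum; apply: eq_bigr => j _; rewrite rmorphM it cF mulrC.
Qed.

(** The coordinates solve the linear system whose right-hand sides are the conjugates of [y].
    Applying [t h] permutes its equations, so uniqueness of the solution makes it invariant. *)
Lemma basis_coordinates (y : L) : exists c : 'I_N -> L,
  (forall g j, t g (c j) = c j) /\ y = \sum_j c j * i (e j).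
Proof.
have [s1 sM] := sG; have [t1 tM] := tG.
pose Y : 'cV[L]_N := \col_r t (enum_val r) y.
pose C := invmx (map_mx i A) *m Y.
have AC : map_mx i A *m C = Y by rewrite mulKVmx.
have CE g : \sum_j i (s g (e j)) * C j 0 = t g y.
  have /colP/(_ (enum_rank g)) := AC; rewrite !mxE enum_rankK => <-.
  by apply: eq_bigr => l _; rewrite !mxE enum_rankK.
exists (fun j => C j 0); split.
  move=> h j; apply/eqP; rewrite -subr_eq0; apply/eqP.
  apply: (@conjugates_free (fun j => t h (C j 0) - C j 0)) => g.
  under eq_bigr do rewrite mulrBr.
  rewrite sumrB CE; apply/eqP; rewrite subr_eq0; apply/eqP.
  transitivity (t h (\sum_l i (s (h^-1 * g)%g (e l)) * C l 0)).
    by rewrite rmorph_sum; apply: eq_bigr => l _; rewrite rmorphM -it -sM mulKVg.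
  by rewrite CE -tM mulKVg.
rewrite -[LHS]t1 -CE; apply: eq_bigr => j _; by rewrite s1 mulrC.
Qed.
End Extension.
End GaloisBasis.

Section Coordinates.
Variables (G : finGroupType) (K : fieldType) (m : nat) (D : 'I_m -> K -> K).
Variable (s : G -> {rmorphism K -> K}).
Hypothesis HK : G_diff_field D s.
Local Notation N := #|G|.
Variables (e : 'I_N -> K) (crd : K -> 'I_N -> K).
Hypothesis crdF : forall x j, fixed_field s (crd x j).
Hypothesis crdE : forall x, x = \sum_j crd x j * e j.
Variable n : nat.
Local Notation term := (dterm K n m).
Local Notation F := (fixed_field s).

Definition dsum (f : 'I_N -> term) : term :=
  foldr (fun j t => DAdd (f j) t) (DCst _ _ 0) (enum 'I_N).
Lemma ev_dsum (P : dpoint D n) f : ev P (dsum f) = \sum_j ev P (f j).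
Proof.
rewrite /dsum -big_enum /=; elim: (enum 'I_N) => [|j r IH].
  by rewrite big_nil /ev /= rmorph0.
by rewrite big_cons -IH.
Qed.
Lemma dsumF f : (forall j, dcoeffs_in F (f j)) -> dcoeffs_in F (dsum f).
Proof.
move=> h; rewrite /dsum; elim: (enum 'I_N) => [|j r IH] /=; last by split.
by move=> g; rewrite rmorph0.
Qed.

(* A tuple [u] of terms over [F = K^G] stands for the term [\sum_j u_j e_j] over [K]. *)
Definition tuple_val (P : dpoint D n) (u : 'I_N -> term) : pt_field P :=
  \sum_j ev P (u j) * pt_emb P (e j).
(** Coordinates of the image under the [F]-linear map that sends [e j] to [f j]. Products,
    derivatives of the basis and the action of [G] are instances. *)
Definition tlin (f : 'I_N -> K) (u : 'I_N -> term) : 'I_N -> term :=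
  fun l => dsum (fun j => DMul (u j) (DCst _ _ (crd (f j) l))).
Definition tcst (x : K) : 'I_N -> term := fun j => DCst _ _ (crd x j).
Definition tadd (u v : 'I_N -> term) : 'I_N -> term := fun j => DAdd (u j) (v j).
Definition topp (u : 'I_N -> term) : 'I_N -> term := fun j => DOpp (u j).
Definition tmul (u v : 'I_N -> term) : 'I_N -> term :=
  fun l => dsum (fun k => DMul (v k) (tlin (fun j => e j * e k) u l)).
Definition tder (l : 'I_m) (u : 'I_N -> term) : 'I_N -> term :=
  tadd (fun j => DDer l (u j)) (tlin (fun j => D l (e j)) u).
Definition tvar (k : 'I_n) : 'I_N -> term := fun j => DMul (DVar _ _ k) (DCst _ _ (crd 1 j)).

Definition over_F (u : 'I_N -> term) : Prop := forall j, dcoeffs_in F (u j).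
Lemma tlinF f u : over_F u -> over_F (tlin f u).
Proof. by move=> h l; apply: dsumF => j /=; split=> //; apply: crdF. Qed.
Lemma tmulF u v : over_F u -> over_F v -> over_F (tmul u v).
Proof. by move=> hu hv l; apply: dsumF => j /=; split=> //; apply: tlinF. Qed.
Lemma tcstF x : over_F (tcst x). Proof. by move=> j; apply: crdF. Qed.
Lemma taddF u v : over_F u -> over_F v -> over_F (tadd u v).
Proof. by move=> hu hv j; split. Qed.
Lemma tderF l u : over_F u -> over_F (tder l u).
Proof. by move=> hu; apply: taddF => //; apply: tlinF. Qed.
Lemma tvarF k : over_F (tvar k).
Proof. by move=> j; split=> //; apply: crdF. Qed.

Section Values.
Variable P : dpoint D n.
Local Notation val := (tuple_val P).
Local Notation i := (pt_emb P).

Lemma val_cst x : val (tcst x) = i x.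
Proof.
rewrite [in RHS](crdE x) rmorph_sum; apply: eq_bigr => j _.
by rewrite rmorphM.
Qed.
Lemma val_lin f u : val (tlin f u) = \sum_j ev P (u j) * i (f j).
Proof.
rewrite /tuple_val /tlin; under eq_bigr do rewrite ev_dsum mulr_suml.
rewrite exchange_big; apply: eq_bigr => j _.
rewrite [in RHS](crdE (f j)) rmorph_sum mulr_sumr; apply: eq_bigr => l _.
by rewrite ev_mul rmorphM mulrA.
Qed.
Lemma val_add u v : val (tadd u v) = val u + val v.
Proof. by rewrite -big_split; apply: eq_bigr => j _; rewrite ev_add mulrDl. Qed.
Lemma val_opp u : val (topp u) = - val u.
Proof. by rewrite -sumrN; apply: eq_bigr => j _; rewrite ev_opp mulNr. Qed.
Lemma val_mul u v : val (tmul u v) = val u * val v.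
Proof.
transitivity (\sum_k ev P (v k) * val (tlin (fun j => e j * e k) u)).
  rewrite /tuple_val /tmul; under eq_bigr do rewrite ev_dsum mulr_suml.
  rewrite exchange_big; apply: eq_bigr => k _; rewrite mulr_sumr.
  by apply: eq_bigr => l _; rewrite ev_mul mulrA.
rewrite [in RHS]/tuple_val mulr_sumr; apply: eq_bigr => k _.
rewrite val_lin mulr_sumr mulr_suml; apply: eq_bigr => j _.
by rewrite rmorphM; ring.
Qed.
Lemma val_der l u : val (tder l u) = @pt_der _ _ _ _ P l (val u).
Proof.
rewrite val_add val_lin (der_sum (proj1 (pt_diff P) l)) -big_split.
apply: eq_bigr => j _ /=; rewrite (proj2 (proj1 (pt_diff P) l)) pt_embD.
by [].
Qed.
Lemma val_var k : val (tvar k) = pt_val P k.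
Proof.
transitivity (pt_val P k * val (tcst 1)); last by rewrite val_cst rmorph1 mulr1.
by rewrite mulr_sumr; apply: eq_bigr => j _; rewrite mulrA.
Qed.
End Values.

Fixpoint tuple_of_dterm (p : term) : 'I_N -> term :=
  match p with
  | DVar k => tvar k
  | DCst c => tcst c
  | DAdd p q => tadd (tuple_of_dterm p) (tuple_of_dterm q)
  | DOpp p => topp (tuple_of_dterm p)
  | DMul p q => tmul (tuple_of_dterm p) (tuple_of_dterm q)
  | DDer l p => tder l (tuple_of_dterm p)
  end.
Lemma tuple_of_dtermF p : over_F (tuple_of_dterm p).
Proof.
elim: p => [k|c|p hp q hq|p hp|p hp q hq|l p hp] /=.
- exact: tvarF.
- exact: tcstF.
- exact: taddF.
- exact: hp.
- exact: tmulF.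
- exact: tderF.
Qed.
Lemma val_tuple_of_dterm P p : tuple_val P (tuple_of_dterm p) = ev P p.
Proof.
elim: p => [k|c|p hp q hq|p hp|p hp q hq|l p hp] /=.
- exact: val_var.
- exact: val_cst.
- by rewrite val_add hp hq.
- by rewrite val_opp hp.
- by rewrite val_mul hp hq.
- by rewrite val_der hp.
Qed.

(** At a point with invariant coordinates [s g] moves only the basis vectors, so [GSig] becomes a
    linear substitution. Each of the [r] unknowns is replaced by its tuple of coordinates [rho]. *)
Fixpoint tuple_of_gdterm (r : nat) (rho : 'I_r -> 'I_N -> term) (p : gdterm K G r m) :
  'I_N -> term :=
  match p with
  | GVar k => rho k
  | GCst c => tcst c
  | GAdd p q => tadd (tuple_of_gdterm rho p) (tuple_of_gdterm rho q)
  | GOpp p => topp (tuple_of_gdterm rho p)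
  | GMul p q => tmul (tuple_of_gdterm rho p) (tuple_of_gdterm rho q)
  | GDer l p => tder l (tuple_of_gdterm rho p)
  | GSig g p => tlin (fun j => s g (e j)) (tuple_of_gdterm rho p)
  end.
Lemma tuple_of_gdtermF r (rho : 'I_r -> 'I_N -> term) p :
  (forall k, over_F (rho k)) -> over_F (tuple_of_gdterm rho p).
Proof.
move=> hr; elim: p => [k|c|p hp q hq|p hp|p hp q hq|l p hp|g p hp] /=.
- exact: hr.
- exact: tcstF.
- exact: taddF.
- exact: hp.
- exact: tmulF.
- exact: tderF.
- exact: tlinF.
Qed.

Section FixedPoint.
Variables (P : dpoint D n) (t : G -> {rmorphism pt_field P -> pt_field P}).
Hypothesis Pt : G_diff_field (@pt_der _ _ _ _ P) t.
Hypothesis it : forall g x, pt_emb P (s g x) = t g (pt_emb P x).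
Hypothesis tv : forall g k, t g (pt_val P k) = pt_val P k.

Lemma ev_fixed p g : dcoeffs_in F p -> t g (ev P p) = ev P p.
Proof.
have [_ [_ [_ tD]]] := Pt.
elim: p => [k _|c|p hp q hq [/hp ep /hq eq]|p hp /hp ep|p hp q hq [/hp ep /hq eq]|l p hp /hp ep].
- exact: tv.
- by move=> /= cF; rewrite /ev /= -it cF.
- by rewrite ev_add rmorphD ep eq.
- by rewrite ev_opp rmorphN ep.
- by rewrite ev_mul rmorphM ep eq.
- by rewrite ev_der tD ep.
Qed.

Lemma val_tuple_of_gdterm r (rho : 'I_r -> 'I_N -> term) p :
  (forall k, over_F (rho k)) ->
  tuple_val P (tuple_of_gdterm rho p) =
  gdeval (pt_emb P) (@pt_der _ _ _ _ P) t (fun k => tuple_val P (rho k)) p.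
Proof.
move=> hr; elim: p => [k|c|p hp q hq|p hp|p hp q hq|l p hp|g p hp] /=.
- by [].
- exact: val_cst.
- by rewrite val_add hp hq.
- by rewrite val_opp hp.
- by rewrite val_mul hp hq.
- by rewrite val_der hp.
- rewrite -hp val_lin rmorph_sum; apply: eq_bigr => j _.
  by rewrite rmorphM it ev_fixed //; apply: tuple_of_gdtermF.
Qed.
End FixedPoint.
End Coordinates.

(** * From strongly PAC invariants to existential closedness *)

Lemma irreducible_of_generic (C U : fieldType) (n m : nat) (D : 'I_m -> C -> C)
  (DU : 'I_m -> U -> U) (i : C -> U) (b : dpoint D n) (V : ('I_n -> U) -> Prop) :
  (forall f, ev b f = 0 -> forall a, V a -> deval i DU a f = 0) ->
  (forall f, ev b f <> 0 -> exists2 a, V a & deval i DU a f <> 0) ->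
  irreducible_wrt (kclosed i DU) V.
Proof.
move=> h1 h2; split.
  have [|a Va _] := h2 (DCst _ _ 1); last by exists a.
  by rewrite /ev /= rmorph1 => /eqP; rewrite oner_eq0.
move=> A B [SA hA] [SB hB] hV.
have [hAf|nA] := pselect (forall f, SA f -> ev b f = 0).
  left=> a; split=> [Va|Aa]; last by apply/hV; left.
  by apply/hA => f /hAf h; apply: h1 h _ Va.
have [hBf|nB] := pselect (forall f, SB f -> ev b f = 0).
  right=> a; split=> [Va|Ba]; last by apply/hV; right.
  by apply/hB => f /hBf h; apply: h1 h _ Va.
have [f [Sf nf]] : exists f, SA f /\ ev b f <> 0.
  by apply: contrapT => h; apply: nA => f Sf; apply: contrapT => nf; apply: h; exists f.
have [g [Sg ng]] : exists f, SB f /\ ev b f <> 0.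
  by apply: contrapT => h; apply: nB => g Sg; apply: contrapT => ng; apply: h; exists g.
have [|a Va] := h2 (DMul f g).
  by rewrite ev_mul => /eqP; rewrite mulf_eq0 => /orP[/eqP|/eqP].
by case/hV: Va => /= [/hA/(_ _ Sf) ->|/hB/(_ _ Sg) ->]; rewrite ?mul0r ?mulr0.
Qed.

Lemma strongly_PAC_ec (G : finGroupType) (K : fieldType) (m : nat)
  (D : 'I_m -> K -> K) (s : G -> {rmorphism K -> K}) :
  G_diff_field D s -> strict_action s ->
  K_strongly_PAC_diff D (fixed_field s) -> ec_G_diff_field D s.
Proof.
move=> HK [[e e_free] _] hPAC; split=> // L DL t i HL [iD it] n eqs neqs [b [b0 bn]].
have [K0 [hD [sG sD]]] := HK; have [L0 [hL [tG tD]]] := HL.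
have idit g x : (GRing.RMorphism.clone _ _ (@idfun K) _ : {rmorphism K -> K}) (s g x) =
   s g ((GRing.RMorphism.clone _ _ (@idfun K) _ : {rmorphism K -> K}) x) by [].
have [crd hcrd] := choice (basis_coordinates sG e_free sG idit).
have crdF x j : fixed_field s (crd x j) by move=> g; apply: (proj1 (hcrd x)).
have crdE x : x = \sum_j crd x j * e j by apply: (proj2 (hcrd x)).
pose h : gdterm K G n m := foldr (fun p q => GMul p q) (GCst _ _ _ 1) neqs.
have hev (M : fieldType) (DM : 'I_m -> M -> M) (tM : G -> {rmorphism M -> M}) (iM : {rmorphism K -> M}) a :
    gdeval iM DM tM a h != 0 <-> forall p, List.In p neqs -> gdeval iM DM tM a p != 0.
  rewrite /h; elim: neqs {bn h} => /= [|p r IH]; first by rewrite rmorph1 oner_eq0; split.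
  rewrite mulf_eq0 negb_or; split=> [/andP[np /IH hr] q [<-//|]|hr]; first exact: hr.
  by rewrite hr ?IH //=; [move=> q hq; apply: hr; right|left].
have nh : gdeval i DL t b h != 0 by apply/hev.
(* Rabinowitsch's trick: the extra coordinate 0 is the inverse of the product [h] of the
   inequations, so that at the end an equation shows [h] to be nonzero. *)
pose b' (k : 'I_n.+1) := oapp b (gdeval i DL t b h)^-1 (unlift ord0 k).
have [c hc] := choice (fun k => basis_coordinates sG e_free tG it (b' k)).
pose X := ('I_n.+1 * 'I_#|G|)%type.
pose v (q : 'I_#|{: X}|) := c (enum_val q).1 (enum_val q).2.
pose P : dpoint D #|{: X}| := DPoint v hL iD.
have vF g k : t g (pt_val P k) = pt_val P k by apply: (proj1 (hc _)).
pose rho0 (k : 'I_n.+1) (j : 'I_#|G|) : dterm K #|{: X}| m := DVar _ _ (enum_rank (k, j)).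
pose rho k := rho0 (lift ord0 k).
have rho0F k : over_F s (rho0 k) by [].
have rhoF k : over_F s (rho k) by [].
have val_rho0 k : tuple_val e P (rho0 k) = b' k.
  rewrite (proj2 (hc k)); apply: eq_bigr => j _.
  by rewrite /ev /= /v enum_rankK.
have val_rho k : tuple_val e P (rho k) = b k.
  by rewrite val_rho0 /b' liftK.
pose S p := dcoeffs_in (fixed_field s) p /\ ev P p = 0.
have tuple0 u : over_F s u -> tuple_val e P u = 0 -> forall j, S (u j).
  move=> uF u0 j; split=> //.
  apply: (basis_free sG e_free it _ u0) => g l.
  exact: (@ev_fixed G K m D s _ P t HL it vF).
have [U [DU [j [cU jD]]]] := exists_diff_closure K0 hD.
have [||a [aF aS]] := hPAC U DU j cU jD #|{: X}| S.
- by move=> p [].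
(* If a term over [K] vanishes at [P], so do its coordinates over [F], by freeness of the basis over
   the invariants of [L]. They belong to [S], hence the term vanishes on the whole locus. *)
- apply: (@irreducible_of_generic _ _ _ _ _ _ _ P) => f.
    move=> f0 a Va; pose Q : dpoint D #|{: X}| := DPoint a (proj1 (proj2 cU)) jD.
    rewrite -[LHS]/(ev Q f) -(val_tuple_of_dterm crdE) /tuple_val.
    apply: big1 => l _; rewrite [ev Q _](Va _ _) ?mul0r //.
    apply: tuple0; first exact: tuple_of_dtermF.
    by rewrite (val_tuple_of_dterm crdE).
  move=> nf; have [a [na ha]] := specialize_point K0 hD cU jD nf.
  by exists a => // p [_ p0]; apply: ha.
have idD : diff_emb D D (GRing.RMorphism.clone _ _ (@idfun K) _) by [].
pose Q : dpoint D #|{: X}| := DPoint a hD idD.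
have QS p : S p -> ev Q p = 0.
  move=> Sp; apply: (fmorph_inj j); rewrite rmorph0 (deval_comp _ _ _ jD).
  by rewrite -[RHS](aS _ Sp); apply: eq_deval.
have val0 u : over_F s u -> tuple_val e P u = 0 -> tuple_val e Q u = 0.
  by move=> uF u0; apply: big1 => l _; rewrite QS ?mul0r //; apply: tuple0.
have valP p : tuple_val e P (tuple_of_gdterm D s e crd rho p) = gdeval i DL t b p.
  rewrite (@val_tuple_of_gdterm G K m D s e crd crdF crdE _ P t HL it vF) //.
  by congr (gdeval _ _ _ _ _); apply/funext => k; rewrite val_rho.
have valQ p : tuple_val e Q (tuple_of_gdterm D s e crd rho p) =
    gdeval id D s (fun k => tuple_val e Q (rho k)) p.
  exact: (@val_tuple_of_gdterm G K m D s e crd crdF crdE _ Q s HK idit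
    (fun g k => aF k g)).
exists (fun k => tuple_val e Q (rho k)); split=> [p hp|].
  rewrite -valQ; apply: val0; first exact: tuple_of_gdtermF.
  by rewrite valP; apply: b0.
apply/(hev _ _ _ (GRing.RMorphism.clone _ _ (@idfun K) _)).
rewrite -[gdeval _ _ _ _ _]valQ; apply/eqP => h0.
pose w := tadd (tmul e crd (tuple_of_gdterm D s e crd rho h) (rho0 ord0)) (topp (tcst m crd _ 1)).
have : tuple_val e Q w = 0.
  apply: val0.
    apply: taddF; last exact: tcstF.
    by apply: tmulF => //; apply: tuple_of_gdtermF.
  rewrite val_add (val_mul crdE) val_opp (val_cst crdE) valP val_rho0 /b' unlift_none /=.
  by rewrite mulfV // rmorph1 subrr.
rewrite val_add (val_mul crdE) val_opp (val_cst crdE) h0 mul0r add0r rmorph1 => /eqP.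
by rewrite oppr_eq0 oner_eq0.
Qed.

(** * Derivations of algebraic extensions *)

Section AlgebraicElements.
Variables (K L : fieldType) (i : {rmorphism K -> L}).
Local Notation "p ^i" := (map_poly i p) (at level 2, format "p ^i").

Definition is_min_poly (y : L) (q : {poly K}) : Prop :=
  [/\ q != 0, q^i.[y] = 0 &
   forall f : {poly K}, f^i.[y] = 0 -> (size f < size q)%N -> f = 0].

Lemma exists_min_poly y : algebraicOver i y -> exists q, is_min_poly y q.
Proof.
case=> p np /eqP py.
move: {2}(size p) (leqnn (size p)) => N; elim: N p np py => [|N IH] p np py.
  by rewrite leqn0 size_poly_eq0 (negbTE np).
move=> pN; have [[f nf [fy fp]]|h] :=
    pselect (exists2 f : {poly K}, f != 0 & f^i.[y] = 0 /\ (size f < size p)%N).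
  by apply: (IH f nf fy); rewrite -ltnS (leq_trans fp).
exists p; split=> // f fy fp; apply/eqP; apply: contraT => nf.
by case: h; exists f.
Qed.

Lemma min_poly_dvd y q f : is_min_poly y q -> f^i.[y] = 0 -> q %| f.
Proof.
case=> nq qy hmin fy; apply/modp_eq0P; apply: hmin; last exact: ltn_modpN0.
have := divp_eq f q => /(congr1 (fun h : {poly K} => h^i.[y])).
by rewrite fy rmorphD rmorphM hornerD hornerM qy mulr0 add0r.
Qed.

Lemma min_poly_size y q : is_min_poly y q -> (1 < size q)%N.
Proof.
case=> nq qy _; rewrite ltnNge; apply/negP => /size1_polyC e.
move: qy; rewrite e map_polyC hornerC => /eqP; rewrite fmorph_eq0 => /eqP q0.
by move: nq; rewrite e q0 polyC0 eqxx.
Qed.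

Lemma min_poly_deriv y q : [pchar K] =i pred0 -> is_min_poly y q -> q^`()^i.[y] != 0.
Proof.
move=> /pcharf0P K0 hq; have q1 := min_poly_size hq; have [nq qy hmin] := hq.
apply/eqP => /hmin; rewrite lt_size_deriv // => /(_ isT) q'0.
have := congr1 (fun p : {poly K} => p`_(size q).-2) q'0; rewrite coef_deriv coef0.
rewrite prednK; last by rewrite -ltnS prednK // ltnW.
rewrite -mulr_natr => /eqP; rewrite mulf_eq0 K0 -lead_coefE lead_coef_eq0 (negbTE nq) /=.
by case: (size q) q1 => [|[|k]].
Qed.

Lemma min_poly_root y q a : is_min_poly y q -> q.[a] = 0 -> y = i a.
Proof.
move=> [nq qy hmin] /eqP/factor_theorem[r qE].
have nr : r != 0 by apply: contraNneq nq => r0; rewrite qE r0 mul0r.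
have sr : (size r < size q)%N.
  by rewrite qE size_Mmonic ?monicXsubC // size_XsubC addn2.
move: qy; rewrite qE rmorphM hornerM rmorphB /= map_polyX map_polyC hornerXsubC.
move=> /eqP; rewrite mulf_eq0 subr_eq0 => /orP[/eqP ry|/eqP//].
by rewrite (hmin r ry sr) eqxx in nr.
Qed.

Section ExtendDerivation.
Variable d : K -> K.
Hypothesis hd : is_derivation d.
Let d0 := der0 hd.

(** The value at [f(z)] forced on any derivation that extends [d] and takes [z] to [v]. *)
Definition poly_der (z v : L) (f : {poly K}) : L :=
  (map_poly d f)^i.[z] + f^`()^i.[z] * v.

Lemma map_derD f g : map_poly d (f + g) = map_poly d f + map_poly d g.
Proof. by apply/polyP => k; rewrite coefD !coef_map_id0 // coefD (proj1 hd). Qed.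
Lemma map_derC c : map_poly d c%:P = (d c)%:P.
Proof.
by apply/polyP => k; rewrite coef_map_id0 // !coefC; case: ifP => // _; rewrite d0.
Qed.
Lemma map_derM f g : map_poly d (f * g) = map_poly d f * g + f * map_poly d g.
Proof.
apply/polyP => k; rewrite coef_map_id0 // coefD !coefM (der_sum hd) -big_split.
by apply: eq_bigr => l _ /=; rewrite (proj2 hd) !coef_map_id0.
Qed.
Lemma map_derX : map_poly d 'X = 0.
Proof.
by apply/polyP => k; rewrite coef_map_id0 // coefX coef0; case: eqP => _;
  rewrite ?(der1 hd) ?d0.
Qed.

Lemma poly_derD z v f g : poly_der z v (f + g) = poly_der z v f + poly_der z v g.
Proof. by rewrite /poly_der map_derD derivD !rmorphD !hornerD; ring. Qed.
Lemma poly_derM z v f g : poly_der z v (f * g) =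
  poly_der z v f * g^i.[z] + f^i.[z] * poly_der z v g.
Proof.
by rewrite /poly_der map_derM derivM !rmorphD !rmorphM !hornerD !hornerM; ring.
Qed.
Lemma poly_derC z v c : poly_der z v c%:P = i (d c).
Proof.
by rewrite /poly_der map_derC derivC rmorph0 horner0 mul0r addr0 map_polyC hornerC.
Qed.
Lemma poly_derX z v : poly_der z v 'X = v.
Proof. by rewrite /poly_der map_derX derivX rmorph0 horner0 rmorph1 hornerC; ring. Qed.

Lemma poly_der_comp z v f g :
  poly_der z v (f \Po g) = poly_der g^i.[z] (poly_der z v g) f.
Proof.
elim/poly_ind: f => [|f c IH].
  by rewrite comp_poly0 -polyC0 !poly_derC.
rewrite comp_polyD comp_polyM comp_polyX comp_polyC !poly_derD !poly_derM !poly_derC.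
by rewrite IH poly_derX map_comp_poly horner_comp map_polyX hornerX.
Qed.

Lemma derivation_poly (e : L -> L) y (f : {poly K}) : is_derivation e ->
  (forall x, e (i x) = i (d x)) -> e f^i.[y] = poly_der y (e y) f.
Proof.
move=> he hei; elim/poly_ind: f => [|f c IH].
  by rewrite -polyC0 poly_derC map_polyC hornerC hei.
rewrite poly_derD poly_derM poly_derC poly_derX -IH rmorphD rmorphM /= map_polyX map_polyC.
by rewrite hornerMXaddC (proj1 he) (proj2 he) hei hornerX.
Qed.

Hypothesis K0 : [pchar K] =i pred0.

Lemma derivation_unique e1 e2 y : is_derivation e1 -> is_derivation e2 ->
  (forall x, e1 (i x) = i (d x)) -> (forall x, e2 (i x) = i (d x)) ->
  algebraicOver i y -> e1 y = e2 y.
Proof.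
move=> h1 h2 i1 i2 /exists_min_poly[q hq].
have := derivation_poly y q h1 i1; have := derivation_poly y q h2 i2.
have [_ -> _] := hq; rewrite (der0 h1) (der0 h2) => E2 E1.
have : poly_der y (e1 y) q = poly_der y (e2 y) q by rewrite -E1 -E2.
by move/addrI/(mulfI (min_poly_deriv K0 hq)).
Qed.

(** The value [e y] is forced by the minimal polynomial of [y], whose derivative does not vanish at
    [y]. The chain rule shows that these separate choices agree: [e] on a polynomial expression in
    [z] is computed from [e z]. *)
Lemma derivation_extension : (forall y, algebraicOver i y) ->
  exists e : L -> L, is_derivation e /\ forall x, e (i x) = i (d x).
Proof.
move=> alg; have [q hq] := choice (fun y => exists_min_poly (alg y)).
pose e y := - (map_poly d (q y))^i.[y] / (q y)^`()^i.[y].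
have ney y : (q y)^`()^i.[y] != 0 by apply: min_poly_deriv.
have eq0 y : poly_der y (e y) (q y) = 0.
  by rewrite /poly_der /e mulrCA mulfV // mulr1 subrr.
have eE z f : e f^i.[z] = poly_der z (e z) f.
  set x := f^i.[z].
  have [_ qx _] := hq x.
  have /(min_poly_dvd (hq z))/dvdpP[r rE] : (q x \Po f)^i.[z] = 0.
    by rewrite map_comp_poly horner_comp.
  have : poly_der z (e z) (q x \Po f) = 0.
    by have [_ qz _] := hq z; rewrite rE poly_derM eq0 qz !mulr0 addr0.
  rewrite poly_der_comp -/x -[RHS](eq0 x) => /addrI/(mulfI (ney x)).
  by [].
(* By the primitive element theorem two elements are polynomials in a single [z], which reduces
   additivity and the Leibniz rule to those of [poly_der]. *)
have PET x y : exists z f g, x = f^i.[z] /\ y = g^i.[z].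
  have [p np px] := alg x; have [r nr ry] := alg y.
  have [k [[f hf] [g hg]]] := pchar0_PET np px nr ry K0.
  by exists (y *+ k - x), f, g.
exists e; split; first split.
- move=> x y; have [z [f [g [-> ->]]]] := PET x y.
  by rewrite -hornerD -rmorphD !eE poly_derD.
- move=> x y; have [z [f [g [-> ->]]]] := PET x y.
  by rewrite -hornerM -rmorphM !eE poly_derM.
- move=> x; have := eE 0 x%:P; rewrite poly_derC map_polyC hornerC; exact.
Qed.
End ExtendDerivation.
End AlgebraicElements.

Definition dterm_of_poly (C : nzRingType) (m : nat) (q : seq C) : dterm C 1 m :=
  foldr (fun c acc => DAdd (DMul acc (DVar _ _ ord0)) (DCst _ _ c)) (DCst _ _ 0) q.

Lemma deval_dterm_of_poly (C L : fieldType) (i : {rmorphism C -> L}) (m : nat)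
  (D : 'I_m -> L -> L) (a : 'I_1 -> L) (q : {poly C}) :
  deval i D a (dterm_of_poly m q) = (map_poly i q).[a ord0].
Proof.
rewrite map_polyE horner_Poly; elim: (q : seq C) => [|c s IH] /=.
  by rewrite rmorph0.
by rewrite IH.
Qed.

Lemma ec_alg_G_closed (G : finGroupType) (K : fieldType) (m : nat)
  (D : 'I_m -> K -> K) (s : G -> {rmorphism K -> K}) :
  ec_G_diff_field D s -> alg_G_closed s.
Proof.
move=> [[K0 [hD [sG sD]]] ec] L i t alg tG ti y.
have algL z : algebraicOver i z by have [p [np pz]] := alg z; exists p.
have [DL hDL] := choice (fun l => derivation_extension (proj1 hD l) K0 algL).
have [[s1 sM] [t1 tM]] := (sG, tG).
have derL l : is_derivation (DL l) by case: (hDL l).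
have DLi l x : DL l (i x) = i (D l x) by case: (hDL l).
have hL : is_diff_field DL.
  split=> // j k z.
  (* The commutator is a derivation that vanishes on [K], so by uniqueness it is zero on the
     algebraic extension. *)
  pose c (w : L) := DL j (DL k w) - DL k (DL j w).
  have hz : is_derivation (fun _ : K => 0 : K) by split=> *; rewrite ?mul0r ?mulr0 addr0.
  have hzL : is_derivation (fun _ : L => 0 : L) by split=> *; rewrite ?mul0r ?mulr0 addr0.
  have hc : is_derivation c.
    have [[jD jM] [kD kM]] := (derL j, derL k).
    split=> u v; rewrite /c; first by rewrite kD jD jD kD; ring.
    by rewrite kM jM !jD !kD !jM !kM; ring.
  apply/eqP; rewrite -subr_eq0 -/(c z); apply/eqP.
  apply: (derivation_unique hz K0 hc hzL) => // x.
    by rewrite /c !DLi (proj2 hD) subrr rmorph0.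
  by rewrite rmorph0.
have tDL g j x : t g (DL j x) = DL j (t g x).
  (* The conjugate of [DL j] by [t g] also extends [D j], so uniqueness makes the two equal. *)
  pose c w := t g (DL j (t g^-1%g w)).
  have hc : is_derivation c.
    have [jD jM] := derL j.
    split=> u v; rewrite /c; first by rewrite rmorphD jD rmorphD.
    by rewrite rmorphM jM rmorphD !rmorphM -!tM mulgV !t1.
  have <- : c (t g x) = DL j (t g x).
    apply: (derivation_unique (proj1 hD j) K0 hc (derL j)) => // z.
    by rewrite /c ti DLi ti sD -sM mulgV s1.
  by rewrite /c -tM mulVg t1.
have [q hq] := exists_min_poly (algL y).
have iD : G_diff_emb D s DL t i by split=> [l x|g x]; rewrite ?DLi ?ti.
have HL : G_diff_field DL t by split; first exact: (pchar_rmorphism i).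
have [|a [ha _]] := ec L DL t i HL iD 1%N [:: gdterm_of G (dterm_of_poly m q)] [::].
  exists (fun=> y); split=> // p [<-|[]]; rewrite gdeval_gdterm_of deval_dterm_of_poly.
  by have [] := hq.
exists (a ord0); symmetry; apply: (min_poly_root hq).
have := ha _ (or_introl erefl); rewrite gdeval_gdterm_of.
rewrite (deval_dterm_of_poly (GRing.RMorphism.clone _ _ (@idfun K) _)).
by rewrite map_poly_id.
Qed.

(** * Regular extensions *)

Lemma exists_irreducible_divisor (F : fieldType) (p : {poly F}) : (1 < size p)%N ->
  exists r, irreducible_poly r /\ r %| p.
Proof.
move: {2}(size p) (leqnn (size p)) => N; elim: N p => [|N IH] p pN p1.
  by have := leq_trans p1 pN.
have [[r [rp [r1 sr]]]|h] :=
    pselect (exists r : {poly F}, r %| p /\ ((1 < size r)%N /\ (size r < size p)%N)).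
  have [|q [irr qr]] := IH r _ r1; first by rewrite -ltnS (leq_trans sr).
  by exists q; split=> //; apply: dvdp_trans qr rp.
exists p; split=> //; split=> // q q1 qp.
have np : p != 0 by rewrite -size_poly_gt0 ltnW.
rewrite -dvdp_size_eqp // eqn_leq dvdp_leq //= leqNgt; apply/negP => sq.
apply: h; exists q; split=> //; split=> //.
have : (0 < size q)%N by rewrite size_poly_gt0; apply: dvdpN0 np.
by move: q1; case: (size q) => [|[|]].
Qed.

Definition poly_closed (O : fieldType) : Prop :=
  forall p : {poly O}, (1 < size p)%N -> exists x, p.[x] = 0.

(* Take a differentially closed field without derivations: it is an existentially
   closed field, hence algebraically closed. *)
Lemma exists_poly_closed (L : fieldType) : [pchar L] =i pred0 ->
  exists (O : fieldType) (k : {rmorphism L -> O}), poly_closed O.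
Proof.
move=> L0; have nodiff (F : fieldType) (d : 'I_0 -> F -> F) : is_diff_field d.
  by split=> -[].
have [O [DO [k [[O0 [hO cO]] _]]]] := exists_diff_closure L0 (nodiff L (fun _ x => x)).
exists O, k => p p1; have [r [irr rp]] := exists_irreducible_divisor p1.
have [E _ [z rz _]] := irredp_FAdjoin irr.
pose DE (j : 'I_0) (x : E) := x.
have [||a [ha _]] := cO (E : fieldType) DE (GRing.RMorphism.clone _ _ (in_alg E) _)
  (nodiff _ _) _ 1%N [:: dterm_of_poly 0 r] [::].
- by move=> [].
- exists (fun=> z); split=> // q [<-|[]].
  by rewrite (deval_dterm_of_poly (GRing.RMorphism.clone _ _ (in_alg E) _)); apply/eqP.
exists (a ord0); apply/eqP; apply: (root_dvdp rp); apply/eqP.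
have := ha _ (or_introl erefl).
by rewrite (deval_dterm_of_poly (GRing.RMorphism.clone _ _ (@idfun O) _)) map_poly_id.
Qed.

Lemma poly_closed_split (O : fieldType) (p : {poly O}) : poly_closed O -> p \is monic ->
  exists rs : seq O, p = \prod_(r <- rs) ('X - r%:P).
Proof.
move=> cO; move: {2}(size p) (leqnn (size p)) => N; elim: N p => [|N IH] p pN mp.
  by move: pN; rewrite leqn0 size_poly_eq0 (negbTE (monic_neq0 mp)).
have [p1|p1] := ltnP 1 (size p); last first.
  exists [::]; rewrite big_nil; move: (mp); rewrite (size1_polyC p1) monicE lead_coefC.
  by move/eqP->.
have [x /eqP/factor_theorem[q qE]] := cO p p1.
have mq : q \is monic by rewrite -(monicMr _ (monicXsubC x)) -qE.
have [|rs rsE] := IH q _ mq.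
  by move: pN; rewrite qE size_Mmonic ?monicXsubC ?monic_neq0 // size_XsubC addn2.
by exists (x :: rs); rewrite big_cons qE rsE mulrC.
Qed.

Lemma algebraic_prod_XsubC (K O : fieldType) (f : {rmorphism K -> O}) (rs : seq O) n :
  (forall r, r \in rs -> algebraicOver f r) ->
  algebraicOver f (\prod_(r <- rs) ('X - r%:P))`_n.
Proof.
elim: rs n => [|r rs IH] n h.
  rewrite big_nil coef1; case: eqP => _; [exact: algebraic1|exact: algebraic0].
have ars l : algebraicOver f (\prod_(r <- rs) ('X - r%:P))`_l.
  by apply: IH => x xrs; apply: h; rewrite inE xrs orbT.
rewrite big_cons mulrBl coefB coefXM coefCM; apply: algebraic_sub.
  by case: ifP => _ //; apply: algebraic0.
by apply: algebraic_mul => //; apply: h; rewrite mem_head.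
Qed.

Section RelativelyClosed.
Variables (K L O : fieldType) (i : {rmorphism K -> L}) (k : {rmorphism L -> O}).
Hypotheses (K0 : [pchar K] =i pred0) (cO : poly_closed O).
Hypothesis i_closed : forall y, algebraicOver i y -> exists x, y = i x.
Local Notation ki := (GRing.RMorphism.clone _ _ (k \o i) _ : {rmorphism K -> O}).

Lemma map_ki (p : {poly K}) : map_poly ki p = map_poly k (map_poly i p).
Proof. by rewrite -map_poly_comp. Qed.

(* The minimal polynomial over [L] has coefficients algebraic over [K]. *)
Lemma min_poly_over_closed w (q : {poly K}) (A : {poly L}) : is_min_poly ki w q ->
  (map_poly k A).[w] = 0 -> (size A < size q)%N -> A = 0.
Proof.
move=> hq Aw sA; have [nq qw qmin] := hq.
have [p hp] : exists p, is_min_poly k w p.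
  apply: exists_min_poly; exists (map_poly i q); first by rewrite map_poly_eq0.
  by apply/eqP; rewrite -map_ki.
have [np pw pmin] := hp.
apply: pmin => //; apply: (leq_trans sA).
pose p1 := (lead_coef p)^-1 *: p.
have nl : lead_coef p != 0 by rewrite lead_coef_eq0.
have mp1 : p1 \is monic by rewrite monicE lead_coefZ mulVf.
have sp1 : size p1 = size p by rewrite size_scale // invr_eq0.
have p1w : (map_poly k p1).[w] = 0 by rewrite map_polyZ hornerZ pw mulr0.
have [|rs rsE] := @poly_closed_split O (map_poly k p1) cO; first by rewrite map_monic.
have rs_alg r : r \in rs -> algebraicOver ki r.
  move=> rrs; exists q => //; rewrite map_ki.
  have pq : p %| map_poly i q by apply: (min_poly_dvd hp); rewrite -map_ki.
  have : root (map_poly k p1) r by rewrite rsE root_prod_XsubC.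
  apply: root_dvdp; rewrite dvdp_map; apply: dvdp_trans pq.
  by rewrite dvdpZl // invr_eq0.
have p1K n : exists x, p1`_n = i x.
  apply: i_closed; have := algebraic_prod_XsubC n rs_alg; rewrite -rsE coef_map.
  case=> f nf; rewrite map_ki /root horner_map fmorph_eq0 => fx.
  by exists f.
have [x hx] := choice p1K.
pose f := \poly_(n < size p1) x n.
have fE : map_poly i f = p1.
  apply/polyP => n; rewrite coef_map coef_poly; case: ltnP => [_|h]; first by rewrite hx.
  by rewrite raddf0 nth_default.
have fw : (map_poly ki f).[w] = 0 by rewrite map_ki fE.
rewrite -sp1 -fE size_map_poly leqNgt; apply/negP => sf.
have f0 := qmin f fw sf; move: (monic_neq0 mp1).
by move: fE; rewrite f0 map_poly0 => <-; rewrite eqxx.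
Qed.

Lemma primitive_element (xs : seq O) : (forall x, x \in xs -> algebraicOver ki x) ->
  exists w, algebraicOver ki w /\
    forall x, x \in xs -> exists f : {poly K}, x = (map_poly ki f).[w].
Proof.
elim: xs => [|x xs IH] h; first by exists 0; split=> //; apply: algebraic0.
have [|w [aw hw]] := IH; first by move=> y yxs; apply: h; rewrite inE yxs orbT.
have ax : algebraicOver ki x by apply: h; rewrite mem_head.
have [[p np px] [q nq qw]] := (ax, aw).
have [n [[f hf] [g hg]]] := pchar0_PET np px nq qw K0.
exists (w *+ n - x); split.
  apply: algebraic_sub => //; rewrite -mulr_natr; apply: algebraic_mul => //.
  by rewrite -(rmorph_nat ki); apply: algebraic_id.
move=> y; rewrite inE => /orP[/eqP->|/hw[e ->]]; first by exists f.
by exists (e \Po g); rewrite map_comp_poly horner_comp hg.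
Qed.

(** Writing each [X p] as a polynomial in a primitive element [w], the relation over [L] becomes a
    polynomial in [w] of degree less than that of [w] over [K]. It is therefore zero, and [a] may be
    applied to its coefficients. *)
Lemma algebraic_linearly_disjoint (T : Type) (s : seq T) (X : T -> O) (l : T -> L) a :
  (forall p, algebraicOver ki (X p)) -> klinear i a ->
  \sum_(p <- s) X p * k (l p) = 0 -> \sum_(p <- s) ki (a (l p)) * X p = 0.
Proof.
move=> Xalg ha hs.
have [|w [aw hw]] := @primitive_element [seq X p | p <- s].
  by move=> x; elim: s {hs} => //= p s IH; rewrite inE => /orP[/eqP->|/IH].
have [q hq] := exists_min_poly aw; have [nq qw _] := hq.
have hQ p : exists f : {poly K}, (X p \in [seq X p | p <- s] -> X p = (map_poly ki f).[w])
    /\ (size f < size q)%N.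
  have [/hw[f e]|] := boolP (X p \in [seq X p | p <- s]); last first.
    by exists 0; rewrite size_poly0 size_poly_gt0.
  exists (f %% q); split; last exact: ltn_modpN0.
  move=> _; rewrite e {1}(divp_eq f q) rmorphD rmorphM hornerD hornerM qw mulr0.
  by rewrite add0r.
have [Q hQs] := choice hQ.
have XQ : forall r : seq T, (forall p, List.In p r -> List.In p s) ->
    forall c : T -> O, \sum_(p <- r) X p * c p = \sum_(p <- r) (map_poly ki (Q p)).[w] * c p.
  elim=> [|p r IH] hr c; first by rewrite !big_nil.
  rewrite !big_cons IH; last by move=> p' h; apply: hr; right.
  congr (_ * _ + _); apply: (proj1 (hQs p)).
  have := hr p (or_introl erefl); elim: (s) => //= p' s' IHs [->|/IHs h].
    by rewrite mem_head.
  by rewrite inE h orbT.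
pose A := \sum_(p <- s) l p *: map_poly i (Q p).
have A0 : A = 0.
  apply: (min_poly_over_closed hq).
    rewrite rmorph_sum horner_sum -[RHS]hs (XQ s) //; apply: eq_bigr => p _.
    by rewrite /= map_polyZ hornerZ map_ki mulrC.
  rewrite /A; elim: (s) => [|p s' IHs]; first by rewrite big_nil size_poly0 size_poly_gt0.
  rewrite big_cons (leq_ltn_trans (size_polyD _ _)) // gtn_max IHs andbT.
  rewrite (leq_ltn_trans (size_scale_leq _ _)) // size_map_poly.
  exact: (proj2 (hQs p)).
have [aD aZ] := ha.
have B0 : \sum_(p <- s) a (l p) *: Q p = 0.
  apply/polyP => n; rewrite coef0 coef_sum.
  have := congr1 (fun p : {poly L} => a p`_n) A0; rewrite coef0 (klinear0 ha) coef_sum.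
  rewrite (klinear_sum _ _ ha) => h; rewrite -[RHS]h; apply: eq_bigr => p _.
  by rewrite !coefZ coef_map mulrC [in RHS]mulrC aZ.
under eq_bigr do rewrite mulrC; rewrite (XQ s) //.
have := congr1 (fun p : {poly K} => (map_poly ki p).[w]) B0.
rewrite rmorph0 horner0 rmorph_sum horner_sum => h; rewrite -[RHS]h.
by apply: eq_bigr => p _; rewrite /= map_polyZ hornerZ mulrC.
Qed.
End RelativelyClosed.

(** * Specialization of finitely generated domains to algebraic points *)

Section Specialization.
Variables (K U O : fieldType) (j : {rmorphism K -> U}) (f : {rmorphism K -> O}).
Hypotheses (K0 : [pchar K] =i pred0) (cO : poly_closed O).

(* A relative form of Zariski's lemma, proved by adjoining variables one at a time. *)
Definition specializable (R : idomainType) (e : {rmorphism R -> U}) (c : {rmorphism K -> R}) :=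
  forall h, e h != 0 -> exists phi : {rmorphism R -> O},
    [/\ forall x, phi (c x) = f x, forall r, e r = 0 -> phi r = 0, phi h != 0 &
        forall r, algebraicOver f (phi r)].

Lemma algebraic_horner (p : {poly O}) x : (forall n, algebraicOver f p`_n) ->
  algebraicOver f x -> algebraicOver f p.[x].
Proof.
move=> hp hx; rewrite horner_coef; elim/big_ind: _ => [|y z|n _].
- exact: algebraic0.
- exact: algebraic_add.
apply: algebraic_mul => //; elim: (n : nat) => [|l IH]; first exact: algebraic1.
by rewrite exprS; apply: algebraic_mul.
Qed.

Lemma exists_nonroot (p : {poly O}) : p != 0 -> exists n, p.[n%:R] != 0.
Proof.
move=> np; apply: contrapT => h.
have /pcharf0P O0 := pchar_rmorphism f K0.
pose rs : seq O := [seq n%:R | n <- iota 0 (size p)].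
have : (size rs < size p)%N.
  apply: max_poly_roots => //.
    apply/allP => x /mapP[n _ ->]; apply/eqP.
    by apply: contrapT => nz; apply: h; exists n; apply/eqP.
  rewrite map_inj_in_uniq ?iota_uniq // => a b _ _ e.
  wlog ab : a b e / (a <= b)%N.
    by move=> H; case/orP: (leq_total a b) => [/H->|/H <-].
  have := O0 (b - a)%N; rewrite natrB // e subrr eqxx => /esym/eqP.
  by lia.
by rewrite size_map size_iota ltnn.
Qed.

Section Step.
Variables (R : idomainType) (e : {rmorphism R -> U}) (c : {rmorphism K -> R}) (u : U).
Hypothesis spec : specializable e c.
Local Notation E p := ((map_poly e p).[u]).

Let ED (p q : {poly R}) : E (p + q) = E p + E q. Proof. by rewrite rmorphD hornerD. Qed.
Let EN (p : {poly R}) : E (- p) = - E p. Proof. by rewrite rmorphN hornerN. Qed.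
Let EM (p q : {poly R}) : E (p * q) = E p * E q. Proof. by rewrite rmorphM hornerM. Qed.
Let EZ r (p : {poly R}) : E (r *: p) = e r * E p. Proof. by rewrite map_polyZ hornerZ. Qed.
Let EC r : E r%:P = e r. Proof. by rewrite map_polyC hornerC. Qed.

Let extend (phi : {rmorphism R -> O}) (x : O) :
  exists phi' : {rmorphism {poly R} -> O}, forall p, phi' p = (map_poly phi p).[x].
Proof.
apply: rmorph_of => [p q|p q|]; rewrite ?rmorphD ?hornerD ?rmorphM ?hornerM //.
by rewrite rmorph1 hornerC.
Qed.

(** Specialize [R] so that some coefficient of [h] survives, then send [u] to a natural number that
    is not a root of the specialized polynomial. *)
Lemma specialize_transcendental (h : {poly R}) :
  (forall p, E p = 0 -> map_poly e p = 0) -> E h != 0 ->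
  exists phi : {rmorphism {poly R} -> O},
    [/\ forall x, phi (c x)%:P = f x, forall r, E r = 0 -> phi r = 0, phi h != 0 &
        forall r, algebraicOver f (phi r)].
Proof.
move=> tr nh.
have [n nhn] : exists n, e h`_n != 0.
  apply: contrapT => H; move/eqP: nh; apply.
  suff -> : map_poly e h = 0 by rewrite horner0.
  apply/polyP => n; rewrite coef_map coef0; apply/eqP; apply: contrapT => /negP hn.
  by apply: H; exists n.
have [phi [pc p0 ph pa]] := spec nhn.
have [|l hl] := @exists_nonroot (map_poly phi h).
  by apply/eqP => /(congr1 (fun p : {poly O} => p`_n)); rewrite coef_map coef0 => /eqP; rewrite (negbTE ph).
have [phi' phiE] := extend phi l%:R.
exists phi'; split.
- by move=> x; rewrite phiE map_polyC hornerC; apply: pc.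
- move=> r /tr r0; rewrite phiE.
  suff -> : map_poly phi r = 0 by rewrite horner0.
  apply/polyP => k; rewrite coef_map coef0; apply: p0.
  by rewrite -coef_map r0 coef0.
- by rewrite phiE.
- move=> r; rewrite phiE; apply: algebraic_horner; last first.
    by rewrite -(rmorph_nat f); apply: algebraic_id.
  by move=> k; rewrite coef_map; apply: pa.
Qed.

Variable p : {poly R}.
Hypotheses (np : map_poly e p != 0) (pu : E p = 0).
Hypothesis pmin : forall q : {poly R}, E q = 0 -> (size q < size p)%N -> map_poly e q = 0.

(** As [e] need not be injective, it may kill a leading coefficient; truncation then lowers the size
    and keeps the image. *)
Let drop_lead (h : {poly R}) : h != 0 -> e (lead_coef h) = 0 ->
  exists g : {poly R}, (size g < size h)%N /\ map_poly e h = map_poly e g.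
Proof.
move=> nh eh; exists (take_poly (size h).-1 h); split.
  by apply: leq_ltn_trans (size_take_poly _ _) _; rewrite prednK ?size_poly_gt0.
apply/polyP => n; rewrite !coef_map coef_take_poly; case: ltnP => //.
rewrite leq_eqVlt => /orP[/eqP <-|hn]; first by rewrite raddf0 -lead_coefE.
by rewrite nth_default //; rewrite -[size h]prednK ?size_poly_gt0.
Qed.

Let nea : e (lead_coef p) != 0.
Proof.
have n0 : p != 0 by apply: contraNneq np => ->; rewrite rmorph0.
apply/eqP => /(drop_lead n0)[g [sg ge]].
move: np; rewrite ge (pmin _ sg) ?eqxx //.
by rewrite -ge.
Qed.
Let p_neq0 : p != 0. Proof. by apply: contraNneq np => ->; rewrite rmorph0. Qed.

Let p_gt1 : (1 < size p)%N.
Proof.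
rewrite ltnNge; apply/negP => /size1_polyC pE.
by move: pu nea; rewrite pE lead_coefC EC => ->; rewrite eqxx.
Qed.

(** The Euclidean algorithm with pseudo-division produces a multiple of [h] whose value at [u] is a
    nonzero constant from [R]; keeping that constant nonzero keeps [h] nonzero. *)
Let invert (h : {poly R}) : E h != 0 ->
  exists (s : {poly R}) r, e r != 0 /\ E (r%:P - s * h) = 0.
Proof.
move: {2}(size h) (leqnn (size h)) => N; elim: N h => [|N IH] h hN nh.
  by move: hN nh; rewrite leqn0 size_poly_eq0 => /eqP->; rewrite rmorph0 horner0 eqxx.
have [h1|h1] := leqP (size h) 1.
  exists 1, h`_0; rewrite mul1r -(size1_polyC h1) subrr rmorph0 horner0; split=> //.
  by move: nh; rewrite [in E h](size1_polyC h1) EC.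
have nh0 : h != 0 by rewrite -size_poly_gt0 ltnW.
have [ph|hp] := leqP (size p) (size h).
  have dE := Pdiv.Idomain.divp_eq h p.
  set b := lead_coef p ^+ _ in dE.
  have neb : e b != 0 by rewrite rmorphXn expf_neq0.
  have Er : E (h %% p) = e b * E h by rewrite -EZ dE ED EM pu mulr0 add0r.
  have [||s [r [nr sr]]] := IH (h %% p).
  - by rewrite -ltnS (leq_trans _ hN) // (leq_trans _ ph) // Pdiv.Idomain.ltn_modpN0.
  - by rewrite Er mulf_neq0.
  exists (b *: s), r; split=> //; move: sr; rewrite !ED !EN !EM EZ Er => <-.
  by ring.
have [eb|neb0] := eqVneq (e (lead_coef h)) 0.
  have [g [sg ge]] := drop_lead nh0 eb.
  have [||s [r [nr sr]]] := IH g; rewrite -?ge //.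
    by rewrite -ltnS (leq_trans sg).
  exists s, r; split=> //; move: sr; rewrite !ED !EN !EM.
  by rewrite -ge.
have dE := Pdiv.Idomain.divp_eq p h.
set b := lead_coef h ^+ _ in dE.
have neb : e b != 0 by rewrite rmorphXn expf_neq0.
have Er : E (p %% h) = - (E (p %/ h) * E h).
  have := congr1 (fun q => E q) dE; rewrite EZ pu mulr0 ED EM => /esym/eqP.
  by rewrite addrC addr_eq0 => /eqP.
have sr : (size (p %% h)%R < size h)%N by rewrite Pdiv.Idomain.ltn_modpN0.
(* If the remainder vanished at [u], so would the quotient; both are smaller than [p], so minimality
   gives them zero image under [e], and then [p] has zero image too. *)
have [r0|nr0] := eqVneq (E (p %% h)) 0.
  have e0 := pmin r0 (ltn_trans sr hp).
  have d0 : E (p %/ h) = 0.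
    move/eqP: Er; rewrite r0 eq_sym oppr_eq0 mulf_eq0 (negbTE nh) orbF.
    by move/eqP.
  have sd : (size (p %/ h)%R < size p)%N.
    by rewrite Pdiv.Idomain.size_divp //; move: h1 hp; lia.
  have := congr1 (map_poly e) dE.
  rewrite rmorphD rmorphM /= e0 (pmin d0 sd) mul0r addr0 map_polyZ => /eqP.
  by rewrite scaler_eq0 (negbTE neb) (negbTE np).
have [|s [r [nr hs]]] := IH (p %% h) _ nr0.
  by rewrite -ltnS (leq_trans sr).
exists (- (s * (p %/ h))), r; split=> //; move: hs.
by rewrite !ED !EN !EM EN EM Er => <-; ring.
Qed.

(** Specialize [R] keeping [r] and the leading coefficient of [p] nonzero, then send [u] to a root
    of [p]. The leading coefficient allows pseudo-division by [p], so relations of [u] are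
    respected; [r] keeps [h] alive. *)
Lemma specialize_algebraic (h : {poly R}) : E h != 0 ->
  exists phi : {rmorphism {poly R} -> O},
    [/\ forall x, phi (c x)%:P = f x, forall r, E r = 0 -> phi r = 0, phi h != 0 &
        forall r, algebraicOver f (phi r)].
Proof.
move=> nh; have [s [r [nr hs]]] := invert nh.
have [|phi [pc p0 ph pa]] := @spec (lead_coef p * r); first by rewrite rmorphM mulf_neq0.
move: ph; rewrite rmorphM mulf_eq0 negb_or => /andP[pl pr].
have mp : (map_poly phi p)`_(size p).-1 != 0 by rewrite coef_map -lead_coefE.
have np' : map_poly phi p != 0 by apply: contraNneq mp => ->; rewrite coef0.
have [|x xr] := cO (p := map_poly phi p).
  have : ((size p).-1 < size (map_poly phi p))%N.
    by rewrite ltnNge; apply: contra mp => /(nth_default 0) ->.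
  by apply: leq_trans; move: p_gt1; case: (size p) => [|[|]].
have [phi' phiE] := extend phi x.
have phi'C y : phi' y%:P = phi y by rewrite phiE map_polyC hornerC.
have ker g : E g = 0 -> phi' g = 0.
  move=> g0; have dE := Pdiv.Idomain.divp_eq g p.
  set b := lead_coef p ^+ _ in dE.
  have neb : phi b != 0 by rewrite rmorphXn expf_neq0.
  have g0' : E (g %% p) = 0.
    have := congr1 (fun q => E q) dE.
    by rewrite EZ g0 mulr0 ED EM pu mulr0 add0r.
  have m0 := pmin g0' (Pdiv.Idomain.ltn_modpN0 _ p_neq0).
  have z : phi' (g %% p) = 0.
    rewrite phiE; suff -> : map_poly phi (g %% p) = 0 by rewrite horner0.
    apply/polyP => n; rewrite coef_map coef0; apply: p0.
    by rewrite -coef_map m0 coef0.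
  have := congr1 phi' dE; rewrite -mul_polyC rmorphD !rmorphM z phi'C [phi' p]phiE xr.
  by rewrite mulr0 addr0 => /eqP; rewrite mulf_eq0 (negbTE neb) => /eqP.
exists phi'; split=> //.
- by move=> y; rewrite phi'C.
- apply/eqP => h0; have := ker _ hs.
  rewrite rmorphB rmorphM h0 mulr0 subr0 phi'C => /eqP.
  by rewrite (negbTE pr).
have xa : algebraicOver f x.
  apply/integral_algebraic; apply: (integral_root np'); first exact/eqP.
  by move=> y /(nthP 0)[n _ <-]; rewrite coef_map; apply/integral_algebraic; apply: pa.
by move=> g; rewrite phiE; apply: algebraic_horner => // n; rewrite coef_map; apply: pa.
Qed.
End Step.

Lemma exists_specializable (us : seq U) :
  exists (R : idomainType) (e : {rmorphism R -> U}) (c : {rmorphism K -> R}),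
  [/\ forall x, e (c x) = j x, specializable e c & forall u, u \in us -> exists r, e r = u].
Proof.
elim: us => [|u us [R [e [c [ec spec hus]]]]].
  exists K, j, (GRing.RMorphism.clone _ _ (@idfun K) _); split=> // h nh.
  exists f; split; first by [].
  - by move=> r /eqP; rewrite fmorph_eq0 => /eqP ->; rewrite rmorph0.
  - by rewrite fmorph_eq0; move: nh; rewrite fmorph_eq0.
  - by move=> r; apply: algebraic_id.
have [e' e'E] : exists e' : {rmorphism {poly R} -> U}, forall p, e' p = (map_poly e p).[u].
  apply: rmorph_of => [p q|p q|]; rewrite ?rmorphD ?hornerD ?rmorphM ?hornerM //.
  by rewrite rmorph1 hornerC.
exists {poly R}, e', (GRing.RMorphism.clone _ _ (@polyC R \o c) _); split.
- by move=> x; rewrite e'E /= map_polyC hornerC; apply: ec.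
- move=> h; rewrite e'E => nh.
  suff [phi [h1 h2 h3 h4]] : exists phi : {rmorphism {poly R} -> O},
    [/\ forall x, phi (c x)%:P = f x, forall r, (map_poly e r).[u] = 0 -> phi r = 0,
        phi h != 0 & forall r, algebraicOver f (phi r)].
    by exists phi; split=> // r; rewrite e'E; apply: h2.
  have [tr|ntr] := pselect (forall p, (map_poly e p).[u] = 0 -> map_poly e p = 0).
    exact: specialize_transcendental.
  have [p0 [np0 pu0]] : exists p, map_poly e p != 0 /\ (map_poly e p).[u] = 0.
    apply: contrapT => H; apply: ntr => p pu; apply/eqP; apply: contrapT => /negP np.
    by apply: H; exists p.
  have [p [np pu pmin]] : exists p, [/\ map_poly e p != 0, (map_poly e p).[u] = 0 &
      forall q : {poly R}, (map_poly e q).[u] = 0 -> (size q < size p)%N -> map_poly e q = 0].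
    move: {2}(size p0) (leqnn (size p0)) => N; elim: N p0 np0 pu0 => [|N IH] p np pu.
      by rewrite leqn0 size_poly_eq0 => /eqP p0; rewrite p0 rmorph0 eqxx in np.
    move=> pN; have [[q [qu [sq nq]]]|H] := pselect (exists q : {poly R},
        (map_poly e q).[u] = 0 /\ ((size q < size p)%N /\ map_poly e q != 0)).
      by apply: (IH q nq qu); rewrite -ltnS (leq_trans sq).
    exists p; split=> // q qu sq; apply/eqP; apply: contrapT => /negP nq.
    by apply: H; exists q.
  exact: (specialize_algebraic spec np pu pmin).
- move=> v; rewrite inE => /orP[/eqP->|/hus[r <-]].
    by exists 'X; rewrite e'E map_polyX hornerX.
  by exists r%:P; rewrite e'E map_polyC hornerC.
Qed.
End Specialization.

(** If [s] and [t] are nonzero, functionals [a], [b] on [L] turn them into nonzero elements of [U].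
    Specialize the finitely many elements of [U] involved to elements of [O] algebraic over [K],
    keeping both nonzero. The tensors then acquire values [Phi] in the field [O], one of which is
    zero; linear disjointness from [L] lets [a] or [b] be applied to that relation, a
    contradiction. *)
Lemma tensor_domain (K L U : fieldType) (i : {rmorphism K -> L}) (j : {rmorphism K -> U}) :
  [pchar K] =i pred0 -> (forall y, algebraicOver i y -> exists x, y = i x) ->
  forall s t : seq (U * L), tensor_eq j i (tensor_mul s t) [::] ->
  tensor_eq j i s [::] \/ tensor_eq j i t [::].
Proof.
move=> K0 i_closed s t hst; apply: contrapT => /not_orP[ns nt].
have [O [k cO]] := exists_poly_closed (pchar_rmorphism i K0).
pose ki := GRing.RMorphism.clone _ _ (k \o i) _ : {rmorphism K -> O}.
have ev0 (l : U -> K) : tensor_ev i l [::] = 0 :> L by rewrite /tensor_ev big_nil.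
have witness (v : seq (U * L)) : ~ tensor_eq j i v [::] -> exists a : L -> K,
    klinear i a /\ \sum_(p <- v) j (a p.2) * p.1 != 0.
  move=> nv; apply: contrapT => H; apply: nv => l hl; rewrite ev0.
  apply: (functional_eq0 (j := i)) => a ha.
  transitivity (l (\sum_(p <- v) j (a p.2) * p.1)).
    rewrite /tensor_ev (klinear_sum _ _ ha) (klinear_sum _ _ hl).
    by apply: eq_bigr => p _; rewrite (proj2 ha) (proj2 hl) mulrC.
  suff -> : \sum_(p <- v) j (a p.2) * p.1 = 0 by apply: klinear0 hl.
  by apply/eqP; apply: contrapT => /negP h; apply: H; exists a.
have [a [ha na]] := witness _ ns; have [b [hb nb]] := witness _ nt.
pose us := [seq p.1 | p <- s ++ t ++ tensor_mul s t].
have [R [e [c [ec spec hus]]]] := exists_specializable j ki K0 cO us.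
have hrho u : exists r, u \in us -> e r = u.
  have [/hus[r er]|] := boolP (u \in us); first by exists r.
  by exists 0.
have [rho hrho'] := choice hrho.
pose W (g : L -> K) (v : seq (U * L)) := \sum_(p <- v) c (g p.2) * rho p.1.
have rhoE (p : U * L) : forall v : seq (U * L), List.In p v -> {subset [seq q.1 | q <- v] <= us} ->
    e (rho p.1) = p.1.
  move=> v hv sv; apply/hrho'/sv; elim: v hv {sv} => //= q v IH [->|/IH h].
    by rewrite mem_head.
  by rewrite inE h orbT.
have eq_In (V : zmodType) (v : seq (U * L)) (F H : U * L -> V) :
    (forall p, List.In p v -> F p = H p) -> \sum_(p <- v) F p = \sum_(p <- v) H p.
  elim: v => [|q v IH] h; first by rewrite !big_nil.
  by rewrite !big_cons h ?IH //; [move=> p hp; apply: h; right|left].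
have eW g v : {subset [seq q.1 | q <- v] <= us} ->
    e (W g v) = \sum_(p <- v) j (g p.2) * p.1.
  move=> sv; rewrite rmorph_sum; apply: (eq_In) => p hp.
  by rewrite rmorphM ec (rhoE p v).
have ss : {subset [seq q.1 | q <- s] <= us}.
  by move=> x hx; rewrite /us map_cat mem_cat hx.
have st : {subset [seq q.1 | q <- t] <= us}.
  by move=> x hx; rewrite /us !map_cat !mem_cat hx orbT.
have sst : {subset [seq q.1 | q <- tensor_mul s t] <= us}.
  by move=> x hx; rewrite /us !map_cat !mem_cat hx !orbT.
have [|phi [pc p0 ph pa]] := spec (W a s * W b t); first by rewrite rmorphM !eW ?mulf_neq0.
pose Phi (v : seq (U * L)) := \sum_(p <- v) phi (rho p.1) * k p.2.
have PhiM : Phi (tensor_mul s t) = Phi s * Phi t.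
  have mulE : \sum_(p <- tensor_mul s t) phi (rho p.1) * k p.2 = \sum_(p <- s) \sum_(q <- t)
      phi (rho (p.1 * q.1)) * k (p.2 * q.2) by rewrite big_allpairs_dep.
  rewrite /Phi mulE mulr_suml; apply: (eq_In) => p hp; rewrite mulr_sumr; apply: (eq_In) => q hq.
  have -> : phi (rho (p.1 * q.1)) = phi (rho p.1) * phi (rho q.1).
    apply/eqP; rewrite -subr_eq0 -rmorphM -rmorphB; apply/eqP/p0.
    rewrite rmorphB rmorphM (rhoE p s) // (rhoE q t) // hrho' ?subrr //.
    apply: sst; apply/mapP; exists (p.1 * q.1, p.2 * q.2) => //.
    have ins (v : seq (U * L)) x : List.In x v -> x \in v.
      by elim: v => //= y v IH [->|/IH h]; rewrite inE ?eqxx ?h ?orbT.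
    by apply/allpairsP; exists (p, q); split; rewrite ?ins.
  by rewrite rmorphM; ring.
(* Expanding the factors from [L] in a dual basis reduces the claim to [W w.2] of the product, which
   is zero in [U] because the tensor is; the specialization respects this. *)
have Phi0 : Phi (tensor_mul s t) = 0.
  have [B [Bl BE]] := dual_basis i [seq p.2 | p <- tensor_mul s t].
  transitivity (\sum_(w <- B) k w.1 * phi (W w.2 (tensor_mul s t))).
    under [RHS]eq_bigr do rewrite rmorph_sum mulr_sumr.
    rewrite exchange_big; apply: (eq_In) => p hp.
    have {1}-> : p.2 = \sum_(w <- B) i (w.2 p.2) * w.1.
      apply: BE; apply/mapP; exists p => //.
      by elim: (tensor_mul s t) hp => //= q v IH [->|/IH h]; rewrite inE ?eqxx ?h ?orbT.
    rewrite rmorph_sum mulr_sumr; apply: eq_bigr => w _.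
    by rewrite !rmorphM pc /=; ring.
  have := Bl; elim: (B) => [|w B' IH] hB; first by rewrite big_nil.
  rewrite big_cons IH; last by move=> p hp; apply: hB; right.
  have hw := hB w (or_introl erefl).
  rewrite p0 ?mulr0 ?addr0 // eW //; apply: (functional_eq0 (j := j)) => l hl.
  transitivity (w.2 (tensor_ev i l (tensor_mul s t))); last first.
    by rewrite hst // ev0; apply: klinear0 hw.
  rewrite /tensor_ev (klinear_sum _ _ hw) (klinear_sum _ _ hl).
  by apply: eq_bigr => p _; rewrite (proj2 hl) (proj2 hw) mulrC.
have final v g : klinear i g -> Phi v = 0 -> phi (W g v) = 0.
  move=> hg v0; rewrite rmorph_sum.
  rewrite -[RHS](@algebraic_linearly_disjoint K L O i k K0 cO i_closed _ v
    (fun p => phi (rho p.1)) snd g _ hg v0) //.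
  by apply: eq_bigr => p _; rewrite rmorphM pc.
move: ph; rewrite rmorphM mulf_eq0 negb_or => /andP[/eqP n1 /eqP n2].
move: Phi0; rewrite PhiM => /eqP; rewrite mulf_eq0 => /orP[/eqP z|/eqP z].
  by apply: n1; apply: final.
by apply: n2; apply: final.
Qed.

(** * Absolute irreducibility and the main theorem *)

Section AlgebraicClosureIn.
Variables (K L : fieldType) (i : {rmorphism K -> L}).

Definition algebraic_pred : {pred L} := fun y => `[< algebraicOver i y >].
Fact algebraic_pred_divring : divring_closed algebraic_pred.
Proof.
split; first exact/asboolP/algebraic1.
  by move=> x y /asboolP hx /asboolP hy; apply/asboolP/algebraic_sub.
by move=> x y /asboolP hx /asboolP hy; apply/asboolP/algebraic_div.
Qed.
HB.instance Definition _ := GRing.isDivringClosed.Build L algebraic_pred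
  algebraic_pred_divring.

Record algebraic_sub_field := AlgebraicSub {
  asf_val : L; asf_valP : asf_val \in algebraic_pred }.
HB.instance Definition _ := [isSub for asf_val].
HB.instance Definition _ := [Choice of algebraic_sub_field by <:].
HB.instance Definition _ := [SubChoice_isSubIntegralDomain of algebraic_sub_field by <:].
HB.instance Definition _ := [SubIntegralDomain_isSubField of algebraic_sub_field by <:].
End AlgebraicClosureIn.

(** The elements of [L] algebraic over [K] form a subfield stable under [G], that is, an algebraic
    extension of [K] to which the action extends. *)
Lemma alg_G_closed_relatively (G : finGroupType) (K L : fieldType)
  (s : G -> {rmorphism K -> K}) (t : G -> {rmorphism L -> L}) (i : {rmorphism K -> L}) :
  alg_G_closed s -> is_G_action t -> (forall g x, i (s g x) = t g (i x)) ->
  forall y, algebraicOver i y -> exists x, y = i x.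
Proof.
move=> hK [t1 tM] it y hy.
pose A : fieldType := algebraic_sub_field i.
have vE (x z : A) : asf_val x = asf_val z -> x = z by apply: val_inj.
have iA x : i x \in algebraic_pred i by apply/asboolP/algebraic_id.
have [iK hiK] : exists f : {rmorphism K -> A}, forall x, f x = AlgebraicSub (iA x).
  by apply: rmorph_of => [x z|x z|]; apply: vE => /=; rewrite ?rmorphD ?rmorphM ?rmorph1.
have tA g (x : A) : t g (asf_val x) \in algebraic_pred i.
  apply/asboolP; have /asboolP[p np px] := asf_valP x.
  exists (map_poly (s g) p); first by rewrite map_poly_eq0.
  rewrite -map_poly_comp (eq_map_poly (it g)) map_poly_comp /root horner_map.
  by rewrite fmorph_eq0.
have htA g : exists f : {rmorphism A -> A}, forall x, f x = AlgebraicSub (tA g x).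
  by apply: rmorph_of => [x z|x z|]; apply: vE => /=; rewrite ?rmorphD ?rmorphM ?rmorph1.
have [tK htK] := choice htA.
have [|||x hx] := hK A iK tK _ _ _ (AlgebraicSub (introT (asboolP _) hy)).
- move=> z; have /asboolP[p np /eqP pz] := asf_valP z.
  exists p; split=> //; apply/eqP/vE.
  rewrite -[RHS]/(0 : L) -[RHS]pz.
  have -> : map_poly i p = map_poly (val : A -> L) (map_poly iK p).
    by rewrite -map_poly_comp; apply: eq_map_poly => w; rewrite /= hiK.
  by rewrite horner_map.
- split=> [z|g h z]; rewrite !htK; apply: vE => /=; first exact: t1.
  exact: tM.
- by move=> g z; rewrite htK !hiK; apply: vE => /=; rewrite it.
- by exists x; have := congr1 (@asf_val _ _ _) hx; rewrite hiK.
Qed.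

(** Differential polynomials over [U] are [U]-linear combinations of those over [K]: differentiating
    a coefficient stays in [U]. *)
Lemma dterm_decompose (K U : fieldType) (j : {rmorphism K -> U}) (m n : nat)
  (DU : 'I_m -> U -> U) (f : dterm U n m) :
  exists s : seq (U * dterm K n m), forall P : dpoint DU n,
    ev P f = \sum_(p <- s) pt_emb P p.1 *
      deval (pt_emb P \o j) (@pt_der _ _ _ _ P) (pt_val P) p.2.
Proof.
elim: f => [k|c|f [s hs] g [r hr]|f [s hs]|f [s hs] g [r hr]|l f [s hs]].
- by exists [:: (1, DVar _ _ k)] => P; rewrite big_seq1 /= rmorph1 mul1r.
- by exists [:: (c, DCst _ _ 1)] => P; rewrite big_seq1 /= !rmorph1 mulr1.
- by exists (s ++ r) => P; rewrite big_cat ev_add hs hr.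
- exists [seq (- p.1, p.2) | p <- s] => P; rewrite ev_opp hs big_map -sumrN.
  by apply: eq_bigr => p _; rewrite rmorphN mulNr.
- exists [seq (p.1 * q.1, DMul p.2 q.2) | p <- s, q <- r] => P.
  rewrite ev_mul hs hr big_allpairs_dep mulr_suml; apply: eq_bigr => p _.
  rewrite mulr_sumr; apply: eq_bigr => q _ /=.
  by rewrite rmorphM; ring.
- exists ([seq (DU l p.1, p.2) | p <- s] ++ [seq (p.1, DDer l p.2) | p <- s]) => P.
  rewrite ev_der hs (der_sum (proj1 (pt_diff P) l)) big_cat !big_map /= -big_split.
  by apply: eq_bigr => p _ /=; rewrite (proj2 (proj1 (pt_diff P) l)) pt_embD.
Qed.

(* [b] stays generic over [U] because the tensor product over [K] of [U] and the field
   of [b] is a domain, whose fraction field contains both. *)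
Lemma absolutely_irreducible (K U : fieldType) (m n : nat) (D : 'I_m -> K -> K)
  (DU : 'I_m -> U -> U) (j : {rmorphism K -> U}) (S : dterm K n m -> Prop) (b : dpoint D n) :
  [pchar K] =i pred0 -> is_diff_field D -> diff_closed DU -> diff_emb D DU j ->
  (forall y, algebraicOver (pt_emb b) y -> exists x, y = pt_emb b x) ->
  (forall f, ev b f = 0 <-> forall a, dzero j DU S a -> deval j DU a f = 0) ->
  irreducible_wrt (kclosed (@id U) DU) (dzero j DU S).
Proof.
move=> K0 hD cU jD b_closed b0.
have [U0 [hU _]] := cU; set i := pt_emb b in b_closed.
have [R [d [pU [pM [dD dM dC [dU dL] [pj ps p0 R1]]]]]] :=
  tensor_diff_ring hD hU (pt_diff b) jD (@pt_embD _ _ _ _ b).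
have hP : prime_ideal (fun x : R => x = 0).
  split=> //; first by move=> x y -> ->; rewrite addr0.
    by move=> q x ->; rewrite mulr0.
  move=> x y; have [[u ->] [v ->]] := (ps x, ps y) => h.
  case: (tensor_domain (j := j) K0 b_closed (s := u) (t := v)); last 2 first.
  - by move/p0; left.
  - by move/p0; right.
  apply/p0; rewrite /tensor_mul big_allpairs_dep -[RHS]h mulr_suml.
  apply: eq_bigr => p _; rewrite mulr_sumr; apply: eq_bigr => q _ /=.
  by rewrite !rmorphM; ring.
have [|F [DF [f [hF [f0 [fd _]]]]]] := prime_diff_field dD dM dC hP.
  by move=> l x ->; apply: (@addrI _ (d l 0)); rewrite -dD !addr0.
pose eU := GRing.RMorphism.clone _ _ (f \o pU) _ : {rmorphism U -> F}.
pose eM := GRing.RMorphism.clone _ _ (f \o pM) _ : {rmorphism pt_field b -> F}.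
have eUD : diff_emb DU DF eU by move=> l x /=; rewrite -fd dU.
have eMD : diff_emb (@pt_der _ _ _ _ b) DF eM by move=> l x /=; rewrite -fd dL.
pose bU : dpoint DU n := DPoint (eM \o pt_val b) hF eUD.
have evK q : deval (eU \o j) DF (eM \o pt_val b) q = eM (ev b q).
  by rewrite (deval_comp _ _ _ eMD); apply: eq_deval => // k /=; rewrite pj.
have idD : diff_emb DU DU (GRing.RMorphism.clone _ _ (@idfun U) _) by [].
apply: (@irreducible_of_generic _ _ _ _ _ _ _ bU) => q.
  move=> q0 a Va; have [s hs] := dterm_decompose j DU q.
  pose P : dpoint DU n := DPoint a hU idD.
  rewrite -[LHS]/(ev P q) hs.
  move: q0; rewrite hs; under eq_bigr do rewrite evK.
  have -> : \sum_(p <- s) pt_emb bU p.1 * eM (ev b p.2) =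
      f (\sum_(p <- [seq (p.1, ev b p.2) | p <- s]) pU p.1 * pM p.2).
    by rewrite rmorph_sum big_map; apply: eq_bigr => p _; rewrite rmorphM.
  move=> /f0/p0 tz.
  (* Applying [l] to the coefficients gives a term over [K] that vanishes at [b], hence on [V]; a
     dual basis for the coefficients then reassembles [q]. *)
  have lam (l : U -> K) : klinear j l -> \sum_(p <- s) j (l p.1) * deval j DU a p.2 = 0.
    move=> hl; pose g := foldr (fun p acc => DAdd (DMul (DCst _ _ (l p.1)) p.2) acc) (DCst n m 0) s.
    have gE (Q : dpoint D n) : ev Q g = \sum_(p <- s) pt_emb Q (l p.1) * ev Q p.2.
      rewrite /g; elim: (s) => [|p r IH] /=; first by rewrite big_nil /ev /= rmorph0.
      by rewrite big_cons -IH.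
    have /b0/(_ _ Va) : ev b g = 0.
      rewrite gE; have := tz l hl; rewrite /tensor_ev big_map big_nil; exact.
    by rewrite -[LHS]/(ev (DPoint a hU jD) g) gE.
  have [B [Bl BE]] := dual_basis j [seq p.1 | p <- s].
  transitivity (\sum_(w <- B) w.1 * \sum_(p <- s) j (w.2 p.1) * deval j DU a p.2).
    under [RHS]eq_bigr do rewrite mulr_sumr.
    rewrite exchange_big.
    have sub : {subset [seq p.1 | p <- s] <= [seq p.1 | p <- s]} by [].
    move: {1 3 4}s sub; elim=> [|p r IH] sub; first by rewrite !big_nil.
    rewrite !big_cons IH => [|x xr]; last by apply: sub; rewrite inE xr orbT.
    congr (_ + _); rewrite {1}[p.1]BE; last by apply: sub; rewrite mem_head.
    rewrite mulr_suml; apply: eq_bigr => w _ /=.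
    by rewrite mulrAC mulrC.
  have := Bl; elim: (B) => [|w B' IH] hB; first by rewrite big_nil.
  rewrite big_cons IH; last by move=> p hp; apply: hB; right.
  by rewrite lam ?mulr0 ?addr0 //; apply: hB; left.
move=> nq.
have [a [na ha]] := specialize_point U0 hU cU idD nq.
exists a => // p Sp; have := ha (dmap j p).
rewrite deval_dmap => -> //.
rewrite /ev deval_dmap -[LHS]/(deval (eU \o j) DF (eM \o pt_val b) p) evK.
suff -> : ev b p = 0 by rewrite rmorph0.
by apply/b0 => c Vc; apply: Vc.
Qed.

Lemma PAC_strongly_PAC (G : finGroupType) (K : fieldType) (m : nat)
  (D : 'I_m -> K -> K) (s : G -> {rmorphism K -> K}) :
  G_diff_field D s -> PAC_diff D (fixed_field s) -> alg_G_closed s ->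
  K_strongly_PAC_diff D (fixed_field s).
Proof.
move=> HK hPAC hK U DU i cU iD n S SF Sirr.
have [b [t [hb bt _ b0]]] := generic_point HK cU iD SF Sirr.
apply: (hPAC U DU i cU iD n S SF).
apply: (absolutely_irreducible (proj1 HK) (proj1 (proj2 HK)) cU iD _ b0).
have [_ [_ [tG _]]] := hb.
exact: (alg_G_closed_relatively hK tG bt).
Qed.

Lemma irreducible_wrt_sub (K U : fieldType) (m n : nat) (DU : 'I_m -> U -> U)
  (i : K -> U) (V : ('I_n -> U) -> Prop) :
  irreducible_wrt (kclosed (@id U) DU) V -> irreducible_wrt (kclosed i DU) V.
Proof.
move=> [V0 irr]; split=> // A B hA hB; apply: irr.
  have [S hS] := hA; exists (fun p => exists2 q, S q & p = dmap i q) => a.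
  split=> [/hS h p [q Sq ->]|h]; first by rewrite deval_dmap; apply: h.
  by apply/hS => q Sq; rewrite -(h (dmap i q)) ?deval_dmap //; exists q.
have [S hS] := hB; exists (fun p => exists2 q, S q & p = dmap i q) => a.
split=> [/hS h p [q Sq ->]|h]; first by rewrite deval_dmap; apply: h.
by apply/hS => q Sq; rewrite -(h (dmap i q)) ?deval_dmap //; exists q.
Qed.

Theorem theorem4p18 (G : finGroupType) (K : fieldType) (m : nat)
  (D : 'I_m -> K -> K) (s : G -> {rmorphism K -> K})
  (HK : G_diff_field D s) (Hstrict : strict_action s) :
  (ec_G_diff_field D s <-> K_strongly_PAC_diff D (fixed_field s)) /\
  (K_strongly_PAC_diff D (fixed_field s) <->
     PAC_diff D (fixed_field s) /\ alg_G_closed s).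
Proof.
have ec_of := strongly_PAC_ec HK Hstrict.
split; first by split=> [|/ec_of //]; apply: ec_strongly_PAC.
split=> [h|[]]; last exact: PAC_strongly_PAC.
split; last exact: ec_alg_G_closed (ec_of h).
by move=> U DU i cU iD n S SF /(irreducible_wrt_sub i); apply: h.
Qed.
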